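(* Let $G$ be a finite simple graph. The connected subgraph arrangement $\mathcal{A}_G$ is factored if and only if it is inductively factored.
   Context: Let $G=(N,E)$ be a finite simple graph with vertex set $N=[n]$; $H_I:=\ker(\sum_{i\in I}x_i)\subseteq\mathbb{Q}^n$ and $\mathcal{A}_G:=\{H_I\mid \varnothing\neq I\subseteq N,\ G[I]\text{ connected}\}$. For $X$ in the intersection lattice, $\mathcal{A}_X:=\{H\in\mathcal{A}\mid X\subseteq H\}$. A partition $\pi=(\pi_1,\dots,\pi_s)$ of $\mathcal{A}$ is independent if any choice $H_i\in\pi_i$ ($1\le i\le s$) gives hyperplanes with $\mathrm{codim}(H_1\cap\dots\cap H_s)=s$; it is nice (a factorization) if it is independent and for every $X\in L(\mathcal{A})\setminus\{V\}$ the induced partition of $\mathcal{A}_X$ (nonempty blocks $\pi_i\cap\mathcal{A}_X$) has a block which is a singleton; $\mathcal{A}$ is factored if it admits a nice partition. For $H_0\in\mathcal{A}$ let $\mathcal{A}'=\mathcal{A}\setminus\{H_0\}$ and $\mathcal{A}''=\{H\cap H_0\mid H\in\mathcal{A}'\}$ (an arrangement in $H_0$). The class of inductively factored pairs $(\mathcal{A},\pi)$ is the smallest class such that (i) $(\Phi_\ell,(\varnothing))$ (empty arrangement with empty partition) is in it for all $\ell\ge0$; (ii) if $\pi=(\pi_1,\dots,\pi_s)$ is a partition of $\mathcal{A}$ and $H_0\in\pi_1$ is such that the restriction map $\mathcal{A}\setminus\pi_1\to\mathcal{A}''$, $H\mapsto H\cap H_0$, is bijective, and both $(\mathcal{A}',\pi')$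 and $(\mathcal{A}'',\pi'')$ are in the class, where $\pi'$ has the nonempty blocks $\pi_i\cap\mathcal{A}'$ and $\pi''=(\pi''_2,\dots,\pi''_s)$ with $\pi''_i=\{H\cap H_0\mid H\in\pi_i\}$, then $(\mathcal{A},\pi)$ is in the class. $\mathcal{A}$ is inductively factored if $(\mathcal{A},\pi)$ is in the class for some partition $\pi$. *)

(* Defs.v *)
From HB Require Import structures.
From mathcomp Require Import all_boot all_order all_algebra.
From mathcomp Require Import finmap.
Set Implicit Arguments. Unset Strict Implicit. Unset Printing Implicit Defensive.
Import GRing.Theory.
Local Open Scope fset_scope.
Local Open Scope ring_scope.

(* Central hyperplane arrangements are represented inside the fixed ambient
   space Q^n = 'rV[rat]_n.  An arrangement is a pair (W, A): the ambient
   space W (a subspace of Q^n) and a finite set A of hyperplanes of W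
   (subspaces of W of codimension 1 in W).  Restrictions A'' then live in
   the ambient space H0.  A partition is a list of (nonempty, pairwise
   disjoint) blocks covering A. *)

Section Arrangements.
Variable n : nat.
Local Notation V := 'rV[rat]_n.
Local Notation sp := {vspace V}.

Definition cvec (I : {set 'I_n}) : 'cV[rat]_n := \col_j (j \in I)%:R.
Definition HI (I : {set 'I_n}) : sp := lker (linfun (mulmxr (cvec I))).

Definition capS (W : sp) (S : {fset sp}) : sp := \big[@capv _ _/W]_(H <- S) H.

Definition is_hyp (W H : sp) : bool := (H <= W)%VS && ((\dim H).+1 == \dim W).

Definition is_arr (W : sp) (A : {fset sp}) : Prop :=
  forall H, H \in A -> is_hyp W H.

Definition blk (P : seq {fset sp}) (i : nat) : {fset sp} := nth fset0 P i.

Definition is_partition (A : {fset sp}) (P : seq {fset sp}) : Prop :=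
  [/\ forall i, (i < size P)%N -> blk P i != fset0,
      forall i j, (i < size P)%N -> (j < size P)%N -> i <> j ->
                  blk P i `&` blk P j = fset0
    & forall H, H \in A <-> exists2 i, (i < size P)%N & H \in blk P i].

Definition independent (W : sp) (P : seq {fset sp}) : Prop :=
  forall f : nat -> sp,
    (forall i, (i < size P)%N -> f i \in blk P i) ->
    (\dim W - \dim (\big[@capv _ _/W]_(i < size P) f i))%N = size P.

(* nice partition: independent, and for every X in L(A) \ {W}
   (X = intersection of a nonempty subset S of A, X <> W) the induced
   partition of A_X = {H in A | X <= H} has a singleton block *)
Definition nice (W : sp) (A : {fset sp}) (P : seq {fset sp}) : Prop :=
  is_partition A P /\ independent W P /\
  forall S : {fset sp}, S `<=` A -> S != fset0 -> capS W S != W ->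
    exists2 i, (i < size P)%N &
      #|` [fset H in blk P i | (capS W S <= H)%VS] | = 1%N.

Definition factored (W : sp) (A : {fset sp}) : Prop :=
  exists P, nice W A P.

Definition drop_blk (i : nat) (P : seq {fset sp}) : seq {fset sp} :=
  take i P ++ drop i.+1 P.

(* inductively factored pairs ((W, A), pi); the distinguished block of the
   paper ("pi_1") may be any block (blocks are unordered). *)
Inductive IFpair : sp -> {fset sp} -> seq {fset sp} -> Prop :=
| IF_empty (W : sp) : IFpair W fset0 [::]
| IF_step (W : sp) (A : {fset sp}) (P : seq {fset sp}) (i : nat) (H0 : sp) :
    is_arr W A ->
    is_partition A P ->
    (i < size P)%N ->
    H0 \in blk P i ->
    {in A `\` blk P i &, injective (fun H => (H :&: H0)%VS)} ->
    [fset (H :&: H0)%VS | H in A `\` blk P i] =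
      [fset (H :&: H0)%VS | H in A `\ H0] ->
    IFpair W (A `\ H0) [seq B `\ H0 | B <- P & B `\ H0 != fset0] ->
    IFpair H0 [fset (H :&: H0)%VS | H in A `\ H0]
              [seq [fset (H :&: H0)%VS | H in B] | B <- drop_blk i P] ->
    IFpair W A P.

Definition ind_factored (W : sp) (A : {fset sp}) : Prop :=
  exists P, IFpair W A P.

(* finite simple graph on vertex set 'I_n given by a symmetric irreflexive
   relation e; G[I] connected *)
Definition induced_connected (e : rel 'I_n) (I : {set 'I_n}) : bool :=
  [forall x in I, forall y in I,
     connect [rel a b | [&& e a b, a \in I & b \in I]] x y].

Definition AG (e : rel 'I_n) : {fset sp} :=
  [fset HI I | I in [seq I <- enum {set 'I_n} |
                     (I != set0) && induced_connected e I]].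

End Arrangements.

(* Main.v *)
(* Localizing at rank two, a nice partition of A_G becomes a coloring of the
   connected vertex sets in which, for disjoint adjacent connected sets I and J,
   exactly two of I, J and their union have the same color, while two connected sets whose
   hyperplanes span a flat with no third hyperplane have different colors.
   Merging vertices into connected sets preserves such colorings, and the claw,
   the 4-cycle, the diamond, K4 and the butterfly (two triangles sharing a vertex)
   admit none. A connected graph having none of these as an induced minor is a
   path or a triangle with a path attached at one of its vertices.

   In both cases the arrangement is inductively factored. For a path it is the
   braid arrangement. For a tailed triangle, suitable coordinates a, b, c_2, c_3, ...
   turn it into the arrangement of the forms
     a, b ± a, b + c_i, c_k - c_j, c_k ± a, c_k - b.
   Without b + c_k for the last k it is a modular extension of the previous member
   of the family; restricting to c_k = - b gives the previous member with b added,
   and the family with b is closed under the same two operations. Disconnected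
   graphs are handled by products. The converse implication holds for all
   arrangements. *)

Require Import Defs.
From HB Require Import structures.
From mathcomp Require Import all_boot all_order all_algebra.
From mathcomp Require Import finmap zify ring.
Set Implicit Arguments. Unset Strict Implicit. Unset Printing Implicit Defensive.
Import GRing.Theory.

(** * Inductively factored pairs *)

Section Pairs.
Local Open Scope fset_scope.
Local Open Scope ring_scope.
Variable n : nat.
Local Notation V := 'rV[rat]_n.
Local Notation sp := {vspace V}.
Local Notation cut U A := [fset (H :&: U)%VS | H in A].
Implicit Types (A B : {fset sp}) (P Q X Y : seq {fset sp}) (H T U W : sp).

(** The characteristic vectors of two sets span at most one further characteristic vector, so a
    rank-two flat of [AG] lies on at most three hyperplanes. Independence forbids three colors on
    such a flat, the singleton block forbids a single one. The resulting condition mentions only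
    connectedness, disjointness, inclusion, unions and differences, all preserved when vertices are
    replaced by disjoint connected sets. It thus passes to induced minors without restricting any
    arrangement, and the five excluded graphs are left to an exhaustive search. The obstacle on the
    other side is the triangle: its blocks have sizes 1, 3, 3, so supersolvability would need four
    hyperplanes through a rank-two flat, and modular steps alone cannot build it. The restriction to
    [b + c_k = 0] leaves the connected subgraph arrangements (for the triangle it is four lines in a
    plane). Hence the induction runs over a family of linear forms on an arbitrary subspace, with a
    flag for the form [b]. *)

(** Index-free form of [is_partition]: [has] and [pairwise] distribute over [++], which suits
    singling out a block in [X ++ B :: Y]. *)
Definition part A P : Prop :=
  [/\ fset0 \notin P, pairwise (fun B C : {fset sp} => B `&` C == fset0) P
    & forall H, (H \in A) = has (fun B : {fset sp} => H \in B) P].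

Lemma partE A P : is_partition A P <-> part A P.
Proof.
split=> [[h1 h2 h3]|[h1 /(pairwiseP fset0) h2 h3]]; split.
- by apply/(nthP fset0) => -[i ip h]; move: (h1 i ip); rewrite /blk h eqxx.
- apply/(pairwiseP fset0) => i j ip jp ij; apply/eqP/h2 => // e.
  by move: ij; rewrite e ltnn.
- move=> H; apply/idP/idP => [/h3[i ip Hi]|].
    by apply/hasP; exists (blk P i); rewrite ?mem_nth.
  by case/(has_nthP fset0) => i ip Hi; apply/h3; exists i.
- move=> i ip; apply/negP => /eqP h; move/negP: h1; apply.
  by rewrite -h mem_nth.
- move=> i j ip jp ij; case: (ltngtP i j) => // lij.
    exact/eqP/h2.
  by rewrite fsetIC; apply/eqP/h2.
- move=> H; rewrite h3; split=> [/(has_nthP fset0)[i ip Hi]|[i ip Hi]].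
    by exists i.
  by apply/(has_nthP fset0); exists i.
Qed.

Lemma part_mem A P B H : part A P -> B \in P -> H \in B -> H \in A.
Proof. by case=> _ _ h3 BP HB; rewrite h3; apply/hasP; exists B. Qed.

Lemma IFpair_arr W A P : IFpair W A P -> is_arr W A.
Proof. by case=> // {}W H; rewrite in_fset0. Qed.

Lemma IFpair_part W A P : IFpair W A P -> part A P.
Proof.
case=> [{}W|W0 A0 P0 i H0 _ /partE //]; split=> //= H.
Qed.

Lemma cut_cut U1 U2 A : cut U2 (cut U1 A) = cut (U1 :&: U2)%VS A.
Proof.
apply/fsetP => H; apply/imfsetP/imfsetP => /= -[K].
  by case/imfsetP => L /= LA -> ->; exists L; rewrite ?capvA.
move=> KA ->; exists (K :&: U1)%VS; last by rewrite capvA.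
by apply/imfsetP; exists K.
Qed.

Lemma drop_blk_cat X B Y : drop_blk (size X) (X ++ B :: Y) = X ++ Y.
Proof.
by rewrite /drop_blk take_size_cat // -cat_rcons drop_size_cat // size_rcons.
Qed.

Lemma blk_cat X B Y : blk (X ++ B :: Y) (size X) = B.
Proof. by rewrite /blk nth_cat ltnn subnn. Qed.

Lemma fsetD1_id A H : H \notin A -> A `\ H = A.
Proof.
move=> HA; apply/fsetP => K; rewrite !inE.
by case: eqP => // ->; rewrite (negbTE HA).
Qed.

(** Addition in constructive form: [B] is the block of [H0] before [H0] joins it, and [nseq] omits
    it when empty, as deletion does. The hypothesis on [B] makes the traces of the other blocks
    exhaust the restriction. Injectivity is asked only within one block, because traces from
    different blocks lie in disjoint blocks of the restricted partition. *)
Lemma IF_add W A B X Y H0 :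
  is_hyp W H0 -> H0 \notin A ->
  IFpair W A (X ++ nseq (B != fset0) B ++ Y) ->
  (forall H : sp, H \in B -> exists K : sp,
     [/\ K \in A, K \notin B & (H :&: H0)%VS = (K :&: H0)%VS]) ->
  (forall C : {fset sp}, C \in X ++ Y -> {in C &, injective (fun H => (H :&: H0)%VS)}) ->
  IFpair H0 (cut H0 A) [seq cut H0 C | C <- X ++ Y] ->
  IFpair W (H0 |` A) (X ++ (H0 |` B) :: Y).
Proof.
move=> hH0 H0A IFA BK inj IFB.
have pA := IFpair_part IFA; have pB := IFpair_part IFB.
have PE : (X ++ nseq (B != fset0) B ++ Y : seq {fset sp}) =i
          (if B != fset0 then B :: X ++ Y else X ++ Y).
  by move=> C; case: ifP => //= _; rewrite !(mem_cat, inE) orbCA.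
have memA H : (H \in A) = (H \in B) || has (fun C : {fset sp} => H \in C) (X ++ Y).
  case: pA => _ _ ->; rewrite !has_cat; case: eqP => [->|_] /=.
    by rewrite ?in_fset0.
  by rewrite orbF orbCA.
have CA (C : {fset sp}) : C \in X ++ Y -> {subset C <= A}.
  move=> CXY H HC; rewrite memA; apply/orP; right; apply/hasP.
  by exists C.
have CN (C : {fset sp}) : C \in X ++ Y -> C != fset0.
  move=> CXY; apply/negP => /eqP e; case: pA => + _ _; rewrite PE -e.
  by case: ifP => _; rewrite ?inE CXY ?orbT.
have BA : {subset B <= A} by move=> H HB; rewrite memA HB.
have AB H : H \in A -> H \notin B -> has (fun C : {fset sp} => H \in C) (X ++ Y).
  by rewrite memA => /orP[->|].
have AX H : has (fun C : {fset sp} => H \in C) (X ++ Y) -> H \in A /\ H \notin B.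
  move=> h; rewrite memA h orbT; split=> //; apply/negP => HB.
  have := pA; rewrite /part; have -> : (B != fset0) by apply/fset0Pn; exists H.
  case=> _ + _; rewrite pairwise_cat allrel_catr /= => /and3P[/andP[h1 _] _].
  move=> /andP[h2 _].
  move: h; rewrite has_cat => /orP[] /hasP[C CX HC].
    move/allrelP: h1 => /(_ C B CX (mem_head _ _)) /eqP/fsetP/(_ H).
    by rewrite !inE HC HB.
  by move/allP: h2 => /(_ C CX)/eqP/fsetP/(_ H); rewrite !inE HC HB.
have AD : (H0 |` A) `\ H0 = A.
  by apply/fsetP => K; rewrite !inE; case: eqP => // -> /=; rewrite (negbTE H0A).
have AD' : (H0 |` A) `\` (H0 |` B) = A `\` B.
  apply/fsetP => K; rewrite !inE; case: eqP => [->|] //=.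
  by rewrite (negbTE H0A) andbF.
have BD : (H0 |` B) `\ H0 = B.
  apply/fsetP => K; rewrite !inE; case: eqP => //= ->.
  by apply/esym/negP => /BA; rewrite (negbTE H0A).
apply: (@IF_step _ W _ _ (size X) H0).
- by move=> H; rewrite !inE => /orP[/eqP->//|]; apply: (IFpair_arr IFA).
- apply/partE; split.
  + rewrite mem_cat inE !negb_or; apply/and3P; split.
    * by apply/negP => h; move: (CN fset0); rewrite mem_cat h eqxx => /(_ isT).
    * by rewrite eq_sym; apply/fset0Pn; exists H0; rewrite !inE eqxx.
    * by apply/negP => h; move: (CN fset0); rewrite mem_cat h orbT eqxx => /(_ isT).
  + have dB (C : {fset sp}) : C \in X ++ Y -> C `&` (H0 |` B) == fset0.
      move=> CXY; apply/eqP/fsetP => K; rewrite !inE.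
      apply/negP => /andP[KC /orP[/eqP e|KB]].
        by move: H0A; rewrite -e (CA C).
      have /AX[_] : has (fun C : {fset sp} => K \in C) (X ++ Y) by apply/hasP; exists C.
      by rewrite KB.
    have : pairwise (fun B C : {fset sp} => B `&` C == fset0) (X ++ Y).
      case: pA => _ + _; apply: subseq_pairwise.
      by apply: cat_subseq => //; apply: suffix_subseq.
    rewrite !pairwise_cat /= allrel_consr => /and3P[-> -> ->].
    rewrite !andbT /=; apply/andP; split; apply/allP => C CX.
      by apply: dB; rewrite mem_cat CX.
    by rewrite fsetIC; apply: dB; rewrite mem_cat CX orbT.
  + move=> H; rewrite in_fset1U memA !has_cat /= in_fset1U.
    by case: (H == H0); case: (H \in B); rewrite ?orbT /= ?orbT.
- by rewrite size_cat /=; lia.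
- by rewrite blk_cat !inE eqxx.
- rewrite blk_cat AD' => H K; rewrite !in_fsetD => /andP[HB HA] /andP[KB KA] e.
  have /hasP[C CX HC] := AB H HA HB; have /hasP[D DX KD] := AB K KA KB.
  case: (C =P D) => [eCD|neCD]; first by apply: (inj C) => //; rewrite eCD.
  exfalso; case: pB => _ + _ => /(pairwiseP fset0) h.
  have [iC iD] := (index_mem C (X ++ Y), index_mem D (X ++ Y)).
  have ne : index C (X ++ Y) <> index D (X ++ Y).
    move=> e'; apply: neCD; rewrite -(nth_index fset0 CX) e'.
    by rewrite (nth_index fset0 DX).
  have wl i j : (i < j)%N -> (j < size (X ++ Y))%N ->
     forall L, L \in cut H0 (nth fset0 (X ++ Y) i) ->
     L \in cut H0 (nth fset0 (X ++ Y) j) -> False.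
    move=> ij js L L1 L2; have is_ := ltn_trans ij js.
    have := h i j; rewrite !inE size_map => /(_ is_ js ij).
    rewrite !(nth_map fset0) // => /eqP/fsetP/(_ L).
    by rewrite in_fsetI L1 L2 in_fset0.
  have m1 : (H :&: H0)%VS \in cut H0 (nth fset0 (X ++ Y) (index C (X ++ Y))).
    by rewrite nth_index //; apply/imfsetP; exists H.
  have m2 : (H :&: H0)%VS \in cut H0 (nth fset0 (X ++ Y) (index D (X ++ Y))).
    by rewrite nth_index // e; apply/imfsetP; exists K.
  case: (ltngtP (index C (X ++ Y)) (index D (X ++ Y))) => // lt.
    by apply: (wl _ _ lt _ _ m1 m2); rewrite index_mem.
  by apply: (wl _ _ lt _ _ m2 m1); rewrite index_mem.
- rewrite blk_cat AD AD'; apply/fsetP => L; apply/imfsetP/imfsetP => /= -[H].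
    by rewrite in_fsetD => /andP[_ HA] ->; exists H.
  move=> HA ->; case: (boolP (H \in B)) => HB.
    by have [K [KA KB ->]] := BK H HB; exists K; rewrite ?in_fsetD ?KA ?KB.
  by exists H; rewrite ?in_fsetD ?HB ?HA.
- rewrite AD filter_cat map_cat /= BD.
  have fx Z : {subset Z <= X ++ Y} ->
     [seq B0 `\ H0 | B0 <- Z & B0 `\ H0 != fset0] = Z.
    move=> ZXY; have ZD (C : {fset sp}) : C \in Z -> C `\ H0 = C.
      move=> /ZXY CX; apply: fsetD1_id.
      by apply/negP => /(CA _ CX); apply/negP.
    have -> : [seq B0 <- Z | B0 `\ H0 != fset0] = Z.
      by apply/all_filterP/allP => C CZ; rewrite ZD // CN // ZXY.
    by rewrite -[RHS]map_id; apply/eq_in_map => C /ZD.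
  rewrite fx => [|C CX]; last by rewrite mem_cat CX.
  by case: (eqVneq B fset0) IFA => [->|nB] /= IFA;
    rewrite ?BD fx // => C CX; rewrite mem_cat CX orbT.
- by rewrite AD drop_blk_cat.
Qed.

(** Every [IF_step] is an instance of [IF_add]. Induction in this form replaces [drop_blk] and the
    filtered partition by a visible splitting around the block of [H0], so later inductions avoid
    block indices. *)
Lemma IFpair_add_ind (Q : sp -> {fset sp} -> seq {fset sp} -> Prop) :
  (forall W, Q W fset0 [::]) ->
  (forall W A B X Y H0,
    is_hyp W H0 -> H0 \notin A ->
    IFpair W A (X ++ nseq (B != fset0) B ++ Y) ->
    Q W A (X ++ nseq (B != fset0) B ++ Y) ->
    (forall H, H \in B -> exists K : sp,
       [/\ K \in A, K \notin B & (H :&: H0)%VS = (K :&: H0)%VS]) ->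
    (forall C, C \in X ++ Y -> {in C &, injective (fun H => (H :&: H0)%VS)}) ->
    IFpair H0 (cut H0 A) [seq cut H0 C | C <- X ++ Y] ->
    Q H0 (cut H0 A) [seq cut H0 C | C <- X ++ Y] ->
    Q W (H0 |` A) (X ++ (H0 |` B) :: Y)) ->
  forall W A P, IFpair W A P -> Q W A P.
Proof.
move=> Q0 QS W A P.
elim=> [{A P}{}W|{A P}{}W A P i H0 arrA /partE pA ip H0i inj img IF1 IH1 IF2 IH2].
  exact: Q0.
set X := take i P; set Y := drop i.+1 P; set B := blk P i `\ H0.
have PE : P = X ++ blk P i :: Y by rewrite -drop_nth // cat_take_drop.
have BP : blk P i \in P by rewrite mem_nth.
have H0A : H0 \in A by apply: part_mem pA BP H0i.
have BE : H0 |` B = blk P i by rewrite fsetD1K.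
have disj C : C \in X ++ Y -> forall H, H \in C -> H \in A /\ H \notin blk P i.
  move=> CXY H HC; split.
    apply: (part_mem pA _ HC); rewrite PE mem_cat inE.
    by move: CXY; rewrite mem_cat => /orP[]->; rewrite ?orbT.
  case: pA => _ + _; rewrite PE pairwise_cat allrel_consr /=.
  rewrite -PE => /and3P[/andP[/allP h1 _] _ /andP[/allP h2 _]].
  apply/negP => HB; move: CXY; rewrite mem_cat => /orP[/h1|/h2] /eqP/fsetP/(_ H).
    by rewrite in_fsetI HC HB.
  by rewrite in_fsetI HC HB.
have flt : [seq D `\ H0 | D <- P & D `\ H0 != fset0]
         = X ++ nseq (B != fset0) B ++ Y.
  rewrite {1}PE filter_cat map_cat /=.
  have fx Z : {subset Z <= X ++ Y} ->
     [seq B0 `\ H0 | B0 <- Z & B0 `\ H0 != fset0] = Z.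
    move=> ZXY; have ZD C : C \in Z -> C `\ H0 = C.
      move=> /ZXY CX; apply: fsetD1_id.
      by apply/negP => /(disj _ CX)[_]; rewrite H0i.
    have -> : [seq B0 <- Z | B0 `\ H0 != fset0] = Z.
      apply/all_filterP/allP => C CZ; rewrite ZD //; case: pA => h _ _.
      apply/negP => /eqP e; move/negP: h; apply; rewrite -e PE mem_cat inE.
      by move: (ZXY _ CZ); rewrite mem_cat => /orP[]->; rewrite ?orbT.
    by rewrite -[RHS]map_id; apply/eq_in_map => C /ZD.
  rewrite fx => [|C CX]; last by rewrite mem_cat CX.
  rewrite -/B; case: (eqVneq B fset0) => [e|nB] /=;
    by rewrite -/B fx // => C CX; rewrite mem_cat CX orbT.
rewrite flt in IF1 IH1; rewrite PE -BE -{1}(fsetD1K H0A).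
apply: QS => //.
- exact: arrA.
- by rewrite fsetD11.
- move=> H; rewrite in_fsetD1 => /andP[nH HB].
  have : (H :&: H0)%VS \in cut H0 (A `\ H0).
    by apply/imfsetP; exists H; rewrite ?in_fsetD1 ?nH ?(part_mem pA BP).
  rewrite -img => /imfsetP[/= K]; rewrite in_fsetD => /andP[KB KA] e.
  exists K; rewrite !in_fsetD1 (negbTE KB) andbF; split=> //.
  by rewrite KA andbT; apply: contraNneq KB => ->.
- move=> C CXY H K HC KC; apply: inj.
    by have [HA HB] := disj _ CXY _ HC; rewrite in_fsetD HA HB.
  by have [KA KB] := disj _ CXY _ KC; rewrite in_fsetD KA KB.
Qed.

End Pairs.

(** * Restriction to a subspace transversal to the center *)

Section Transfer.
Local Open Scope fset_scope.
Local Open Scope ring_scope.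
Variable n : nat.
Local Notation V := 'rV[rat]_n.
Local Notation sp := {vspace V}.
Local Notation cut U A := [fset (H :&: U)%VS | H in A].
Implicit Types (A B C : {fset sp}) (P Q X Y : seq {fset sp}) (H K T U W : sp).

Section Transversal.
Variables W U T : sp.
Hypotheses (UW : (U <= W)%VS) (UTW : (U + T)%VS = W).

(** Modular law: adding [T] undoes the cut with [U], so subspaces containing [T] are determined by
    their traces on [U]. *)
Lemma capU_addT H : (T <= H)%VS -> (H <= W)%VS -> (H :&: U + T)%VS = H.
Proof.
move=> TH HW; rewrite capvC addvC vspace_modl // addvC UTW.
by apply/capv_idPr.
Qed.

Lemma capU_inj H K : (T <= H)%VS -> (H <= W)%VS -> (T <= K)%VS -> (K <= W)%VS ->
  (H :&: U)%VS = (K :&: U)%VS -> H = K.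
Proof. by move=> TH HW TK KW e; rewrite -(capU_addT TH HW) e capU_addT. Qed.

Lemma capU_hyp H : (T <= H)%VS -> is_hyp W H -> is_hyp U (H :&: U)%VS.
Proof.
move=> TH /andP[HW /eqP dH]; rewrite /is_hyp capvSr /=.
have HU : (H + U)%VS = W.
  apply/eqP; rewrite eqEsubv; apply/andP; split; first by rewrite subv_add HW.
  by rewrite -[X in (X <= _)%VS]UTW addvC; apply: addvS.
have := dimv_sum_cap H U; rewrite HU => h; apply/eqP; lia.
Qed.

End Transversal.

(** Adding [T] recovers what [U] cuts off, so the trace on [U] is an isomorphic copy of the
    arrangement. [U] and [T] stay quantified in the induction because the restricted pair has to be
    transferred to [H0 :&: U]. *)
Lemma IF_transfer W A P : IFpair W A P ->
  forall U T, (U <= W)%VS -> (U + T)%VS = W -> {in A, forall H, (T <= H)%VS} ->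
  IFpair U (cut U A) [seq cut U B | B <- P].
Proof.
elim/IFpair_add_ind => {W A P} [W|].
  by move=> U T _ _ _; rewrite imfset0 /=; apply: IF_empty.
move=> W A B X Y H0 hH0 H0A IF1 IH1 BK inj IF2 IH2 U T UW UTW TA.
have TH0 : (T <= H0)%VS by apply: TA; rewrite in_fset1U eqxx.
have {}TA : {in A, forall H, (T <= H)%VS}.
  by move=> H HA; apply: TA; rewrite in_fset1U HA orbT.
have H0W : (H0 <= W)%VS by case/andP: hH0.
have AW H : H \in A -> (H <= W)%VS by move/(IFpair_arr IF1)/andP=> [].
have pA := IFpair_part IF1.
have BA : {subset B <= A}.
  move=> H HB; apply: (part_mem pA _ HB); rewrite !mem_cat mem_nseq eqxx.
  suff -> : B != fset0 by rewrite orbT.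
  by apply/fset0Pn; exists H.
have XYA C : C \in X ++ Y -> {subset C <= A}.
  move=> CX H; apply: (part_mem pA); move: CX; rewrite !mem_cat.
  by case/orP=> ->; rewrite ?orbT.
have cut0 C : (cut U C != fset0) = (C != fset0).
  by apply/fset0Pn/fset0Pn => -[H]; [case/imfsetP => K; exists K|
     exists (H :&: U)%VS; apply/imfsetP; exists H].
have capc H : (H :&: U :&: (H0 :&: U))%VS = (H :&: H0 :&: U)%VS.
  by rewrite -!capvA [(U :&: _)%VS]capvC -!capvA capvv.
have cutcut C : 
    cut (H0 :&: U)%VS (cut U C) = cut (H0 :&: U)%VS (cut H0 C).
  by rewrite !cut_cut [(U :&: _)%VS]capvC -capvA capvv capvA capvv.
rewrite imfsetU1 map_cat /= imfsetU1; apply: IF_add.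
- exact: (capU_hyp UW UTW).
- apply/negP => /imfsetP[/= H HA e]; move: H0A.
  by rewrite (capU_inj UTW TH0 H0W (TA _ HA) (AW _ HA) e) HA.
- by have := IH1 U T UW UTW TA; rewrite !map_cat map_nseq cut0.
- move=> L /imfsetP[/= H HB ->]; have [M [MA MB e]] := BK H HB.
  exists (M :&: U)%VS; rewrite !capc e; split=> //.
    by apply/imfsetP; exists M.
  apply/negP => /imfsetP[/= N NB e']; move: MB.
  have [NA TM] := (BA _ NB, TA _ MA).
  by rewrite (capU_inj UTW TM (AW _ MA) (TA _ NA) (AW _ NA) e') NB.
- move=> D; rewrite -map_cat => /mapP[C CXY ->].
  move=> L M /imfsetP[/= H HC ->] /imfsetP[/= N NC ->]; rewrite !capc => e.
  congr (_ :&: U)%VS; apply: (inj C) => //.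
  have cW L0 : L0 \in A -> (L0 :&: H0 <= W)%VS.
    by move=> /AW; apply: subv_trans (capvSl _ _).
  have [HA NA] := (XYA _ CXY _ HC, XYA _ CXY _ NC).
  by apply: (capU_inj UTW) e; rewrite ?cW ?subv_cap ?TH0 ?TA.
- rewrite cutcut -map_cat.
  have -> : [seq cut (H0 :&: U)%VS C | C <- [seq cut U C | C <- X ++ Y]] =
    [seq cut (H0 :&: U)%VS C | C <- [seq cut H0 C | C <- X ++ Y]].
    by rewrite -!map_comp; apply: eq_map => C /=; apply: cutcut.
  (* Together with the same [T], the subspace [H0 :&: U] spans [H0], by the modular law. *)
  apply: (IH2 _ T).
  + exact: capvSl.
  + by apply: (capU_addT UTW).
  + by move=> L /imfsetP[/= H HA ->]; rewrite subv_cap TA.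
Qed.

End Transfer.

(** * Products, linear forms and modular extensions *)

Section Forms.
Local Open Scope fset_scope.
Local Open Scope ring_scope.
Variable n : nat.
Local Notation V := 'rV[rat]_n.
Local Notation sp := {vspace V}.
Local Notation form := 'cV[rat]_n.
Local Notation cut U A := [fset (H :&: U)%VS | H in A].
Implicit Types (A B C : {fset sp}) (P Q X Y : seq {fset sp}) (H K T U W : sp).
Implicit Types (f g h : form) (fs : seq form) (w t : V).

Lemma hyp_proper W H : is_hyp W H -> ~~ (W <= H)%VS.
Proof.
by case/andP=> HW /eqP d; apply/negP => /dimvS; rewrite -d ltnn.
Qed.

Lemma hyp_addv W H T : is_hyp W H -> (T <= W)%VS -> ~~ (T <= H)%VS ->
  (H + T)%VS = W.
Proof.
move=> /andP[HW /eqP d] TW TH.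
have HTW : (H + T <= W)%VS by rewrite subv_add HW.
apply/eqP; rewrite eqEdim HTW -d ltn_neqAle dimvS ?addvSl // andbT.
apply: contra TH => /eqP e; have /eqP -> : (H == H + T)%VS.
  by rewrite eqEdim addvSl -e leqnn.
exact: addvSr.
Qed.

(** Induction on the first factor. [H0] contains [T1], hence not [T2], since [T1 + T2] is all of
    [W]. So [H0] and [T2] span [W], and the second factor restricts to [H0] isomorphically, while
    deletion of [H0] leaves it alone. *)
Lemma IF_product W A1 P1 : IFpair W A1 P1 ->
  forall A2 P2 T1 T2, (T1 + T2)%VS = W ->
  {in A1, forall H, (T1 <= H)%VS} -> {in A2, forall H, (T2 <= H)%VS} ->
  IFpair W A2 P2 -> IFpair W (A1 `|` A2) (P1 ++ P2).
Proof.
elim/IFpair_add_ind => {W A1 P1} [W A2 P2 T1 T2 _ _ _|].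
  by rewrite fset0U.
move=> W A B X Y H0 hH0 H0A IF1 IH1 BK inj IF2 IH2 A2 P2 T1 T2 TW T1A T2A IFA2.
have T1H0 : (T1 <= H0)%VS by apply: T1A; rewrite in_fset1U eqxx.
have T1A' : {in A, forall H, (T1 <= H)%VS}.
  by move=> H HA; apply: T1A; rewrite in_fset1U HA orbT.
have T2W : (T2 <= W)%VS by rewrite -TW addvSr.
have T2H0 : ~~ (T2 <= H0)%VS.
  apply/negP => h; move: (hyp_proper hH0); rewrite -TW.
  by rewrite subv_add T1H0 h.
have HT2 : (H0 + T2)%VS = W by apply: hyp_addv.
have H0W : (H0 <= W)%VS by case/andP: hH0.
rewrite -catA cat_cons -fsetUA; apply: IF_add => //.
- rewrite in_fsetU negb_or H0A; apply/negP => /T2A.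
  by rewrite (negbTE T2H0).
- by have := IH1 _ _ _ _ TW T1A' T2A IFA2; rewrite -!catA.
- move=> H /BK[K [KA KB e]]; exists K; split=> //.
  by rewrite in_fsetU KA.
- move=> C; rewrite catA mem_cat => /orP[/inj //|CP2] H K HC KC.
  have pA2 := IFpair_part IFA2.
  have HA := part_mem pA2 CP2 HC; have KA := part_mem pA2 CP2 KC.
  have a2W L : L \in A2 -> (L <= W)%VS by move/(IFpair_arr IFA2)/andP=> [].
  by apply: (capU_inj HT2); rewrite ?a2W ?T2A.
- rewrite catA map_cat imfsetU.
  (* Inside [H0] the two directions become [T1] and [T2 :&: H0], which span [H0] by the modular
     law. *)
  apply: (IH2 _ _ T1 (T2 :&: H0)%VS).
  + by rewrite vspace_modl // TW; apply/capv_idPr.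
  + by move=> L /imfsetP[/= H HA ->]; rewrite subv_cap T1A'.
  + by move=> L /imfsetP[/= H HA ->]; rewrite capvS ?T2A.
  + exact: (IF_transfer IFA2 H0W HT2).
Qed.

Definition ev f w : rat := (w *m f) 0 0.
Definition kerf f : sp := lker (linfun (mulmxr f)).
(** Equal to [W] when [f] vanishes on [W]; that it is a hyperplane is always certified by a vector
    of [W] where [f] is nonzero. *)
Definition hyp W f : sp := (W :&: kerf f)%VS.
Definition arr W fs : {fset sp} := [fset hyp W f | f in fs].

Lemma evDl f g w : ev (f + g) w = ev f w + ev g w.
Proof. by rewrite /ev mulmxDr mxE. Qed.
Lemma evNl f w : ev (- f) w = - ev f w.
Proof. by rewrite /ev mulmxN mxE. Qed.
Lemma evBl f g w : ev (f - g) w = ev f w - ev g w.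
Proof. by rewrite evDl evNl. Qed.
Lemma evZl a f w : ev (a *: f) w = a * ev f w.
Proof. by rewrite /ev -scalemxAr mxE. Qed.
Lemma ev0l w : ev 0 w = 0.
Proof. by rewrite /ev mulmx0 mxE. Qed.
Lemma evDr f w t : ev f (w + t) = ev f w + ev f t.
Proof. by rewrite /ev mulmxDl mxE. Qed.
Lemma evNr f w : ev f (- w) = - ev f w.
Proof. by rewrite /ev mulNmx mxE. Qed.
Lemma evBr f w t : ev f (w - t) = ev f w - ev f t.
Proof. by rewrite evDr evNr. Qed.
Lemma evZr a f w : ev f (a *: w) = a * ev f w.
Proof. by rewrite /ev -scalemxAl mxE. Qed.
Definition evE := (evDl, evNl, evZl, ev0l, evDr, evNr, evZr).

Lemma mem_kerf f w : (w \in kerf f) = (ev f w == 0).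
Proof.
rewrite memv_ker lfunE /= /ev; apply/eqP/eqP => [->|e]; first by rewrite mxE.
by apply/matrixP => i j; rewrite !ord1 e mxE.
Qed.

Lemma mem_hyp W f w : (w \in hyp W f) = (w \in W) && (ev f w == 0).
Proof. by rewrite memv_cap mem_kerf. Qed.

Lemma hyp_sub W f : (hyp W f <= W)%VS. Proof. exact: capvSl. Qed.

Lemma hyp_is_hyp W f w : w \in W -> ev f w != 0 -> is_hyp W (hyp W f).
Proof.
move=> wW fw; rewrite /is_hyp hyp_sub /=.
have w0 : w != 0 by apply: contraNneq fw => ->; rewrite /ev mul0mx mxE.
have dis : (hyp W f :&: <[w]> = 0)%VS.
  apply/eqP; rewrite -subv0; apply/subvP => x; rewrite memv_cap mem_hyp.
  case/andP=> /andP[_ fx] /vlineP[k e]; move: fx; rewrite e evZr mulf_eq0.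
  by rewrite (negbTE fw) orbF => /eqP ->; rewrite scale0r mem0v.
have HW : (hyp W f + <[w]>)%VS = W.
  apply/eqP; rewrite eqEsubv subv_add hyp_sub -memvE wW /=.
  apply/subvP => x xW; rewrite -(subrK ((ev f x / ev f w) *: w) x).
  apply: memv_add; last by apply/vlineP; eexists.
  by rewrite mem_hyp rpredB ?rpredZ //= !evE divfK ?subrr.
by rewrite -[in X in _ == X]HW dimv_disjoint_sum // dim_vline w0 addn1.
Qed.

Lemma is_hypP W f : is_hyp W (hyp W f) -> exists2 w, w \in W & ev f w != 0.
Proof.
move/hyp_proper/subvPn => [w wW]; rewrite mem_hyp wW /= => fw.
by exists w.
Qed.

Lemma eq_hyp W f g : (forall w, w \in W -> (ev f w == 0) = (ev g w == 0)) ->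
  hyp W f = hyp W g.
Proof.
move=> h; apply/eqP; rewrite eqEsubv; apply/andP.
by split; apply/subvP => w; rewrite !mem_hyp => /andP[wW]; rewrite wW h.
Qed.

Lemma hyp_scale W c f : c != 0 -> hyp W (c *: f) = hyp W f.
Proof. by move=> c0; apply: eq_hyp => w _; rewrite evZl mulf_eq0 (negbTE c0). Qed.

Lemma hyp_opp W f : hyp W (- f) = hyp W f.
Proof. by rewrite -scaleN1r hyp_scale. Qed.

Lemma hyp_cut W f g : (hyp W f :&: hyp W g)%VS = hyp (hyp W g) f.
Proof.
apply/vspaceP => w; rewrite memv_cap !mem_hyp.
by case: (w \in W) => //=; rewrite andbC.
Qed.

(** Subtracting [ev f w *: t] from [w] lands in the common kernel. Forms normalized at one vector
    thus have equal hyperplanes only if they agree on [W], which is how distinct forms are shown to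
    give distinct hyperplanes. *)
Lemma norm_inj W f g t : t \in W -> ev f t = 1 -> ev g t = 1 ->
  hyp W f = hyp W g -> {in W, ev f =1 ev g}.
Proof.
move=> tW ft gt e w wW.
have : w - ev f w *: t \in hyp W f.
  by rewrite mem_hyp rpredB ?rpredZ //= !evE ft mulr1 subrr.
rewrite e mem_hyp => /andP[_]; rewrite !evE gt mulr1 subr_eq0 => /eqP.
by move=> ->.
Qed.

Lemma mem_arr W fs f : f \in fs -> hyp W f \in arr W fs.
Proof. by move=> ffs; apply/imfsetP; exists f. Qed.

Lemma arrP W fs H : reflect (exists2 f, f \in fs & H = hyp W f) (H \in arr W fs).
Proof. exact: imfsetP. Qed.

Lemma arr_cons W f fs : arr W (f :: fs) = hyp W f |` arr W fs.
Proof.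
apply/fsetP => H; rewrite in_fset1U; apply/arrP/orP.
  case=> g; rewrite inE => /orP[/eqP ->|gfs] ->; first by left.
  by right; apply: mem_arr.
case=> [/eqP->|/arrP[g gfs ->]]; first by exists f; rewrite ?inE ?eqxx.
by exists g; rewrite // inE gfs orbT.
Qed.

Lemma arr_nil W : arr W [::] = fset0.
Proof. by apply/fsetP => H; rewrite in_fset0; apply/negP => /arrP[]. Qed.

Lemma arr_cat W fs gs : arr W (fs ++ gs) = arr W fs `|` arr W gs.
Proof.
elim: fs => [|f fs IH] /=; last by rewrite !arr_cons IH fsetUA.
by rewrite arr_nil fset0U.
Qed.

Lemma arr_eq0 W fs : (arr W fs != fset0) = (fs != [::]).
Proof.
case: fs => [|f fs]; first by rewrite arr_nil eqxx.
by apply/fset0Pn; exists (hyp W f); rewrite mem_arr ?mem_head.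
Qed.

Lemma cut_arr W g fs : cut (hyp W g) (arr W fs) = arr (hyp W g) fs.
Proof.
elim: fs => [|f fs IH]; first by rewrite !arr_nil imfset0.
by rewrite !arr_cons imfsetU1 IH hyp_cut.
Qed.

(* The modular coatom step: [t] lies in the center of [A], so [H -> H :&: hyp W f]
   is an isomorphism of arrangements on [A], and two new hyperplanes meet inside
   a member of [A]. *)
Lemma IF_modular W A X Y t fs :
  IFpair W A (X ++ Y) -> t \in W -> {in A, forall H, t \in H} ->
  {in fs, forall f, ev f t = 1} -> uniq fs ->
  {in fs &, forall f g, f != g -> hyp W (f - g) \in A} ->
  IFpair W (arr W fs `|` A) (X ++ nseq (fs != [::]) (arr W fs) ++ Y).
Proof.
move=> IFA tW tA; elim: fs => [_ _ _|f fs IH ft /andP[ffs ufs] dA].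
  by rewrite arr_nil fset0U.
have {}IH : IFpair W (arr W fs `|` A) (X ++ nseq (fs != [::]) (arr W fs) ++ Y).
  apply: IH => // [g gfs|g h gfs hfs]; first by rewrite ft // inE gfs orbT.
  by apply: dA; rewrite inE ?gfs ?hfs orbT.
have ft1 : ev f t = 1 by rewrite ft ?mem_head.
have hf : is_hyp W (hyp W f) by apply: (hyp_is_hyp tW); rewrite ft1 oner_eq0.
have tf : t \notin hyp W f by rewrite mem_hyp ft1 oner_eq0 andbF.
have UT : (hyp W f + <[t]>)%VS = W by apply: hyp_addv; rewrite -?memvE.
have ne g : g \in fs -> f != g by move=> gfs; apply: contraNneq ffs => ->.
have dfA g : g \in fs -> hyp W (f - g) \in A.
  by move=> gfs; apply: dA; rewrite ?ne // inE ?gfs ?eqxx ?orbT.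
have ceq g : g \in fs ->
  (hyp W g :&: hyp W f)%VS = (hyp W (f - g) :&: hyp W f)%VS.
  move=> gfs; rewrite !hyp_cut; apply: eq_hyp => w; rewrite mem_hyp => /andP[_ /eqP].
  by rewrite evBl => ->; rewrite sub0r oppr_eq0.
have gt g : g \in fs -> ev g t = 1 by move=> gfs; rewrite ft // inE gfs orbT.
(* Each form [g] added earlier has on [hyp W f] the trace of [f - g], a member of [A], so the
   restriction is that of [A] alone. *)
have cutE : cut (hyp W f) (arr W fs `|` A) = cut (hyp W f) A.
  rewrite imfsetU; apply/fsetP => L; rewrite in_fsetU; apply/orb_idl.
  case/imfsetP => /= H /arrP[g gfs ->] ->; rewrite ceq //.
  by apply/imfsetP; exists (hyp W (f - g)) => //; apply: dfA.
rewrite /= arr_cons -fsetUA; apply: IF_add => //.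
- rewrite in_fsetU negb_or; apply/andP; split; last first.
    by apply/negP => /tA; rewrite (negbTE tf).
  apply/negP => /arrP[g gfs e].
  (* As a member of [A], the hyperplane of [f - g] is proper, so [f] and [g] differ somewhere on
     [W]. *)
  have /is_hypP[w wW] := IFpair_arr IFA (dfA g gfs).
  by rewrite evBl (norm_inj tW ft1 (gt g gfs) e wW) subrr eqxx.
- by rewrite arr_eq0.
- move=> H /arrP[g gfs ->]; exists (hyp W (f - g)); split.
  + by rewrite in_fsetU dfA ?orbT.
  + apply/negP => /arrP[h hfs e].
    by move: (tA _ (dfA g gfs)); rewrite e mem_hyp gt // oner_eq0 andbF.
  + exact: ceq.
- move=> C CXY H L HC LC; have pA := IFpair_part IFA.
  have AW M : M \in A -> (M <= W)%VS by move/(IFpair_arr IFA)/andP=> [].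
  have HA := part_mem pA CXY HC; have LA := part_mem pA CXY LC.
  by apply: (capU_inj UT); rewrite -?memvE ?AW ?tA.
- rewrite cutE; apply: (IF_transfer IFA (hyp_sub W f) UT).
  by move=> H HA; rewrite -memvE tA.
Qed.

End Forms.

(** * The arrangements of tailed triangles *)

Section Gamma.
Local Open Scope fset_scope.
Local Open Scope ring_scope.
Variable n : nat.
Local Notation V := 'rV[rat]_n.
Local Notation sp := {vspace V}.
Local Notation form := 'cV[rat]_n.
Local Notation cut U A := [fset (H :&: U)%VS | H in A].
Implicit Types (H K T U W : sp) (f g h s : form) (cs fs : seq form) (w t : V).

(** Linear independence of the restrictions to [W], given by dual vectors. It is relative to [W]
    because the induction on the family passes to a hyperplane. *)
Definition dual W fs := {in fs, forall f,
  exists2 w, w \in W & {in fs, forall g, ev g w = (g == f)%:R}}.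

Lemma dual_sub W fs gs : {subset gs <= fs} -> dual W fs -> dual W gs.
Proof.
move=> sub d f /sub /d[w wW h]; exists w => // g /sub; exact: h.
Qed.

Lemma dual_cons W fs c t : dual W fs -> t \in W -> {in fs, forall f, ev f t = 0} ->
  ev c t = 1 -> dual W (c :: fs).
Proof.
move=> d tW t0 ct f; rewrite inE; case: eqVneq => [-> _|nfc /= ffs].
  exists t => // g; rewrite inE; case: eqVneq => [->//|_ /= gfs]; exact: t0.
have [w wW h] := d f ffs; exists (w - ev c w *: t).
  by rewrite rpredB ?rpredZ.
move=> g; rewrite inE; case: eqVneq => [->|ngc /= gfs]; rewrite !evE.
  by rewrite ct mulr1 subrr eq_sym (negbTE nfc).
by rewrite t0 // mulr0 subr0 h.
Qed.

Variables a b : form.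

(* The family of the header: [upper c cs] is the block added with the form
   [c], [sums] is the block of the forms [b + s], which contains [b] when [eps]. *)
Definition ends cs := cs ++ [:: a; - a; b].
Definition upper c cs := [seq c - s | s <- ends cs].
Fixpoint uppers cs : seq (seq form) :=
  if cs is c :: cs' then upper c cs' :: uppers cs' else [:: [:: a]].
Definition sums (eps : bool) cs := [seq b + s | s <- cs ++ [:: a; - a] ++ nseq eps 0].
Definition Gam eps cs := sums eps cs :: uppers cs.

Lemma Gam_cat eps cs : flatten (Gam eps cs) = sums eps cs ++ flatten (uppers cs).
Proof. by []. Qed.

Lemma Gam_cons eps c cs : flatten (Gam eps (c :: cs)) =
  (b + c) :: sums eps cs ++ upper c cs ++ flatten (uppers cs).
Proof. by []. Qed.

Lemma Gam_sub eps c cs :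
  {subset flatten (Gam eps cs) <= flatten (Gam eps (c :: cs))}.
Proof.
move=> f; rewrite Gam_cons Gam_cat inE !mem_cat.
by case/orP=> ->; rewrite ?orbT.
Qed.

Lemma ev_ends0 cs w s : {in a :: b :: cs, forall f, ev f w = 0} ->
  s \in ends cs -> ev s w = 0.
Proof.
move=> h; rewrite mem_cat !inE => /orP[scs|/or3P[]/eqP->].
- by rewrite h // !inE scs !orbT.
- by rewrite h // inE eqxx.
- by rewrite evNl h ?oppr0 // inE eqxx.
- by rewrite h // !inE eqxx orbT.
Qed.

Lemma ev_Gam0 eps cs w f : {in a :: b :: cs, forall g, ev g w = 0} ->
  f \in flatten (Gam eps cs) -> ev f w = 0.
Proof.
move=> h; rewrite Gam_cat mem_cat => /orP[/mapP[s ss ->]|].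
  rewrite evDl h ?inE ?eqxx ?orbT // add0r.
  move: ss; rewrite !mem_cat mem_nseq => /or3P[ss|ss|/andP[_ /eqP->]].
  - by apply: (ev_ends0 h); rewrite mem_cat ss.
  - by apply: (ev_ends0 h); move: ss; rewrite mem_cat !inE => /orP[]->; rewrite ?orbT.
  - exact: ev0l.
elim: cs h => [|c cs IH] h /=.
  by rewrite inE => /eqP ->; rewrite h ?inE ?eqxx.
have h' : {in a :: b :: cs, forall g, ev g w = 0}.
  by move=> g gi; apply: h; move: gi; rewrite !inE => /or3P[]->; rewrite ?orbT.
rewrite mem_cat => /orP[/mapP[s ss ->]|]; last exact: IH.
by rewrite evBl (ev_ends0 h' ss) h ?subr0 // !inE eqxx !orbT.
Qed.

(** The modularity condition for [upper c cs]: the hyperplanes of [c - x] and [c - y] meet inside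
    that of [x - y], which has to be an older one. The factor [k] absorbs signs and the 2 in
    [a - (- a) = 2 a]. *)
Lemma ends_diff eps cs x y : x \in ends cs -> y \in ends cs -> x != y ->
  exists k : rat, exists2 f, f \in flatten (Gam eps cs) & k != 0 /\ x - y = k *: f.
Proof.
elim: cs => [|c cs IH].
  have e1 : a \in flatten (Gam eps [::]) by rewrite Gam_cat mem_cat mem_head orbT.
  have e2 : b + a \in flatten (Gam eps [::]) by rewrite Gam_cat mem_cat map_f // mem_head.
  have e3 : b - a \in flatten (Gam eps [::]) by rewrite Gam_cat mem_cat map_f // inE mem_head orbT.
  rewrite /ends /= !inE => /or3P[]/eqP-> /or3P[]/eqP->; rewrite ?eqxx // => _.
  - by exists (1 + 1), a => //; split=> //; rewrite scalerDl scale1r opprK.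
  - by exists (-1), (b - a) => //; split=> //; rewrite scaleN1r opprB.
  - by exists (- (1 + 1)), a => //; split=> //; rewrite scaleNr scalerDl scale1r opprD.
  - by exists (-1), (b + a) => //; split=> //; rewrite scaleN1r opprD addrC.
  - by exists 1, (b - a) => //; split=> //; rewrite scale1r.
  - by exists 1, (b + a) => //; split=> //; rewrite scale1r opprK.
have up s : s \in ends cs -> c - s \in flatten (Gam eps (c :: cs)).
  by move=> ss; rewrite Gam_cons inE !mem_cat (map_f _ ss) !orbT.
rewrite /ends /= ![_ \in _ :: _]inE => /orP[/eqP->|xs] /orP[/eqP->|ys].
- by rewrite eqxx.
- by move=> _; exists 1, (c - y); rewrite ?up // scale1r.
- by move=> _; exists (-1), (c - x); rewrite ?up // scaleN1r opprB.
- move=> nxy; have [k [f ff [k0 e]]] := IH xs ys nxy.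
  by exists k, f => //; apply: Gam_sub.
Qed.

Section Dual.
Variables (W : sp) (cs : seq form).
Hypotheses (d : dual W [:: a, b & cs]) (u : uniq [:: a, b & cs]).

(** Dual vectors separate the independent forms from everything else in the list. The [0] is
    adjoined because on the hyperplane of [b + c] the form [c - b] becomes a multiple of [b + 0]. *)
Lemma ends_sep x y : x \in 0 :: ends cs -> y \in 0 :: ends cs -> x != y ->
  exists2 w, w \in W & ev x w != ev y w.
Proof.
have key z y' : z \in [:: a, b & cs] -> y' \in 0 :: ends cs -> z != y' ->
    exists2 w, w \in W & ev z w != ev y' w.
  move=> zi y'i ne; have [w wW h] := d zi; exists w => //; rewrite h // eqxx.
  have y'f : y' \in [:: a, b & cs] -> 1 != ev y' w.
    by move=> y'f; rewrite h // [y' == z]eq_sym (negbTE ne) oner_eq0.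
  move: y'i; rewrite /ends inE mem_cat !inE => /orP[/eqP->|]; first by rewrite ev0l.
  case/orP=> [y'c|/or3P[]/eqP e]; try by apply: y'f; rewrite ?y'c ?e !inE ?y'c ?eqxx ?orbT.
  by rewrite e evNl h ?inE ?eqxx //; case: (a == z).
have mem z : z \in 0 :: ends cs -> [|| z \in [:: a, b & cs], z == 0 | z == - a].
  rewrite /ends !inE mem_cat !inE.
  by case: (z == 0); case: (z \in cs); case: (z == a); case: (z == - a); case: (z == b).
have [wa waW ha] := d (mem_head _ _).
have ea : ev a wa = 1 by rewrite ha ?mem_head ?eqxx.
move=> xi yi ne; case/orP: (mem x xi) => [xf|xz]; first exact: key.
case/orP: (mem y yi) => [yf|yz].
  by rewrite eq_sym in ne; have [w wW h] := key _ _ yf xi ne; exists w; rewrite // eq_sym.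
(* Both forms are now [0] or [- a], the only entries outside the independent family, and the vector
   dual to [a] tells them apart. *)
exists wa => //.
by move: ne; case/orP: xz => /eqP->; case/orP: yz => /eqP->;
  rewrite ?eqxx // evNl ev0l ea.
Qed.

Lemma ends_uniq : uniq (0 :: ends cs).
Proof.
have [wa waW ha] := d (mem_head _ _).
have hb : b \in [:: a, b & cs] by rewrite !inE eqxx orbT.
have ea : ev a wa = 1 by rewrite ha ?mem_head ?eqxx.
have neq f : f \in [:: a, b & cs] -> f != 0 /\ f != - a.
  move=> fi; have [w wW h] := d fi; have ef : ev f w = 1 by rewrite h ?eqxx.
  split; apply/eqP => e; move: ef; rewrite {1}e ?ev0l // evNl h ?mem_head //.
  by case: (a == f).
have a0 := neq a (mem_head _ _); have b0 := neq b hb.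
move: u; rewrite /ends /= cat_uniq !inE !negb_or mem_cat !inE !negb_or /=.
case/and3P=> /andP[nab acs] bcs ucs.
have cne f : f \in cs -> f != 0 /\ f != - a.
  by move=> fc; apply: neq; rewrite !inE fc !orbT.
rewrite ucs acs bcs ![0 == _]eq_sym oppr_eq0 a0.1 b0.1 !inE negb_or a0.2 nab /=.
rewrite [- a == b]eq_sym b0.2 !andbT.
by apply/andP; split; apply/negP => h; have [] := cne _ h; rewrite eqxx.
Qed.

End Dual.

(** Meant for [W] the hyperplane of [b + c], on which each old block must keep distinct traces. The
    vector dual to the leading form of a block normalizes all its members, and [ends_sep] separates
    what is subtracted from that form. *)
Lemma uppers_inj W cs : dual W [:: a, b & cs] -> uniq [:: a, b & cs] ->
  forall B, B \in uppers cs -> {in B &, forall f g, hyp W f = hyp W g -> f = g}.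
Proof.
elim: cs => [|c cs IH] d u B.
  by rewrite inE => /eqP -> f g; rewrite !inE => /eqP -> /eqP ->.
have cs_c : {subset [:: a, b & cs] <= [:: a, b, c & cs]}.
  by move=> f; rewrite !inE => /or3P[]->; rewrite ?orbT.
have d' : dual W [:: a, b & cs] by apply: dual_sub d.
have [c_cs u'] : c \notin [:: a, b & cs] /\ uniq [:: a, b & cs].
  by move: u; rewrite /= !inE !negb_or [c == a]eq_sym [c == b]eq_sym;
    case/and4P => /and3P[-> -> ->] /andP[-> ->] -> ->.
rewrite inE => /orP[/eqP->|]; last exact: IH.
have ci : c \in [:: a, b, c & cs] by rewrite !inE eqxx !orbT.
have [w wW hw] := d c ci.
have w0 : {in [:: a, b & cs], forall f, ev f w = 0}.
  move=> f fi; rewrite hw ?cs_c //.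
  by rewrite (negbTE (_ : f != c)) //; apply: contraNneq c_cs => <-.
have wc : ev c w = 1 by rewrite hw ?eqxx.
move=> _ _ /mapP[s si ->] /mapP[s' si' ->] e; congr (c - _).
apply/eqP; apply: contraT => ne.
have [|||x xW] := ends_sep d' (x := s) (y := s'); rewrite ?inE ?si ?si' ?orbT //.
have := norm_inj wW _ _ e xW; rewrite !evBl wc (ev_ends0 w0 si) (ev_ends0 w0 si').
by rewrite subr0 => /(_ erefl erefl)/addrI/oppr_inj ->; rewrite eqxx.
Qed.

(** [eps] and [W] vary in the induction, since adding [b + c] calls for the smaller family with
    [eps = true] inside a hyperplane; [cs] lists the latest form first. The new hyperplane can join
    the block [sums] because on it the block [upper c cs] becomes [sums true cs], which already
    contains the traces of [sums eps cs]. *)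
Lemma IFpair_Gam cs : forall (eps : bool) W,
  dual W [:: a, b & cs] -> uniq [:: a, b & cs] ->
  IFpair W (arr W (flatten (Gam eps cs))) [seq arr W B | B <- Gam eps cs].
Proof.
elim: cs => [|c cs IH] eps W d u.
  have [wa waW ha] := d a (mem_head _ _).
  have bi : b \in [:: a; b] by rewrite !inE eqxx orbT.
  have [wb wbW hb] := d b bi.
  have nab : a != b by move: u; rewrite /= inE andbT.
  have ea : ev a wa = 1 by rewrite ha ?mem_head ?eqxx.
  have eab : ev a wb = 0 by rewrite hb ?mem_head ?(negbTE nab).
  have ebb : ev b wb = 1 by rewrite hb ?eqxx.
  (* A single hyperplane is a modular step over the empty arrangement. *)
  have IFa : IFpair W (arr W [:: a]) [:: arr W [:: a]].
    have := @IF_modular n W fset0 [::] [::] wa [:: a].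
    rewrite /= fsetU0; apply=> //; first exact: IF_empty.
      by move=> f; rewrite inE => /eqP ->.
    by move=> f g; rewrite !inE => /eqP -> /eqP ->; rewrite eqxx.
  have sP s : s \in [::] ++ [:: a; - a] ++ nseq eps 0 -> [\/ s = a, s = - a | s = 0].
    rewrite cat0s mem_cat mem_nseq !inE -orbA => /or3P[/eqP->|/eqP->|/andP[_ /eqP->]].
    - exact: Or31.
    - exact: Or32.
    - exact: Or33.
  rewrite Gam_cat arr_cat.
  (* The forms [b + a], [b - a] and possibly [b] differ pairwise by multiples of [a], so the base
     case is a modular step over [a]. *)
  apply: (@IF_modular n W _ [::] _ wb) => //.
  - move=> H /arrP[f]; rewrite inE => /eqP -> ->.
    by rewrite mem_hyp wbW eab eqxx.
  - move=> f /mapP[s /sP ss ->]; rewrite evDl ebb.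
    by case: ss => ->; rewrite ?evNl ?ev0l ?eab ?oppr0 addr0.
  - rewrite map_inj_uniq; last by move=> x y /addrI.
    have /= := ends_uniq d u; rewrite !inE !negb_or ![0 == _]eq_sym.
    by case/andP=> /and3P[a0 na0 _] /and3P[/andP[a1 _] _ _];
      case: (eps); rewrite /= ?inE ?negb_or ?a0 ?na0 ?a1.
  - move=> f g /mapP[s /sP ss ->] /mapP[s' /sP ss' ->] ne.
    suff [k k0 ->] : exists2 k : rat, k != 0 & b + s - (b + s') = k *: a.
      by rewrite hyp_scale // mem_arr ?mem_head.
    have -> : b + s - (b + s') = s - s' by rewrite opprD addrACA subrr add0r.
    have {}ne : s != s' by apply: contraNneq ne => ->.
    move: ne; case: ss => ->; case: ss' => ->; rewrite ?eqxx // => _.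
    + by exists (1 + 1); rewrite // scalerDl scale1r opprK.
    + by exists 1; rewrite // scale1r subr0.
    + by exists (- (1 + 1)); rewrite // scaleNr scalerDl scale1r opprD.
    + by exists (-1); rewrite // scaleN1r subr0.
    + by exists (-1); rewrite // scaleN1r sub0r.
    + by exists 1; rewrite // scale1r sub0r opprK.
have cs_c : {subset [:: a, b & cs] <= [:: a, b, c & cs]}.
  by move=> f; rewrite !inE => /or3P[]->; rewrite ?orbT.
have bi : b \in [:: a, b, c & cs] by rewrite !inE eqxx orbT.
have ci : c \in [:: a, b, c & cs] by rewrite !inE eqxx !orbT.
have [c_cs u'] : c \notin [:: a, b & cs] /\ uniq [:: a, b & cs].
  by move: u; rewrite /= !inE !negb_or [c == a]eq_sym [c == b]eq_sym;
    case/and4P => /and3P[-> -> ->] /andP[-> ->] -> ->.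
have d' : dual W [:: a, b & cs] by apply: dual_sub d.
have [wb wbW hb] := d b bi.
have [wc wcW hc] := d c ci.
have nbc : b != c by apply: contraNneq c_cs => <-; rewrite !inE eqxx orbT.
have wc0 : {in [:: a, b & cs], forall f, ev f wc = 0}.
  move=> f fi; rewrite hc ?cs_c //.
  by rewrite (negbTE (_ : f != c)) //; apply: contraNneq c_cs => <-.
have ecc : ev c wc = 1 by rewrite hc ?eqxx.
have ebb : ev b wb = 1 by rewrite hb ?eqxx.
have ecb : ev c wb = 0 by rewrite hb // eq_sym (negbTE nbc).
have bN : b \notin 0 :: cs ++ [:: a; - a].
  have := ends_uniq d' u'; rewrite /ends -[[:: a; - a; b]]/([:: a; - a] ++ [:: b]).
  by rewrite catA -cat_cons cats1 rcons_uniq => /andP[].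
have evb s : s \in ends cs -> ev s wb = (s == b)%:R.
  rewrite mem_cat !inE => /orP[si|/or3P[]/eqP->].
  - by rewrite hb // !inE si !orbT.
  - by rewrite hb // inE eqxx.
  - rewrite evNl hb ?inE ?eqxx // (negbTE (_ : a != b)).
      rewrite oppr0 (negbTE (_ : - a != b)) //.
      by apply: contraNneq bN => <-; rewrite !inE mem_cat !inE eqxx !orbT.
    by apply: contraNneq bN => <-; rewrite !inE mem_cat !inE eqxx !orbT.
  - by rewrite hb.
have uE : uniq (ends cs) by have := ends_uniq d' u'; case/andP.
have IF1 := IH eps W d' u'.
have IFA' : IFpair W (arr W (upper c cs) `|` arr W (flatten (Gam eps cs)))
    ([:: arr W (sums eps cs)] ++ nseq (upper c cs != [::]) (arr W (upper c cs))
       ++ [seq arr W B | B <- uppers cs]).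
  apply: (@IF_modular n W _ [:: arr W (sums eps cs)] _ wc (upper c cs) IF1) => //.
  - move=> H /arrP[f fi ->]; rewrite mem_hyp wcW.
    by rewrite (ev_Gam0 wc0 fi) eqxx.
  - move=> f /mapP[s si ->].
    by rewrite evBl ecc (ev_ends0 wc0 si) subr0.
  - by rewrite map_inj_uniq // => x y /addrI /oppr_inj.
  - move=> f g /mapP[s si ->] /mapP[s' si' ->] ne.
    have ne' : s' != s by apply: contraNneq ne => ->.
    have [k [h hG [k0 e]]] := ends_diff eps si' si ne'.
    have -> : c - s - (c - s') = k *: h by rewrite -e opprB addrC subrKA.
    by rewrite hyp_scale // mem_arr.
have upN : upper c cs != [::] by rewrite /upper /ends; case: (cs).
rewrite upN in IFA'.
set H0 := hyp W (b + c).
set A := arr W _ `|` _ in IFA'.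
have hH0 : is_hyp W H0.
  by apply: (hyp_is_hyp wcW); rewrite evDl ecc wc0 ?add0r ?oner_eq0 // !inE eqxx orbT.
have bc_wc : ev (b + c) wc = 1 by rewrite evDl ecc wc0 ?add0r // !inE eqxx orbT.
have dH0 : dual H0 [:: a, b & cs].
  move=> f fi; case: (eqVneq f b) => [->|nfb].
    (* [wb] itself is outside [H0]; subtracting [wc] moves it into [H0] and keeps its values on [a],
       [b] and [cs]. *)
    exists (wb - wc).
      by rewrite mem_hyp rpredB // evBr bc_wc evDl ebb ecb addr0 subrr eqxx.
    by move=> g gi; rewrite evBr hb ?cs_c // wc0 // subr0.
  have [w wW hw] := d f (cs_c _ fi); exists w; last by move=> g /cs_c; apply: hw.
  rewrite mem_hyp wW evDl !hw // [b == f]eq_sym (negbTE nfb) add0r.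
  by rewrite (negbTE (_ : c != f)) //; apply: contraNneq c_cs => ->.
have mod_c : {in H0, forall w, ev c w = - ev b w}.
  by move=> w; rewrite mem_hyp evDl addrC addr_eq0 => /andP[_ /eqP].
(* On [H0] one has [c = - b], so [c - s] is [- (b + s)], except that [c - b = - 2 b] has the
   hyperplane of [b + 0]. *)
pose sg s := if s == b then 0 else s.
have hypH0 s : s \in ends cs -> hyp H0 (c - s) = hyp H0 (b + sg s).
  move=> si; apply: eq_hyp => w wH; rewrite !evE mod_c // -opprD oppr_eq0.
  rewrite /sg; case: (eqVneq s b) => [->|_] //.
  by rewrite ev0l addr0 -mulr2n -mulr_natr mulf_eq0 orbF.
have arrH0 : arr H0 (upper c cs) = arr H0 (sums true cs).
  have sgi s : s \in ends cs -> sg s \in cs ++ [:: a; - a] ++ [:: 0].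
    rewrite /sg; case: (eqVneq s b) => [_ _|nsb].
      by rewrite !mem_cat mem_head !orbT.
    rewrite !mem_cat !inE (negbTE nsb).
    by rewrite orbF => /or3P[]->; rewrite ?orbT.
  apply/fsetP => H; apply/arrP/arrP => -[f /mapP[s si ->] ->].
    exists (b + sg s); last exact: hypH0.
    by apply: map_f; apply: sgi.
  move: si; rewrite !mem_cat !inE => si.
  have [s0|s0] := eqVneq s 0.
    exists (c - b); first by apply: map_f; rewrite mem_cat !inE eqxx !orbT.
    by rewrite hypH0 ?s0 /sg ?eqxx // mem_cat !inE eqxx !orbT.
  have sE : s \in ends cs.
    by move: si; rewrite (negbTE s0) orbF mem_cat !inE => /or3P[]->; rewrite ?orbT.
  exists (c - s); first exact: map_f.
  rewrite hypH0 // /sg; case: (eqVneq s b) => // e; exfalso; move/negP: bN; apply.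
  by rewrite -e !inE mem_cat !inE; move: si => /or3P[->|/orP[]->|->]; rewrite ?orbT.
have IF2 := IH true H0 dH0 u'.
have cutA : cut H0 A = arr H0 (flatten (Gam true cs)).
  rewrite /A imfsetU !cut_arr arrH0 [flatten _]/= [in RHS]arr_cat arr_cat.
  rewrite fsetUA; congr (_ `|` _); apply/fsetP => H; rewrite in_fsetU.
  apply: orb_idr => /arrP[f /mapP[s si ->] ->]; apply: mem_arr.
  apply: map_f; move: si; rewrite !mem_cat => /or3P[->//|->|]; rewrite ?orbT //.
  by rewrite mem_nseq => /andP[_ /eqP->]; rewrite [_ \in nseq _ _]mem_nseq eqxx !orbT.
have -> : arr W (flatten (Gam eps (c :: cs))) = H0 |` A.
  by rewrite Gam_cons /A Gam_cat arr_cons !arr_cat; congr (_ |` _); apply: fsetUCA.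
rewrite [map _ _]/= arr_cons -/H0.
apply: (@IF_add n W A (arr W (sums eps cs)) [::]) => //.
- rewrite in_fsetU negb_or; apply/andP; split; last first.
    apply/negP => /arrP[f fi e]; have : wc \in H0.
      by rewrite e mem_hyp wcW (ev_Gam0 wc0 fi) eqxx.
    by rewrite mem_hyp bc_wc oner_eq0 andbF.
  apply/negP => /arrP[f /mapP[s si ->] e].
  (* Equal hyperplanes would force equal values at [wb], but [b + c] is 1 there while [c - s] is 0
     or -1. *)
  have : ev (b + c) wb = ev (c - s) wb.
    apply: (norm_inj wcW) => //.
    by rewrite evBl ecc (ev_ends0 wc0 si) subr0.
  rewrite !evE ebb ecb addr0 add0r evb //.
  by case: (s == b).
- by rewrite arr_eq0 /= (_ : sums eps cs != [::]) // /sums; case: (cs).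
- move=> H /arrP[f fi ->].
  have : hyp H0 f \in arr H0 (upper c cs).
    rewrite arrH0; apply/mem_arr; case/mapP: fi => s si ->; apply: map_f.
    move: si; rewrite !mem_cat => /or3P[->//|->|]; rewrite ?orbT //.
    by rewrite mem_nseq => /andP[_ /eqP->]; rewrite [_ \in nseq _ _]mem_nseq eqxx !orbT.
  case/arrP=> g gi e; exists (hyp W g); rewrite !hyp_cut; split=> //.
    by rewrite in_fsetU mem_arr.
  apply/negP => /arrP[h hi e']; have : wc \in hyp W h.
    rewrite mem_hyp wcW (@ev_Gam0 eps cs) ?eqxx //.
    by rewrite Gam_cat mem_cat hi.
  rewrite -e' mem_hyp; case/mapP: gi => s si ->.
  by rewrite evBl ecc (ev_ends0 wc0 si) subr0 oner_eq0 andbF.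
- move=> C; rewrite cat0s inE => /orP[/eqP->|/mapP[B Bi ->]]; last first.
    move=> _ _ /arrP[f fi ->] /arrP[g gi ->]; rewrite !hyp_cut => e.
    by rewrite (uppers_inj dH0 u' Bi fi gi e).
  move=> _ _ /arrP[_ /mapP[s si ->] ->] /arrP[_ /mapP[s' si' ->] ->].
  rewrite !hyp_cut !hypH0 // => e; congr (hyp W (c - _)).
  have n0 : 0 \notin ends cs by have /andP[] := ends_uniq d' u'.
  have sgi s0 : s0 \in ends cs -> sg s0 \in 0 :: ends cs.
    by rewrite /sg; case: ifP => _; rewrite inE ?eqxx // => ->; rewrite orbT.
  (* Every [b + sg s] thus takes the value 1 at [wb - wc], a vector of [H0], and equal traces give
     [sg s = sg s']. Since [0] is not in [ends cs], this implies [s = s']. *)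
  have esg s0 : s0 \in ends cs -> ev (sg s0) (wb - wc) = 0.
    move=> s0i; rewrite /sg; case: (eqVneq s0 b) => [_|ne]; first exact: ev0l.
    by rewrite evBr evb // (negbTE ne) (ev_ends0 wc0 s0i) subrr.
  have ssg : sg s = sg s'.
    apply/eqP; apply: contraT => ne.
    have [|||x xH] := ends_sep dH0 (x := sg s) (y := sg s'); rewrite ?sgi //.
    have tH : wb - wc \in H0.
      by rewrite mem_hyp rpredB // evBr bc_wc evDl ebb ecb addr0 subrr eqxx.
    have := norm_inj tH _ _ e xH; rewrite !evDl !esg // evBr ebb.
    rewrite wc0 ?subr0 ?addr0; last by rewrite !inE eqxx orbT.
    by move=> /(_ erefl erefl)/addrI ->; rewrite eqxx.
  move: ssg; rewrite /sg; case: (eqVneq s b) => [->|_]; case: (eqVneq s' b) => [->|_] //.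
    by move=> e0; move: n0; rewrite e0 si'.
  by move=> e0; move: n0; rewrite -e0 si.
- rewrite cutA cat0s map_cons cut_arr arrH0.
  move: IF2; rewrite [map _ _]/=; congr (IFpair _ _ (_ :: _)).
  by rewrite -map_comp; apply: eq_map => B /=; rewrite cut_arr.
Qed.

End Gamma.

(** * Inductively factored arrangements are factored *)

Section Addition.
Local Open Scope fset_scope.
Local Open Scope ring_scope.
Variable n : nat.
Local Notation V := 'rV[rat]_n.
Local Notation sp := {vspace V}.
Local Notation cut U A := [fset (H :&: U)%VS | H in A].
Implicit Types (A B C D S : {fset sp}) (P Q X Y : seq {fset sp}) (H K T U W Z : sp).

Lemma subv_bigcap Z W (s : seq sp) :
  (Z <= \big[@capv _ _/W]_(H <- s) H)%VS =
  (Z <= W)%VS && all (fun H => (Z <= H)%VS) s.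
Proof.
elim: s => [|H s IH] /=; first by rewrite big_nil andbT.
by rewrite big_cons subv_cap IH andbCA.
Qed.

Lemma bigcap_cut W H0 (s : seq sp) : (H0 <= W)%VS ->
  \big[@capv _ _/H0]_(H <- [seq (H :&: H0)%VS | H <- s]) H =
  (H0 :&: \big[@capv _ _/W]_(H <- s) H)%VS.
Proof.
move=> H0W; elim: s => [|H s IH] /=.
  by rewrite !big_nil; apply/esym/capv_idPl.
by rewrite !big_cons IH capvA -(capvA H) capvv (capvC H) !capvA.
Qed.

Definition meets_once Z B := exists H,
  [/\ H \in B, (Z <= H)%VS & forall K, K \in B -> (Z <= K)%VS -> K = H].

Lemma meets_onceP Z B :
  #|` [fset H in B | (Z <= H)%VS]| = 1%N <-> meets_once Z B.
Proof.
split=> [/eqP/cardfs1P[H e]|[H [HB ZH u]]].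
  have : H \in [fset H in B | (Z <= H)%VS] by rewrite e in_fset1.
  rewrite !inE => /andP[HB ZH]; exists H; split=> // K KB ZK.
  have : K \in [fset H in B | (Z <= H)%VS] by rewrite !inE KB ZK.
  by rewrite e in_fset1 => /eqP.
apply/eqP/cardfs1P; exists H; apply/fsetP => K; rewrite !inE.
apply/andP/eqP => [[KB ZK]|->//]; exact: u.
Qed.

(** The transversal is a list rather than a function of the index, so that it splits along
    [X ++ B :: Y]. *)
Definition indep W P := forall g : seq sp,
  all2 (fun H B => H \in B) g P ->
  (\dim W - \dim (\big[@capv _ _/W]_(H <- g) H))%N = size P.

Lemma indep_independent W P : indep W P -> independent W P.
Proof.
move=> h f fP; have := h (mkseq f (size P)).
rewrite /mkseq big_map -(big_mkord xpredT f) /index_iota subn0; apply.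
rewrite -/(mkseq f (size P)) all2E size_mkseq eqxx; apply/(all_nthP (0%VS, fset0)) => i.
rewrite size_zip size_mkseq minnn => ip /=.
by rewrite nth_zip ?size_mkseq //= nth_mkseq //; apply: fP.
Qed.

Lemma all2_cat_cons (g : seq sp) X B Y :
  all2 (fun H B => H \in B) g (X ++ B :: Y) ->
  exists g1 H g2, [/\ g = g1 ++ H :: g2, all2 (fun H B => H \in B) g1 X,
    H \in B & all2 (fun H B => H \in B) g2 Y].
Proof.
elim: X g => [|C X IH] [|H g] //= /andP[HC]; first by exists [::], H, g.
move=> /IH[g1 [K [g2 [-> a1 KB a2]]]].
by exists (H :: g1), K, g2; rewrite /= HC a1.
Qed.

Lemma all2_catI (g1 g2 : seq sp) X Y :
  all2 (fun H B => H \in B) g1 X -> all2 (fun H B => H \in B) g2 Y ->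
  all2 (fun H B => H \in B) (g1 ++ g2) (X ++ Y).
Proof.
by elim: X g1 => [|C X IH] [|H g1] //= /andP[-> h] a2; rewrite IH.
Qed.

Lemma all2_cut H0 (g : seq sp) X :
  all2 (fun H B => H \in B) g X ->
  all2 (fun H B => H \in B) [seq (K :&: H0)%VS | K <- g] [seq cut H0 B | B <- X].
Proof.
elim: X g => [|C X IH] [|H g] //= /andP[HC /IH ->].
by rewrite andbT; apply/imfsetP; exists H.
Qed.

Lemma bigcap_midE W H0 (g1 g2 : seq sp) :
  \big[@capv _ _/W]_(K <- g1 ++ H0 :: g2) K =
  (H0 :&: \big[@capv _ _/W]_(K <- g1 ++ g2) K)%VS.
Proof.
elim: g1 => [|K g1 IH] /=; first by rewrite big_cons.
by rewrite !big_cons IH !capvA (capvC H0).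
Qed.

Lemma le_capS Z W S :
  (Z <= capS W S)%VS = (Z <= W)%VS && all (fun H => (Z <= H)%VS) S.
Proof. exact: subv_bigcap. Qed.

Lemma capS_le W S H : H \in S -> (capS W S <= H)%VS.
Proof.
by move=> HS; have := subvv (capS W S); rewrite le_capS => /andP[_ /allP]; apply.
Qed.

Definition singular W A P := forall S, S `<=` A -> S != fset0 ->
  exists2 B : {fset sp}, B \in P & meets_once (capS W S) B.

(** A transversal through [H0] cuts [H0] in a transversal of the restriction, whose codimension in
    [H0] is one less; a transversal avoiding [H0] is one of the deletion. *)
Lemma IFpair_indep W A P : IFpair W A P -> indep W P.
Proof.
elim/IFpair_add_ind => {W A P} [W [] // _|]; first by rewrite big_nil subnn.
move=> W A B X Y H0 hH0 H0A IF1 IH1 BK inj IF2 IH2 g.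
case/all2_cat_cons => g1 [H [g2 [-> a1 + a2]]].
rewrite in_fset1U => /orP[/eqP ->|HB].
  have H0W : (H0 <= W)%VS by case/andP: hH0.
  have := IH2 [seq (K :&: H0)%VS | K <- g1 ++ g2].
  rewrite (bigcap_cut _ H0W) size_map !size_cat /= addnS => <-.
    rewrite bigcap_midE.
    case/andP: hH0 => _ /eqP <-; rewrite subSn //.
    by apply: dimvS; apply: capvSl.
  by apply: all2_cut; apply: all2_catI.
have nB : B != fset0 by apply/fset0Pn; exists H.
have := IH1 (g1 ++ H :: g2); rewrite nB !size_cat /= => -> //.
by apply: all2_catI => //=; rewrite HB.
Qed.

(** For a flat not inside [H0] no member of [S] is [H0], and the singleton block of the deletion
    stays one. For a flat inside [H0], a singleton block of the restriction lifts, because cutting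
    with [H0] is injective on each of the other blocks. *)
Lemma IFpair_singular W A P : IFpair W A P -> singular W A P.
Proof.
elim/IFpair_add_ind => {W A P} [W S|].
  by rewrite fsubset0 => ->.
move=> W A B X Y H0 hH0 H0A IF1 IH1 BK inj IF2 IH2 S SA S0.
have H0W : (H0 <= W)%VS by case/andP: hH0.
set Z := capS W S.
have [ZH0|ZH0] := boolP (Z <= H0)%VS; last first.
  have SA' : S `<=` A.
    apply/fsubsetP => H HS; have := fsubsetP SA H HS.
    rewrite in_fset1U => /orP[/eqP e|//]; by move: ZH0; rewrite -e capS_le.
  have [C CP mC] := IH1 S SA' S0.
  have [e|CXY] : C = B \/ C \in X ++ Y.
    move: CP; rewrite !mem_cat mem_nseq => /or3P[->|/andP[_ /eqP ->]|->].
    - by right.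
    - by left.
    - by right; rewrite orbT.
  - exists (H0 |` B); first by rewrite mem_cat mem_head orbT.
    case: mC => H [HC ZH u]; exists H; split=> //.
      by rewrite in_fset1U -e HC orbT.
    move=> K; rewrite in_fset1U => /orP[/eqP-> h|KB]; first by case/negP: ZH0.
    by apply: u; rewrite e.
  - exists C => //; move: CXY; rewrite !mem_cat inE => /orP[->|->] //.
    by rewrite !orbT.
pose S' := cut H0 (S `\ H0).
(* If [S] is just [H0], the flat is [H0] and gives nothing to restrict; the block of [H0] then
   contains no other hyperplane through it. *)
have [e|S'0] := eqVneq (S `\ H0) fset0.
  exists (H0 |` B); first by rewrite mem_cat mem_head orbT.
  have SE : S = [fset H0].
    case/fset0Pn: S0 => H HS; apply/fsetP => K; rewrite in_fset1.
    have S1 L : L \in S -> L = H0.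
      by move=> LS; apply/eqP; move/fsetP/(_ L): e; rewrite !inE LS andbT => /negbFE.
    by apply/idP/eqP => [/S1//|->]; rewrite -(S1 H HS).
  have ZE : Z = H0.
    apply/eqP; rewrite eqEsubv ZH0 le_capS H0W SE.
    by apply/allP => K; rewrite in_fset1 => /eqP ->.
  exists H0; split=> //; first by rewrite in_fset1U eqxx.
  move=> K; rewrite in_fset1U => /orP[/eqP//|KB]; rewrite ZE => H0K.
  have /andP[_ /eqP dK] : is_hyp W K.
    apply: (IFpair_arr IF1); apply: (part_mem (IFpair_part IF1) _ KB).
    rewrite !mem_cat mem_nseq eqxx andbT.
    by rewrite (_ : B != fset0) ?orbT //; apply/fset0Pn; exists K.
  apply/esym/eqP; rewrite eqEdim H0K /= -ltnS dK.
  by case/andP: hH0 => _ /eqP ->.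
have ZE : capS H0 S' = Z.
  apply/eqP; rewrite eqEsubv !le_capS ZH0 /=; apply/andP; split.
    apply/andP; split.
      have := subvv (capS H0 S'); rewrite le_capS => /andP[h _].
      exact: subv_trans h H0W.
    apply/allP => H HS; have [->|nH] := eqVneq H H0.
      by have := subvv (capS H0 S'); rewrite le_capS => /andP[].
    apply: (subv_trans (capS_le _ _)) (capvSl H H0).
    by apply/imfsetP; exists H; rewrite ?in_fsetD1 ?nH.
  apply/allP => K /imfsetP[/= H]; rewrite in_fsetD1 => /andP[_ HS] ->.
  by rewrite subv_cap ZH0 capS_le.
have S'A : S' `<=` cut H0 A.
  apply/fsubsetP => K /imfsetP[/= H]; rewrite in_fsetD1 => /andP[nH HS] ->.
  apply/imfsetP; exists H => //; have := fsubsetP SA H HS.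
  by rewrite in_fset1U (negbTE nH).
have S'N : S' != fset0.
  case/fset0Pn: S'0 => H HS; apply/fset0Pn; exists (H :&: H0)%VS.
  by apply/imfsetP; exists H.
have [C CXY] := IH2 S' S'A S'N; rewrite ZE => -[K [KC ZK u]].
have /mapP[D DXY eC] : C \in [seq cut H0 D | D : {fset sp} <- X ++ Y] by exact: CXY.
move: KC; rewrite eC => /imfsetP[/= H HD e]; move: ZK u; rewrite eC e => ZH u.
exists D; first by move: DXY; rewrite !mem_cat inE => /orP[->|->]; rewrite ?orbT.
exists H; split=> //; first exact: subv_trans ZH (capvSl _ _).
move=> L LD ZL; apply: (inj D DXY) => //; apply: u.
  by apply/imfsetP; exists L.
by rewrite subv_cap ZL.
Qed.

Lemma ind_factored_factored W A : ind_factored W A -> factored W A.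
Proof.
case=> P IF; exists P; split; first by apply/partE/(IFpair_part IF).
split; first exact: (indep_independent (IFpair_indep IF)).
move=> S SA S0 _; have [B BP mB] := IFpair_singular IF SA S0.
exists (index B P); first by rewrite index_mem.
by apply/meets_onceP; rewrite /blk nth_index.
Qed.

End Addition.

(** * The coloring of connected sets given by a nice partition *)

Section Colouring.
Local Open Scope ring_scope.
Variable n : nat.
Local Notation V := 'rV[rat]_n.
Local Notation sp := {vspace V}.
Implicit Types (I J M : {set 'I_n}) (H : sp).

Lemma HI_kerf I : HI I = kerf (cvec I). Proof. by []. Qed.

Lemma ev_cvec I (w : V) : ev (cvec I) w = \sum_(i in I) w 0 i.
Proof.
rewrite /ev mxE [RHS]big_mkcond; apply: eq_bigr => i _.
by rewrite mxE; case: (i \in I); rewrite ?mulr1 ?mulr0.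
Qed.

Lemma ev_cvec_delta I k : ev (cvec I) (delta_mx 0 k) = (k \in I)%:R.
Proof.
rewrite ev_cvec big_mkcond /= (bigD1 k) //= big1 ?addr0 => [|i ne].
  by rewrite mxE !eqxx; case: (k \in I).
by rewrite mxE eqxx (negbTE ne); case: (i \in I).
Qed.

Lemma cvecU I J : [disjoint I & J] -> cvec (I :|: J) = cvec I + cvec J.
Proof.
move=> d; apply/colP => k; rewrite !mxE in_setU.
by have := disjointFr d (x := k); case: (k \in I) => [->|_];
  rewrite ?addr0 ?add0r.
Qed.

Lemma HI_inj : injective (@HI n).
Proof.
move=> I J e; apply/setP => k.
have := mem_kerf (cvec I) (delta_mx 0 k); rewrite -HI_kerf e mem_kerf !ev_cvec_delta.
by case: (k \in I); case: (k \in J).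
Qed.

Lemma HI_hyp I : I != set0 -> is_hyp fullv (HI I).
Proof.
case/set0Pn => k kI; rewrite HI_kerf -(capfv (kerf _)).
apply: (@hyp_is_hyp n fullv (cvec I) (delta_mx 0 k)); first exact: memvf.
by rewrite ev_cvec_delta kI oner_eq0.
Qed.

(** The nonzero 0/1 vectors in the span of two given ones. A disjoint pair offers only the union and
    a nested pair only the difference, so at most one set is new. *)
Definition third I J M :=
  [\/ M = I, M = J, [disjoint I & J] /\ M = I :|: J
    | J \subset I /\ M = I :\: J \/ I \subset J /\ M = J :\: I].

(** Test vectors in both kernels: a unit vector outside both sets, a difference of two unit vectors
    from one Venn region, and [p + q - r] with one index from each region. So [M] is constant on
    each region, misses the outside, and its value on the overlap is the sum of the other two
    values, which excludes 1 + 1. *)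
Lemma HI_span I J M : I != set0 -> J != set0 -> M != set0 ->
  (HI I :&: HI J <= HI M)%VS -> third I J M.
Proof.
move=> I0 J0 M0 /subvP sub.
have {}sub w : ev (cvec I) w = 0 -> ev (cvec J) w = 0 -> ev (cvec M) w = 0.
  move=> wI wJ; apply/eqP; rewrite -mem_kerf -HI_kerf; apply: sub.
  by rewrite memv_cap !HI_kerf !mem_kerf wI wJ eqxx.
have out k : k \notin I -> k \notin J -> k \notin M.
  move=> kI kJ; have := sub (delta_mx 0 k).
  rewrite !ev_cvec_delta (negbTE kI) (negbTE kJ) => /(_ erefl erefl).
  by case: (k \in M).
have same k l : (k \in I) = (l \in I) -> (k \in J) = (l \in J) ->
    (k \in M) = (l \in M).
  move=> kI kJ; have := sub (delta_mx 0 k - delta_mx 0 l).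
  rewrite !evBr !ev_cvec_delta kI kJ !subrr => /(_ erefl erefl).
  by case: (k \in M); case: (l \in M).
have mix p q r : p \in I -> p \notin J -> q \notin I -> q \in J -> r \in I ->
    r \in J -> (r \in M) = (p \in M) || (q \in M) /\ ~~ ((p \in M) && (q \in M)).
  move=> pI pJ qI qJ rI rJ.
  have := sub (delta_mx 0 p + delta_mx 0 q - delta_mx 0 r).
  rewrite !evBr !evDr !ev_cvec_delta pI (negbTE pJ) (negbTE qI) qJ rI rJ.
  rewrite addr0 add0r subrr => /(_ erefl erefl).
  by case: (p \in M); case: (q \in M); case: (r \in M).
have hp p k : p \in I -> p \notin J -> k \in I -> k \notin J -> (k \in M) = (p \in M).
  by move=> pI pJ kI kJ; apply: same; rewrite ?pI ?kI ?(negbTE pJ) ?(negbTE kJ).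
have hq q k : q \notin I -> q \in J -> k \notin I -> k \in J -> (k \in M) = (q \in M).
  by move=> pI pJ kI kJ; apply: same; rewrite ?pJ ?kJ ?(negbTE pI) ?(negbTE kI).
have hr r k : r \in I -> r \in J -> k \in I -> k \in J -> (k \in M) = (r \in M).
  by move=> pI pJ kI kJ; apply: same; rewrite ?pI ?kI ?pJ ?kJ.
have ME (mp mq mr : bool) :
    (forall k, k \in I -> k \notin J -> (k \in M) = mp) ->
    (forall k, k \notin I -> k \in J -> (k \in M) = mq) ->
    (forall k, k \in I -> k \in J -> (k \in M) = mr) ->
    M =i [pred k | if k \in I then if k \in J then mr else mp
                   else if k \in J then mq else false].
  move=> h1 h2 h3 k; rewrite inE.
  case: (boolP (k \in I)) => kI; case: (boolP (k \in J)) => kJ.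
  - exact: h3.
  - exact: h1.
  - exact: h2.
  - exact/negbTE/out.
have M0' : ~ (forall k, (k \in M) = false).
  by move=> h; case/set0Pn: M0 => k; rewrite h.
have [JI|/subsetPn[q qJ qI]] := boolP (J \subset I).
  have hJ k : k \notin I -> k \in J -> (k \in M) = false.
    by move=> /negP kI /(subsetP JI).
  have [IJ|/subsetPn[p pI pJ]] := boolP (I \subset J).
    have IE : I = J by apply/eqP; rewrite eqEsubset IJ JI.
    case/set0Pn: J0 => r rJ; have rI := subsetP JI r rJ.
    have hI k : k \in I -> k \notin J -> (k \in M) = false.
      by rewrite IE => ->.
    have E := ME _ _ _ hI hJ (fun k => hr r k rI rJ).
    move: E; case: (r \in M) => E; last first.
      by case: M0' => k; rewrite E inE IE; case: (k \in J).
    by constructor 1; apply/setP => k; rewrite E inE IE; case: (k \in J).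
  case/set0Pn: J0 => r rJ; have rI := subsetP JI r rJ.
  have E := ME _ _ _ (fun k => hp p k pI pJ) hJ (fun k => hr r k rI rJ).
  move: E; case: (r \in M); case: (p \in M) => E.
  - constructor 1; apply/setP => k; rewrite E inE.
    by case: (k \in I); case: (k \in J).
  - constructor 2; apply/setP => k; rewrite E inE.
    by move: (subsetP JI k); case: (k \in I); case: (k \in J) => // /(_ isT).
  - constructor 4; left; split=> //; apply/setP => k; rewrite E inE in_setD.
    by case: (k \in I); case: (k \in J).
  - by case: M0' => k; rewrite E inE; case: (k \in I); case: (k \in J).
have [IJ|/subsetPn[p pI pJ]] := boolP (I \subset J).
  have hI k : k \in I -> k \notin J -> (k \in M) = false.
    by move=> /(subsetP IJ) ->.
  case/set0Pn: I0 => r rI; have rJ := subsetP IJ r rI.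
  have E := ME _ _ _ hI (fun k => hq q k qI qJ) (fun k => hr r k rI rJ).
  move: E; case: (r \in M); case: (q \in M) => E.
  - constructor 2; apply/setP => k; rewrite E inE.
    by move: (subsetP IJ k); case: (k \in I); case: (k \in J) => // /(_ isT).
  - constructor 1; apply/setP => k; rewrite E inE.
    by move: (subsetP IJ k); case: (k \in I); case: (k \in J) => // /(_ isT).
  - constructor 4; right; split=> //; apply/setP => k; rewrite E inE in_setD.
    by case: (k \in I); case: (k \in J).
  - by case: M0' => k; rewrite E inE; case: (k \in I); case: (k \in J).
have [dIJ|/pred0Pn[r /andP[rI rJ]]] := boolP [disjoint I & J].
  have hIJ k : k \in I -> k \in J -> (k \in M) = false.
    by move=> kI; rewrite (disjointFr dIJ kI).
  have E := ME _ _ _ (fun k => hp p k pI pJ) (fun k => hq q k qI qJ) hIJ.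
  have dd k : k \in I -> (k \in J) = false by move=> kI; rewrite (disjointFr dIJ kI).
  move: E; case: (p \in M); case: (q \in M) => E.
  - constructor 3; split=> //; apply/setP => k; rewrite E inE in_setU.
    by move: (dd k); case: (k \in I); case: (k \in J) => // /(_ isT).
  - constructor 1; apply/setP => k; rewrite E inE.
    by move: (dd k); case: (k \in I); case: (k \in J) => // /(_ isT).
  - constructor 2; apply/setP => k; rewrite E inE.
    by move: (dd k); case: (k \in I); case: (k \in J) => // /(_ isT).
  - by case: M0' => k; rewrite E inE; case: (k \in I); case: (k \in J).
have [rE nE] := mix p q r pI pJ qI qJ rI rJ.
have E := ME _ _ _ (fun k => hp p k pI pJ) (fun k => hq q k qI qJ)
  (fun k => hr r k rI rJ).
move: E nE; rewrite rE; case: (p \in M); case: (q \in M) => //= E _.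
- constructor 1; apply/setP => k; rewrite E inE.
  by case: (k \in I); case: (k \in J).
- constructor 2; apply/setP => k; rewrite E inE.
  by case: (k \in I); case: (k \in J).
- by case: M0' => k; rewrite E inE; case: (k \in I); case: (k \in J).
Qed.

Variable e : rel 'I_n.

Definition conn I := (I != set0) && induced_connected e I.

Lemma AGP H : reflect (exists2 I, conn I & H = HI I) (H \in AG e).
Proof.
apply: (iffP (imfsetP _ _ _ _)) => /= -[I].
  by rewrite mem_filter => /andP[cI _] ->; exists I.
by move=> cI ->; exists I; rewrite // mem_filter -/(conn I) cI mem_enum.
Qed.

Lemma mem_AG I : conn I -> HI I \in AG e.
Proof. by move=> cI; apply/AGP; exists I. Qed.

(* [joinable I J] says that [HI I :&: HI J] lies on a third member of [AG e]. *)
Definition joinable I J :=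
  [|| [disjoint I & J] && conn (I :|: J), (J \subset I) && conn (I :\: J)
    | (I \subset J) && conn (J :\: I)].

(** The sum counts equal pairs among three colors and is 0, 1 or 3. The value 0 would give three
    blocks with dependent members, against independence; the value 3 would leave the rank-two flat
    without a singleton block. *)
Definition coloring (col : {set 'I_n} -> nat) :=
  (forall I J, conn I -> conn J -> I != J -> col I = col J -> joinable I J) /\
  (forall I J, conn I -> conn J -> [disjoint I & J] -> conn (I :|: J) ->
    ((col I == col J) + (col I == col (I :|: J)) + (col J == col (I :|: J)) = 1)%N).

Lemma codim_bigcap (I : finType) (P : pred I) (f : I -> sp) :
  (forall i, P i -> is_hyp fullv (f i)) ->
  (\dim (fullv : sp) <= \dim (\bigcap_(i | P i) f i)%VS + #|P|)%N.
Proof.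
move=> hf; rewrite -sum1_card.
elim/big_rec2: _ => [|i k Z Pi IH]; first by rewrite addn0.
have /andP[_ /eqP d] := hf i Pi.
have := dimv_sum_cap (f i) Z; have := dimvS (subvf (f i + Z)%VS); lia.
Qed.

(** In a transversal through all three, [H3] adds nothing to the intersection, whose codimension
    then stays below the number of blocks. *)
Lemma dependent_triple P i j k (H1 H2 H3 : sp) :
  (forall l, (l < size P)%N -> exists H, H \in blk P l) ->
  (forall l H, (l < size P)%N -> H \in blk P l -> is_hyp fullv H) ->
  (i < size P)%N -> (j < size P)%N -> (k < size P)%N ->
  H1 \in blk P i -> H2 \in blk P j -> H3 \in blk P k ->
  i != j -> i != k -> j != k ->
  (H1 :&: H2 <= H3)%VS -> ~ independent fullv P.
Proof.
move=> ne hyps ip jp kp m1 m2 m3 nij nik njk le ind.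
(* The remaining blocks are nonempty, so taking their first elements completes the transversal and
   the default [0%VS] is never reached. *)
pose f l := if l == i then H1 else if l == j then H2 else if l == k then H3
  else nth 0%VS (enum_fset (blk P l)) 0.
have fi : f i = H1 by rewrite /f eqxx.
have fj : f j = H2 by rewrite /f eqxx eq_sym (negbTE nij).
have fk : f k = H3 by rewrite /f eqxx eq_sym (negbTE nik) eq_sym (negbTE njk).
have fP l : (l < size P)%N -> f l \in blk P l.
  move=> lp; have [->|nli] := eqVneq l i; first by rewrite fi.
  have [->|nlj] := eqVneq l j; first by rewrite fj.
  have [->|nlk] := eqVneq l k; first by rewrite fk.
  rewrite /f (negbTE nli) (negbTE nlj) (negbTE nlk).
  have [H HB] := ne l lp.
  change (nth 0%VS (enum_fset (blk P l)) 0 \in enum_fset (blk P l)).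
  apply: mem_nth; move: HB; rewrite -[H \in blk P l]/(H \in enum_fset _).
  by case: (enum_fset _).
have := ind f fP; rewrite (bigD1 (Ordinal kp)) //= fk.
have := @codim_bigcap _ (fun l : 'I_(size P) => l != Ordinal kp) (fun l => f l).
set Z := (\bigcap_(l < size P | _) f l)%VS; rewrite cardC1 card_ord => cd.
have Z1 : (Z <= H1)%VS.
  by rewrite -fi; apply: (bigcapv_inf (Ordinal ip)).
have Z2 : (Z <= H2)%VS.
  by rewrite -fj; apply: (bigcapv_inf (Ordinal jp)).
have /capv_idPr -> : (Z <= H3)%VS.
  by apply: subv_trans le; rewrite subv_cap Z1 Z2.
have {}cd : (\dim (fullv : sp) <= \dim Z + (size P).-1)%N.
  by apply: cd => l _; apply: (hyps l); [|apply: fP]; apply: ltn_ord.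
have := kp; move: cd; clear; lia.
Qed.

(** The singleton condition at the rank-two flat spanned by the two hyperplanes, expressed through
    vertex sets. *)
Lemma nice_pair P I J : nice fullv (AG e) P -> conn I -> conn J -> I != J ->
  exists i M, [/\ (i < size P)%N, conn M /\ HI M \in blk P i,
    (HI I :&: HI J <= HI M)%VS &
    forall M', conn M' -> (HI I :&: HI J <= HI M')%VS -> HI M' \in blk P i -> M' = M].
Proof.
case=> /partE pA [_ sing] cI cJ nIJ; set S := [fset HI I; HI J]%fset.
have cS : capS fullv S = (HI I :&: HI J)%VS.
  rewrite /capS big_fsetU1 /= ?big_seq_fset1 //.
  by rewrite in_fset1; apply: contra nIJ => /eqP/HI_inj ->.
have SA : (S `<=` AG e)%fset.
  by apply/fsubsetP => H; rewrite in_fset2 => /orP[]/eqP->; apply: mem_AG.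
have S0 : S != fset0 by apply/fset0Pn; exists (HI I); rewrite in_fset2 eqxx.
have SW : capS fullv S != fullv.
  case/andP: cI => I0 _.
  rewrite cS; apply: contraTneq (hyp_proper (HI_hyp I0)) => E.
  by rewrite negbK -[X in (X <= _)%VS]E capvSl.
have [i ip] := sing S SA S0 SW.
rewrite cS => /eqP/cardfs1P[H HE].
have := fset11 H; rewrite -HE !inE => /andP[Hi HS].
have /AGP[M cM HM] : H \in AG e by apply: (part_mem pA _ Hi); rewrite mem_nth.
exists i, M; rewrite -HM; split=> // M' cM' le cE; apply: HI_inj; rewrite -HM.
have : HI M' \in [fset H]%fset by rewrite -HE !inE le cE.
by rewrite in_fset1 => /eqP.
Qed.

Lemma subv_HIU I J : [disjoint I & J] -> (HI I :&: HI J <= HI (I :|: J))%VS.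
Proof.
move=> dIJ; apply/subvP => w; rewrite memv_cap !HI_kerf !mem_kerf cvecU // evDl.
by move=> /andP[/eqP-> /eqP->]; rewrite addr0.
Qed.

Lemma nice_triple P I J i j k : nice fullv (AG e) P -> conn I -> conn J ->
  [disjoint I & J] -> conn (I :|: J) ->
  (i < size P)%N -> (j < size P)%N -> (k < size P)%N ->
  HI I \in blk P i -> HI J \in blk P j -> HI (I :|: J) \in blk P k ->
  [|| i == j, i == k | j == k].
Proof.
case=> /partE pA [ind _] cI cJ dIJ cIJ ip jp kp mI mJ mK.
apply: contraT; rewrite !negb_or => /and3P[nij nik njk].
suff : ~ independent fullv P by move/(_ ind).
apply: (dependent_triple _ _ ip jp kp mI mJ mK nij nik njk (subv_HIU dIJ)).
- move=> l lp; apply/fset0Pn; case: pA => h _ _.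
  by apply: contraNneq h => <-; rewrite mem_nth.
- move=> l H lp Hl; have /AGP[M /andP[M0 _] ->] : H \in AG e.
    by apply: (part_mem pA _ Hl); rewrite mem_nth.
  exact: HI_hyp.
Qed.

Lemma nice_coloring P : nice fullv (AG e) P -> exists col, coloring col.
Proof.
move=> nP; pose col I := find (fun B : {fset sp} => HI I \in B) P.
have conn0 I : conn I -> I != set0 by case/andP.
have colE I i : conn I -> (i < size P)%N -> HI I \in blk P i -> col I = i.
  move=> cI ip Ii; case: nP => -[_ h2 _] _.
  have hP : has (fun B : {fset sp} => HI I \in B) P.
    by apply/(has_nthP fset0); exists i.
  have lc : (col I < size P)%N by rewrite -has_find.
  case: (col I =P i) => // ne; have /fsetP/(_ (HI I)) := h2 _ _ lc ip ne.
  by rewrite in_fsetI (nth_find fset0 hP) Ii in_fset0.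
have hcol I : conn I -> (col I < size P)%N /\ HI I \in blk P (col I).
  move=> cI; case: nP => -[_ _ h3] _.
  by have /h3[i ip Ii] := mem_AG cI; rewrite (colE I i).
have pair I J : conn I -> conn J -> I != J -> exists M,
    [/\ conn M, third I J M, (col I = col M -> I = M), (col J = col M -> J = M) &
     [disjoint I & J] -> conn (I :|: J) -> col (I :|: J) = col M -> I :|: J = M].
  move=> cI cJ nIJ; have [i [M [ip [cM Mi] le u]]] := nice_pair nP cI cJ nIJ.
  have u' M' : conn M' -> (HI I :&: HI J <= HI M')%VS -> col M' = col M -> M' = M.
    by move=> c1 l1; rewrite (colE M i) // => c2; apply: u; rewrite // -c2 (hcol M' c1).2.
  exists M; split; first exact: cM.
  - exact: (HI_span (conn0 _ cI) (conn0 _ cJ) (conn0 _ cM) le).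
  - exact: (u' _ cI (capvSl _ _)).
  - exact: (u' _ cJ (capvSr _ _)).
  - by move=> d c; apply: (u' _ c (subv_HIU d)).
have triple I J : conn I -> conn J -> [disjoint I & J] -> conn (I :|: J) ->
    [|| col I == col J, col I == col (I :|: J) | col J == col (I :|: J)].
  move=> cI cJ dIJ cIJ; have [lI mI] := hcol I cI; have [lJ mJ] := hcol J cJ.
  have [lK mK] := hcol _ cIJ.
  exact: (nice_triple nP cI cJ dIJ cIJ lI lJ lK mI mJ mK).
exists col; move: col conn0 pair triple {nP colE hcol} => col conn0 pair triple.
split=> [I J cI cJ nIJ cE|I J cI cJ dIJ cIJ].
  have [M [cM t u1 u2 _]] := pair I J cI cJ nIJ.
  case: t => [e1|e1|[d e1]|[[d e1]|[d e1]]].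
  - by case/eqP: nIJ; rewrite -e1; apply/esym/u2; rewrite -cE e1.
  - by case/eqP: nIJ; rewrite -e1; apply/u1; rewrite cE e1.
  - by rewrite /joinable d -e1 cM.
  - by rewrite /joinable d -e1 cM orbT.
  - by rewrite /joinable d -e1 cM !orbT.
have nIJ : I != J.
  apply: contraTneq dIJ => <-; rewrite -setI_eq0 setIid; exact: conn0.
have [M [cM t u1 u2 u3]] := pair I J cI cJ nIJ.
have {}u3 := u3 dIJ cIJ.
(* With a single color the distinguished set [M] has it too, whichever member of the flat it is, and
   uniqueness then identifies both [I] and [J] with [M]. Nested cases contradict disjointness. *)
have not_all : ~ (col I = col J /\ col I = col (I :|: J)).
  case=> e1 e2; case/eqP: nIJ.
  have iE : col I = col M.
    case: t => [->|->|[_ ->]|[[d _]|[d _]]] //.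
    - case/set0Pn: (conn0 _ cJ) => k kJ; move: (disjointFr dIJ (subsetP d k kJ)).
      by rewrite kJ.
    - case/set0Pn: (conn0 _ cI) => k kI; move: (disjointFr dIJ kI).
      by rewrite (subsetP d).
  by rewrite (u1 iE) u2 // -e1.
have := triple I J cI cJ dIJ cIJ; move: not_all.
case: (col I =P col J) => [<-|n1].
  by case: (col I =P _) => // e2 h; case: h.
case: (col I =P col (I :|: J)) => [<-|n2] //=.
  by rewrite eq_sym => _ _; case: eqP n1.
by case: eqP.
Qed.

End Colouring.

(** * Connectivity and colorings of minors *)

Section Connectivity.
Variables (n : nat) (e : rel 'I_n).
Hypothesis e_sym : symmetric e.
Implicit Types (I J K : {set 'I_n}) (x y : 'I_n).
Local Notation conn := (conn e).

Definition adj I J := [exists x in I, exists y in J, e x y].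

Lemma adjP I J : reflect (exists x y, [/\ x \in I, y \in J & e x y]) (adj I J).
Proof.
apply: (iffP exists_inP) => [[x xI /exists_inP[y yJ exy]]|[x [y [xI yJ exy]]]].
  by exists x, y.
by exists x => //; apply/exists_inP; exists y.
Qed.

Lemma adjC I J : adj I J = adj J I.
Proof.
by apply/adjP/adjP => -[x [y [xI yJ exy]]]; exists y, x; rewrite e_sym.
Qed.

(** A path in [I] from [J] to its complement crosses an edge leaving [J]; conversely, the part of
    [I] reachable from [x] has no edge leaving it. Cuts pass through unions and branch sets more
    easily than [connect]. *)
Lemma connP I : reflect
  (I != set0 /\ forall J, J \subset I -> J != set0 -> J != I -> adj J (I :\: J))
  (conn I).
Proof.
pose r I := [rel a b | [&& e a b, a \in I & b \in I]].
apply: (iffP andP) => -[I0 h]; split=> //.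
  move=> J JI /set0Pn[x xJ] nJ.
  have /subsetPn[y yI yJ] : ~~ (I \subset J).
    by apply: contra nJ => IJ; rewrite eqEsubset JI.
  have xI := subsetP JI x xJ.
  have cxy : connect (r I) x y by move/forall_inP: h => /(_ x xI)/forall_inP; apply.
  apply: contraT => na; move: yJ; rewrite -(closed_connect _ cxy) ?xJ // => a b.
  case/and3P=> eab aI bI; apply/idP/idP => [aJ|bJ]; apply: contraNT na => nJb.
    by apply/adjP; exists a, b; rewrite inE nJb.
  by apply/adjP; exists b, a; rewrite inE nJb e_sym.
apply/forall_inP => x xI; apply/forall_inP => y yI.
pose J := [set z in I | connect (r I) x z].
have JI : J \subset I by apply/subsetP => z; rewrite inE => /andP[].
have xJ : x \in J by rewrite inE xI connect0.
have [JE|nJ] := eqVneq J I; first by have : y \in J by [rewrite JE]; rewrite inE => /andP[].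
have J0 : J != set0 by apply/set0Pn; exists x.
have /adjP[a [b []]] := h J JI J0 nJ; rewrite !inE => /andP[aI ca] /andP[nb bI] eab.
case/negP: nb; rewrite bI; apply: (connect_trans ca); apply: connect1.
by rewrite /= eab aI bI.
Qed.

Lemma conn_neq0 I : conn I -> I != set0. Proof. by case/andP. Qed.

Lemma conn1 x : conn [set x].
Proof.
apply/connP; split; first by apply/set0Pn; exists x; rewrite inE.
by move=> J; rewrite subset1 => /orP[/eqP->|/eqP->]; rewrite eqxx.
Qed.

Lemma conn_cut I J : conn I -> J \subset I -> J != set0 -> I :\: J != set0 ->
  adj J (I :\: J).
Proof.
case/connP=> _ h JI J0 /set0Pn[x xIJ]; apply: h => //.
by apply: contraTneq xIJ => ->; rewrite setDv inE.
Qed.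

End Connectivity.

(** * Exhaustive search for colorings of a small graph *)

Section Solver.
Variables (k : nat) (h : rel nat).
Implicit Types (s t u : seq nat).

(* A subset of the vertices [0, .., k - 1] of the graph [h] is the increasing list
   of its elements. *)
Definition hadj s t := has (fun i => has (h i) t) s.

Fixpoint splits s : seq (seq nat * seq nat) :=
  if s is i :: s' then
    flatten [seq [:: (i :: p.1, p.2); (p.1, i :: p.2)] | p <- splits s']
  else [:: ([::], [::])].

(** The cut criterion of [connP], checked on all two-sided splittings; exponential, but run only on
    four or five vertices. *)
Definition hconn s := (s != [::]) &&
  all (fun p => [|| nilp p.1, nilp p.2 | hadj p.1 p.2]) (splits s).

(** Filtering [iota] keeps the list increasing, so that equality of lists is equality of sets. *)
Definition hunion s t := [seq i <- iota 0 k | (i \in s) || (i \in t)].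
Definition hdiff s t := [seq i <- s | i \notin t].
Definition hdisj s t := ~~ has (mem t) s.
Definition hsub s t := all (mem t) s.

Definition hjoinable s t :=
  [|| hdisj s t && hconn (hunion s t), hsub t s && hconn (hdiff s t)
    | hsub s t && hconn (hdiff t s)].

Definition one_pair (p q r : seq nat) := ((p == q) + (p == r) + (q == r) == 1)%N.

(* An entry [(s, r)] records that [s] has the color of [r]; representatives have
   pairwise distinct colours. *)
Definition consistent s r (env : seq (seq nat * seq nat)) :=
  all (fun p =>
    [&& if r == p.2 then (s == p.1) || hjoinable s p.1 else true,
        if hdisj s p.1 then let u := hunion s p.1 in
          all (fun q => if q.1 == u then one_pair r p.2 q.2 else true) env
        else true
      & if hsub p.1 s then let d := hdiff s p.1 in
          all (fun q => if q.1 == d then one_pair p.2 q.2 r else true) env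
        else true]) env.

(** Backtracking: [s] receives the color of an existing representative or opens a new color
    represented by itself, so colors are never permuted. The value is [true] when all branches fail.
    The [if] keeps call-by-value evaluation from entering inconsistent branches. *)
Fixpoint refute order env : bool :=
  if order is s :: order' then
    all (fun r => if consistent s r env then refute order' ((s, r) :: env) else true)
        (s :: undup (unzip2 env))
  else false.

(** Binary counting order: each set comes after its proper subsets, so its splittings into two parts
    constrain it as soon as it is colored. *)
Fixpoint subs m : seq (seq nat) :=
  if m is m'.+1 then subs m' ++ [seq rcons s m' | s <- subs m'] else [:: [::]].

Definition uncolorable := refute (filter hconn (subs k)) [::].

Definition canon s := s == [seq i <- iota 0 k | i \in s].

Lemma subs_sorted m s : s \in subs m -> m <= k -> canon s.
Proof.
move=> ss mk; have {ss}: s = [seq i <- iota 0 m | i \in s] /\ {in s, forall i, i < m}.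
  elim: m s {mk} ss => [|m IH] s; first by rewrite inE => /eqP ->.
  have iS : iota 0 m.+1 = iota 0 m ++ [:: m] by rewrite -addn1 iotaD.
  rewrite iS [subs _]/= mem_cat => /orP[/IH[sE lt]|/mapP[t /IH[tE lt] ->]].
    rewrite filter_cat /= -sE.
    have -> : m \in s = false by apply/negP => /lt; rewrite ltnn.
    by rewrite cats0; split=> // i /lt; lia.
  split; last by move=> i; rewrite mem_rcons inE => /orP[/eqP->|/lt]; lia.
  rewrite filter_cat /= mem_rcons mem_head cats1.
  congr rcons; rewrite [LHS]tE; apply: eq_in_filter => i.
  by rewrite mem_iota mem_rcons inE => /andP[_]; case: eqP => //; lia.
case=> sE lt; apply/eqP; rewrite [LHS]sE.
have -> : iota 0 k = iota 0 m ++ iota m (k - m) by rewrite -iotaD; congr iota; lia.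
rewrite filter_cat -[LHS]cats0; congr (_ ++ _); apply/esym/eqP.
rewrite -[_ == _]negbK -has_filter; apply/hasPn => i; rewrite mem_iota.
by move=> /andP[mi _]; apply/negP => /lt; lia.
Qed.

Variable g : seq nat -> nat.
Hypothesis g_pair : forall s t, canon s -> canon t -> hconn s -> hconn t ->
  s != t -> g s = g t -> hjoinable s t.
Hypothesis g_triple : forall s t, canon s -> canon t -> hconn s -> hconn t ->
  hdisj s t -> hconn (hunion s t) ->
  ((g s == g t) + (g s == g (hunion s t)) + (g t == g (hunion s t)) = 1)%N.

Definition env_ok (env : seq (seq nat * seq nat)) :=
  {in env, forall p, [/\ canon p.1, hconn p.1 & g p.1 = g p.2]} /\
  {in env &, forall p q, g p.2 = g q.2 -> p.2 = q.2}.

(** The actual coloring [g] selects a branch: [r] is the representative already carrying the color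
    [g s], or [s] itself if that color is new. This choice is always consistent, so the branch
    survives until the list is exhausted. *)
Lemma refuteP order env :
  all (fun s => canon s && hconn s) order -> env_ok env -> ~ refute order env.
Proof.
elim: order env => [|s order IH] env //= /andP[/andP[ms cs] ao] [ok inj].
case/andP=> h0 /allP h1.
have [r rs [gr rinj]] : exists2 r, r \in s :: undup (unzip2 env) &
    g s = g r /\ {in env, forall p, g p.2 = g r -> p.2 = r}.
  have [/hasP[p pe /eqP gp]|/hasPn hn] := boolP (has (fun p => g p.2 == g s) env).
    exists p.2; first by rewrite inE mem_undup map_f ?orbT.
    by split=> // q qe; apply: inj.
  exists s; first exact: mem_head.
  by split=> // p /hn /eqP np /np.
have ok' : env_ok ((s, r) :: env).
  split=> [p|p q]; rewrite !inE.
    by case/orP=> [/eqP->|/ok].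
  case/orP=> [/eqP->|pe]; case/orP=> [/eqP->|qe] //=.
  - by move=> e1; rewrite (rinj _ qe).
  - exact: rinj.
  - exact: inj.
have cons : consistent s r env.
  have eqg p : p \in env -> (r == p.2) = (g s == g p.1).
    move=> pe; have [_ _ gp] := ok p pe; rewrite gr gp.
    by apply/eqP/eqP => [->//|e1]; apply/esym/rinj.
  have eqg2 p q : p \in env -> q \in env -> (p.2 == q.2) = (g p.1 == g q.1).
    move=> pe qe; have [_ _ ->] := ok p pe; have [_ _ ->] := ok q qe.
    by apply/eqP/eqP => [->//|]; apply: inj.
  apply/allP => p pe; have [mp cp _] := ok p pe; apply/and3P; split.
  - rewrite eqg //; case: eqP => // e1.
    by case: eqVneq => //= ne; apply: g_pair.
  - case: ifP => // d; apply/allP => q qe; case: eqP => // E.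
    have [mq cq _] := ok q qe.
    by rewrite /one_pair !eqg // eqg2 // E g_triple // -E.
  - case: ifP => // d; apply/allP => q qe; case: eqP => // E.
    have [mq cq _] := ok q qe.
    have dpq : hdisj p.1 q.1.
      by apply/hasPn => i ip; rewrite /= E /hdiff mem_filter ip.
    have sE : hunion p.1 q.1 = s.
      rewrite [RHS](eqP ms); apply: eq_in_filter => i _; rewrite E /hdiff mem_filter.
      by case: (boolP (i \in p.1)) => //= /(allP d) /= ->.
    by rewrite /one_pair eqg2 // ![_ == r]eq_sym !eqg // ![g s == _]eq_sym -sE
      g_triple // sE.
suff: refute order ((s, r) :: env) by apply: IH.
move: rs; rewrite inE => /orP[/eqP e1|re].
  by move: h0; rewrite e1 in cons *; rewrite cons.
by have := h1 r re; rewrite cons.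
Qed.

Lemma uncolorableP : ~ uncolorable.
Proof.
apply: refuteP; last by split=> p.
apply/allP => s; rewrite mem_filter => /andP[-> /subs_sorted -> //].
Qed.

End Solver.

(** * Pulling a coloring back to an induced minor *)

Section Minor.
Variables (n : nat) (e : rel 'I_n).
Hypothesis e_sym : symmetric e.
Variables (k : nat) (h : rel nat) (B : nat -> {set 'I_n}).
Hypothesis Bconn : forall i, i < k -> conn e (B i).
Hypothesis Bdisj : forall i j, i < k -> j < k -> i != j -> [disjoint B i & B j].
Hypothesis Badj : forall i j, i < k -> j < k -> i != j -> adj e (B i) (B j) = h i j.
Implicit Types (s t : seq nat).

Definition bunion s : {set 'I_n} := [set x | has (fun i => x \in B i) s].

Lemma bunionP s x : reflect (exists2 i, i \in s & x \in B i) (x \in bunion s).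
Proof. by rewrite inE; apply: hasP. Qed.

Lemma B_inj i j x : i < k -> j < k -> x \in B i -> x \in B j -> i = j.
Proof.
move=> ik jk xi xj; have [//|ne] := eqVneq i j.
by have := disjointFr (Bdisj ik jk ne) xi; rewrite xj.
Qed.

Lemma canon_lt s : canon k s -> {in s, forall i, i < k}.
Proof. by move=> /eqP -> i; rewrite mem_filter mem_iota => /andP[_]. Qed.

Lemma mem_bunion s i x : {in s, forall j, j < k} -> i < k -> x \in B i ->
  (x \in bunion s) = (i \in s).
Proof.
move=> sk ik xi; apply/bunionP/idP => [[j js xj]|]; last by exists i.
by rewrite (B_inj ik (sk j js) xi xj).
Qed.

Lemma bunion_union s t : {in s, forall j, j < k} -> {in t, forall j, j < k} ->
  bunion (hunion k s t) = bunion s :|: bunion t.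
Proof.
move=> sk tk; apply/setP => x; rewrite in_setU; apply/bunionP/orP => [[i]|].
  rewrite mem_filter => /andP[/orP[is_|it] _] xi; [left|right]; apply/bunionP; by exists i.
case=> /bunionP[i ist xi]; exists i; rewrite // mem_filter ist ?orbT mem_iota /=; [exact: sk|exact: tk].
Qed.

Lemma bunion_diff s t : {in s, forall j, j < k} -> {in t, forall j, j < k} ->
  bunion (hdiff s t) = bunion s :\: bunion t.
Proof.
move=> sk tk; apply/setP => x; rewrite in_setD; apply/bunionP/andP => [[i]|[xt /bunionP[i is_ xi]]].
  rewrite mem_filter => /andP[it is_] xi.
  by rewrite (mem_bunion tk (sk i is_) xi) it; split=> //; apply/bunionP; exists i.
exists i => //; rewrite mem_filter is_ andbT.
by rewrite -(mem_bunion tk (sk i is_) xi).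
Qed.

Lemma bunion_disj s t : {in s, forall j, j < k} -> {in t, forall j, j < k} ->
  [disjoint bunion s & bunion t] = hdisj s t.
Proof.
move=> sk tk; rewrite /hdisj -setI_eq0; apply/idP/idP.
  apply: contraL => /hasP[i is_ /= it]; apply/set0Pn.
  have /conn_neq0 /set0Pn[x xi] := Bconn (sk i is_).
  by exists x; rewrite in_setI (mem_bunion sk (sk i is_) xi) (mem_bunion tk (sk i is_) xi) is_ it.
apply: contraR => /set0Pn[x]; rewrite in_setI => /andP[/bunionP[i is_ xi]].
by rewrite (mem_bunion tk (sk i is_) xi) => it; apply/hasP; exists i.
Qed.

Lemma bunion_sub s t : {in s, forall j, j < k} -> {in t, forall j, j < k} ->
  (bunion s \subset bunion t) = hsub s t.
Proof.
move=> sk tk; apply/subsetP/allP => [st i is_|st x /bunionP[i is_ xi]].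
  have /conn_neq0 /set0Pn[x xi] := Bconn (sk i is_).
  rewrite -[mem t i]/(i \in t) -(mem_bunion tk (sk i is_) xi); apply: st.
  by rewrite (mem_bunion sk (sk i is_) xi).
by apply/bunionP; exists i => //; apply: st.
Qed.

Lemma bunion_inj s t : canon k s -> canon k t -> bunion s = bunion t -> s = t.
Proof.
move=> ms mt E; rewrite (eqP ms) (eqP mt); apply: eq_in_filter => i.
rewrite mem_iota => /andP[_ ik].
have /conn_neq0 /set0Pn[x xi] := Bconn ik.
by rewrite -(mem_bunion (canon_lt ms) ik xi) E (mem_bunion (canon_lt mt) ik xi).
Qed.

Lemma bunion_eq0 s : {in s, forall j, j < k} -> (bunion s == set0) = (s == [::]).
Proof.
case: s => [|i s] sk.
  by rewrite (_ : bunion [::] = set0) ?eqxx //; apply/setP => x; rewrite !inE.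
apply/negbTE/set0Pn; have /conn_neq0 /set0Pn[x xi] := Bconn (sk i (mem_head _ _)).
by exists x; apply/bunionP; exists i; rewrite ?mem_head.
Qed.

Lemma adj_bunion s t : {in s, forall j, j < k} -> {in t, forall j, j < k} ->
  hdisj s t -> adj e (bunion s) (bunion t) = hadj h s t.
Proof.
move=> sk tk d; have ne i j : i \in s -> j \in t -> i != j.
  by move=> is_ jt; apply: contraNneq d => ij; apply/hasP; exists i; rewrite //= ij.
apply/adjP/hasP => [[x [y [/bunionP[i is_ xi] /bunionP[j jt yj] exy]]]|[i is_ /hasP[j jt hij]]].
  exists i => //; apply/hasP; exists j => //.
  by rewrite -(Badj (sk i is_) (tk j jt) (ne i j is_ jt)); apply/adjP; exists x, y.
move: hij; rewrite -(Badj (sk i is_) (tk j jt) (ne i j is_ jt)) => /adjP[x [y [xi yj exy]]].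
by exists x, y; split=> //; apply/bunionP; [exists i | exists j].
Qed.

Lemma splits_filter (P : pred nat) s :
  ([seq i <- s | P i], [seq i <- s | ~~ P i]) \in splits s.
Proof.
elim: s => [|i s IH] //=; apply/flattenP.
exists [:: (i :: [seq i <- s | P i], [seq i <- s | ~~ P i]);
           ([seq i <- s | P i], i :: [seq i <- s | ~~ P i])].
  by apply/mapP; exists ([seq i <- s | P i], [seq i <- s | ~~ P i]).
by rewrite !inE; case: (P i); rewrite eqxx ?orbT.
Qed.

Lemma splits_mem s p : p \in splits s ->
  [/\ {subset p.1 <= s}, {subset p.2 <= s},
      {in s, forall i, (i \in p.1) || (i \in p.2)} & uniq s -> hdisj p.1 p.2].
Proof.
elim: s p => [|i s IH] p /=; first by rewrite inE => /eqP ->.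
case/flattenP => _ /mapP[q /IH[s1 s2 c d] ->]; rewrite !inE => /orP[]/eqP-> /=; split.
- by move=> j; rewrite !inE => /orP[->//|/s1 ->]; rewrite orbT.
- by move=> j /s2; rewrite inE orbC => ->.
- move=> j; rewrite !inE => /orP[->//|/c /orP[]->]; by rewrite ?orbT.
- case/andP=> ni us; rewrite /hdisj /= negb_or -/(hdisj _ _) d // andbT.
  by apply: contra ni => /s2.
- by move=> j /s1; rewrite inE orbC => ->.
- by move=> j; rewrite !inE => /orP[->//|/s2 ->]; rewrite orbT.
- move=> j; rewrite !inE => /orP[->|/c /orP[]->]; by rewrite ?orbT.
- case/andP=> ni us; have := d us; rewrite /hdisj has_sym [X in _ -> ~~ X]has_sym /=.
  by rewrite negb_or => ->; rewrite andbT; apply: contra ni => /s1.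
Qed.

(** A cut of the union either splits some branch set, whose connectedness supplies a crossing edge,
    or is a union of branch sets and comes from a splitting of [s]. *)
Lemma conn_bunion s : canon k s -> conn e (bunion s) = hconn h s.
Proof.
move=> ms; have sk := canon_lt ms.
have us : uniq s by rewrite (eqP ms) filter_uniq ?iota_uniq.
apply/(connP e_sym)/andP => -[s0 hs].
  split; first by rewrite -(bunion_eq0 sk).
  apply/allP => p /splits_mem[s1 s2 c /(_ us) d].
  have k1 : {in p.1, forall j, j < k} by move=> j /s1 /sk.
  have k2 : {in p.2, forall j, j < k} by move=> j /s2 /sk.
  have [//|n1] /= := boolP (nilp p.1); have [//|n2] /= := boolP (nilp p.2).
  rewrite -adj_bunion //; have E : bunion p.2 = bunion s :\: bunion p.1.
    apply/setP => x; rewrite in_setD; apply/bunionP/andP => [[i i2 xi]|[x1 /bunionP[i is_ xi]]].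
      rewrite (mem_bunion k1 (k2 i i2) xi); split; last by apply/bunionP; exists i => //; apply: s2.
      by apply: contraNN d => i1; apply/hasP; exists i.
    exists i => //; have := c i is_; rewrite -(mem_bunion k1 (sk i is_) xi).
    by rewrite (negbTE x1).
  rewrite E; apply: hs.
  - by apply/subsetP => x /bunionP[i /s1 is_ xi]; apply/bunionP; exists i.
  - by rewrite bunion_eq0 //; case: (p.1) n1.
  - apply: contraNneq n2 => E'; rewrite /nilp size_eq0 -(bunion_eq0 k2) E E' setDv //.
split; first by rewrite bunion_eq0.
move=> J Js J0 Jn.
have [/hasP[i is_ /andP[i1 i2]]|/hasPn hn] :=
    boolP (has (fun i => (B i :&: J != set0) && ~~ (B i \subset J)) s).
  have /adjP[x [y [xi yi exy]]] : adj e (B i :&: J) (B i :\: (B i :&: J)).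
    apply: (conn_cut e_sym (Bconn (sk i is_))) => //; first exact: subsetIl.
    by rewrite setDIr setDv set0U setD_eq0.
  move: xi yi; rewrite !inE => /andP[xi xJ] /andP[ny yi].
  apply/adjP; exists x, y; rewrite in_setD; split=> //.
  rewrite (_ : y \in bunion s) ?andbT; last by apply/bunionP; exists i.
  by apply: contra ny => ->; rewrite yi.
pose P i := B i \subset J.
have inJ i x : i \in s -> x \in B i -> (x \in J) = P i.
  move=> is_ xi; have := hn i is_; rewrite negb_and !negbK -/(P i) => /orP[/eqP E|pi].
    have nx : x \notin J by apply/negP => xJ; have := in_set0 x; rewrite -E inE xi xJ.
    by rewrite (negbTE nx); apply/esym/negP => /subsetP/(_ x xi); apply/negP.
  by rewrite pi (subsetP pi).
have JE : J = bunion [seq i <- s | P i].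
  apply/setP => x; apply/idP/bunionP => [xJ|[i]].
    have /bunionP[i is_ xi] := subsetP Js x xJ; exists i => //.
    by rewrite mem_filter is_ -(inJ i x) ?xJ.
  by rewrite mem_filter => /andP[Pi is_] xi; rewrite (inJ i).
have DE : bunion s :\: J = bunion [seq i <- s | ~~ P i].
  apply/setP => x; rewrite in_setD; apply/andP/bunionP => [[nJ /bunionP[i is_ xi]]|[i]].
    by exists i; rewrite // mem_filter is_ -(inJ i x) // nJ.
  rewrite mem_filter => /andP[Pi is_] xi; rewrite (inJ i) // Pi; split=> //.
  by apply/bunionP; exists i.
have k1 : {in [seq i <- s | P i], forall j, j < k}.
  by move=> j; rewrite mem_filter => /andP[_ /sk].
have k2 : {in [seq i <- s | ~~ P i], forall j, j < k}.
  by move=> j; rewrite mem_filter => /andP[_ /sk].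
rewrite DE {1}JE adj_bunion //; last first.
  by apply/hasPn => i; rewrite mem_filter => /andP[Pi _]; rewrite /= mem_filter Pi.
have := allP hs _ (splits_filter P s); case/or3P => //=.
  by move=> /nilP E; move: J0; rewrite JE E bunion_eq0 ?eqxx.
move=> /nilP E; case/eqP: Jn; apply/eqP; rewrite eqEsubset Js /= -setD_eq0 DE E.
by rewrite bunion_eq0.
Qed.

(** Disjointness, inclusion, union, difference and connectedness all commute with [bunion], so
    coloring [s] by [col (bunion s)] satisfies both hypotheses of the search. *)
Lemma uncolorable_minor col : coloring e col -> ~ uncolorable k h.
Proof.
case=> cpair ctriple; apply: (@uncolorableP k h (fun s => col (bunion s))).
  move=> s t ms mt cs ct nst E; have sk := canon_lt ms; have tk := canon_lt mt.
  have mu : canon k (hunion k s t).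
    by apply/eqP; apply: eq_in_filter => i ik; rewrite mem_filter ik andbT.
  have md s' t' : canon k s' -> canon k (hdiff s' t').
    move=> ms'; apply/eqP; rewrite /hdiff {1}(eqP ms') -filter_predI.
    apply: eq_in_filter => i ik; rewrite mem_filter /= andbC.
    by rewrite andbC.
  have m1 := md s t ms; have m2 := md t s mt.
  have := cpair (bunion s) (bunion t); rewrite /joinable !conn_bunion // => /(_ cs ct _ E).
  rewrite !bunion_disj // !bunion_sub // -bunion_union // -!bunion_diff // !conn_bunion //.
  apply; by apply: contra nst => /eqP/bunion_inj ->.
move=> s t ms mt cs ct d cu; have sk := canon_lt ms; have tk := canon_lt mt.
have mu : canon k (hunion k s t).
  by apply/eqP; apply: eq_in_filter => i ik; rewrite mem_filter ik andbT.
have := ctriple (bunion s) (bunion t); rewrite -bunion_union // !conn_bunion // => /(_ cs ct).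
by rewrite bunion_disj // => /(_ d cu).
Qed.

End Minor.

(** * Paths and tailed triangles *)

Section Shape.
Variables (n : nat) (e : rel 'I_n).
Hypotheses (e_sym : symmetric e) (e_irr : irreflexive e).
Implicit Types (I J K D : {set 'I_n}) (x y v q : 'I_n) (p l m r s t : seq 'I_n).
Local Notation conn := (conn e).
Local Notation adj := (adj e).

(** A cut either splits [I] or [J], or contains one and misses the other; in the latter case the
    edge between [I] and [J] crosses it. *)
Lemma connU I J : conn I -> conn J -> adj I J -> conn (I :|: J).
Proof.
move=> cI cJ aIJ; apply/(connP e_sym); split.
  by have /set0Pn[x xI] := conn_neq0 cI; apply/set0Pn; exists x; rewrite inE xI.
move=> K KIJ /set0Pn[z zK] nK.
have cutting M : conn M -> M \subset I :|: J -> K :&: M != set0 -> ~~ (M \subset K) ->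
    adj K ((I :|: J) :\: K).
  move=> cM MIJ KM MK; have /adjP[x [y [xK yM exy]]] : adj (M :&: K) (M :\: (M :&: K)).
    apply: (conn_cut e_sym cM); first exact: subsetIl.
      by rewrite setIC.
    by rewrite setDIr setDv set0U setD_eq0.
  apply/adjP; exists x, y; move: xK yM; rewrite !inE => /andP[_ ->] /andP[nyK yM].
  split=> //; have := subsetP MIJ y yM; rewrite inE => ->.
  by rewrite andbT; apply: contra nyK => ->; rewrite yM.
have [KI|KI] := boolP (K :&: I == set0); last first.
  have [IK|IK] := boolP (I \subset K); last by apply: (cutting I); rewrite ?subsetUl.
  have [KJ|KJ] := boolP (K :&: J == set0); last first.
    have [JK|JK] := boolP (J \subset K); last by apply: (cutting J); rewrite ?subsetUr.
    by case/eqP: nK; apply/eqP; rewrite eqEsubset KIJ subUset IK JK.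
  have /adjP[x [y [xI yJ exy]]] := aIJ; apply/adjP; exists x, y.
  rewrite (subsetP IK) // !inE yJ orbT andbT; split=> //.
  by apply/negP => yK; have := in_set0 y; rewrite -(eqP KJ) inE yK yJ.
have [KJ|KJ] := boolP (K :&: J == set0).
  have := subsetP KIJ z zK; rewrite inE => /orP[] zz.
    by have := in_set0 z; rewrite -(eqP KI) inE zK zz.
  by have := in_set0 z; rewrite -(eqP KJ) inE zK zz.
have [JK|JK] := boolP (J \subset K); last by apply: (cutting J); rewrite ?subsetUr.
have /adjP[x [y [xI yJ exy]]] := aIJ; apply/adjP; exists y, x.
rewrite (subsetP JK) // !inE xI andbT e_sym; split=> //.
by apply/negP => xK; have := in_set0 x; rewrite -(eqP KI) inE xK xI.
Qed.

Definition vset s : {set 'I_n} := [set x in s].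
Definition ladj s t := has (fun x => has (e x) t) s.

Lemma adj_vset s t : adj (vset s) (vset t) = ladj s t.
Proof.
apply/adjP/hasP => [[x [y []]]|[x xs /hasP[y yt exy]]].
  by rewrite !inE => xs yt exy; exists x => //; apply/hasP; exists y.
by exists x, y; rewrite !inE.
Qed.

(** An induced path: vertices are adjacent exactly when consecutive, so chords are excluded as
    well. *)
Definition ispath p := uniq p /\
  {in p &, forall x y, e x y = ((index x p).+1 == index y p) || ((index y p).+1 == index x p)}.

Lemma ispath1 x : ispath [:: x].
Proof. by split=> // y z; rewrite !inE => /eqP-> /eqP->; rewrite e_irr /= eqxx. Qed.

Lemma ispath_sub l m r : ispath (l ++ m ++ r) -> ispath m.
Proof.
case=> u h; move: (u); rewrite !cat_uniq => /and3P[_ d /and3P[um _ _]]; split=> //.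
have ix x : x \in m -> index x (l ++ m ++ r) = size l + index x m.
  move=> xm; rewrite !index_cat xm ifF //; apply/negP => xl.
  by move/hasPn: d => /(_ x); rewrite mem_cat xm /= => /(_ isT); rewrite xl.
by move=> x y xm ym; rewrite h ?mem_cat ?xm ?ym ?orbT // !ix // -!addnS !eqn_add2l.
Qed.

Lemma ispath_rev p : ispath p -> ispath (rev p).
Proof.
case=> u h; split; first by rewrite rev_uniq.
have ix x : x \in p -> (index x (rev p) + (index x p).+1 = size p)%N.
  move=> xp; have lt : index x p < size p by rewrite index_mem.
  have lt' : size p - (index x p).+1 < size p by lia.
  have {1}<- : nth x (rev p) (size p - (index x p).+1) = x.
    by rewrite nth_rev // (_ : size p - _ = index x p) ?nth_index //; lia.
  rewrite index_uniq ?rev_uniq ?size_rev //; lia.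
move=> x y; rewrite !mem_rev => xp yp; rewrite h //; have := ix x xp; have := ix y yp.
lia.
Qed.

Lemma ispath_rcons l x v : ispath (rcons l x) -> v \notin rcons l x -> e x v ->
  ~~ has (e v) l -> ispath (rcons (rcons l x) v).
Proof.
case=> u h vn exv nv; split; first by rewrite rcons_uniq vn.
have ix y : y \in rcons l x -> index y (rcons (rcons l x) v) = index y (rcons l x).
  by move=> yl; rewrite -[rcons (rcons _ _) _]cats1 index_cat yl.
have iv : index v (rcons (rcons l x) v) = (size l).+1.
  by rewrite -[rcons (rcons _ _) _]cats1 index_cat (negbTE vn) /= eqxx size_rcons addn0.
have key y : y \in rcons l x -> e y v = ((index y (rcons l x)).+1 == (size l).+1).
  rewrite eqSS; move: u; rewrite rcons_uniq => /andP[xl ul].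
  rewrite mem_rcons inE -cats1 index_cat => /orP[/eqP ->|yl].
    by rewrite exv (negbTE xl) /= eqxx addn0 eqxx.
  rewrite yl e_sym (negbTE (hasPn nv y yl)); apply/esym/negbTE.
  by rewrite neq_ltn index_mem yl.
have lt y : y \in rcons l x -> index y (rcons l x) < (size l).+1.
  by rewrite -(size_rcons l x) index_mem.
move=> y z; rewrite mem_rcons [_ \in rcons _ v]mem_rcons !inE.
case/orP=> [/eqP->|yl] /orP[/eqP->|zl].
- by rewrite e_irr iv; lia.
- rewrite e_sym key // iv ix //; have := lt z zl; lia.
- rewrite key // iv ix //; have := lt y yl; lia.
- by rewrite h // !ix.
Qed.

Lemma ispath_edge l x y r : ispath (l ++ x :: y :: r) -> e x y.
Proof.
move=> /(@ispath_sub l [:: x; y] r)[u ->]; rewrite ?inE ?eqxx ?orbT //=.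
by move: u; rewrite /= inE andbT !eqxx => /negbTE ->.
Qed.

Lemma ispath_adj a b : ispath (a ++ b) -> a != [::] -> b != [::] -> ladj a b.
Proof.
case/lastP: a => // a x; case: b => // y b; rewrite cat_rcons => /ispath_edge exy _ _.
by apply/hasP; exists x; rewrite ?mem_rcons ?mem_head //= exy.
Qed.

Lemma ispath_nadj a b c : ispath (a ++ b ++ c) -> b != [::] -> ~~ ladj a c.
Proof.
case=> u h b0; have {}b0 : 0 < size b by case: b b0 {u h}.
apply/hasPn => x xa; apply/hasPn => y yc.
move: (u); rewrite catA cat_uniq => /and3P[_ d _].
have yab : y \notin a ++ b by move/hasPn: d => /(_ y yc).
rewrite h; rewrite ?mem_cat ?xa ?yc ?orbT //.
have -> : index y (a ++ b ++ c) = size a + size b + index y c.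
  by rewrite catA index_cat (negbTE yab) size_cat.
have -> : index x (a ++ b ++ c) = index x a by rewrite index_cat xa.
have := xa; rewrite -index_mem; move: (index x a) (index y c) => i j.
move: (size a) (size b) b0 => sa sb b0 ia; rewrite negb_or; apply/andP; split; apply/eqP; lia.
Qed.

Lemma path_conn p : ispath p -> p != [::] -> conn (vset p).
Proof.
elim: p => // x [|y p] IH pp _.
  rewrite (_ : vset [:: x] = [set x]); first exact: conn1.
  by apply/setP => z; rewrite !inE.
have pq : ispath (y :: p).
  by apply: (@ispath_sub [:: x] _ [::]); rewrite cats0.
rewrite (_ : vset [:: x, y & p] = vset [:: x] :|: vset (y :: p)); last first.
  by apply/setP => z; rewrite !inE.
apply: connU; last 1 first.
- by rewrite adj_vset; apply: (@ispath_adj [:: x]).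
- rewrite (_ : vset [:: x] = [set x]); first exact: conn1.
  by apply/setP => z; rewrite !inE.
- exact: IH.
Qed.

(** The flag may be an undetermined Boolean, so that one pattern covers several candidate minors,
    separated by cases before computing. *)
Definition edges (L : seq (nat * nat * bool)) : rel nat := fun i j =>
  has (fun w => ((w.1 == (i, j)) || (w.1 == (j, i))) && w.2) L.

Lemma edges_sym L : symmetric (edges L).
Proof. by move=> i j; apply: eq_has => w; rewrite orbC. Qed.

Lemma no_minor col (ss : seq (seq 'I_n)) L : coloring e col ->
  all (fun s => conn (vset s)) ss ->
  pairwise (fun s t => ~~ has (mem s) t) ss ->
  (forall i j, i < j -> j < size ss ->
     ladj (nth [::] ss i) (nth [::] ss j) = edges L i j) ->
  ~ uncolorable (size ss) (edges L).
Proof.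
move=> cc /(all_nthP [::]) cs /(pairwiseP [::]) ds h.
have dd i j : i < size ss -> j < size ss -> i < j ->
    [disjoint vset (nth [::] ss i) & vset (nth [::] ss j)].
  move=> ik jk ij; have := ds i j ik jk ij => /hasPn d.
  rewrite disjoint_sym disjoints_subset; apply/subsetP => x; rewrite !inE.
  by move/d.
apply: (uncolorable_minor e_sym (B := fun i => vset (nth [::] ss i))) cc => //.
  move=> i j ik jk; case: ltngtP => // ij _; first exact: dd.
  by rewrite disjoint_sym; apply: dd.
move=> i j ik jk; case: ltngtP => // ij _; first by rewrite adj_vset h.
by rewrite adjC // adj_vset h // edges_sym.
Qed.

(** Searching from the left gives the first hit; searching the reversed remainder gives the last,
    possibly the same one, in which case [m] is empty. *)
Lemma split_has (a : pred 'I_n) p : has a p -> exists l x m r,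
  [/\ p = l ++ (x :: m) ++ r, ~~ has a l, ~~ has a r, a x & a (last x m)].
Proof.
move=> hp; have [x l q ax nl] := split_find hp.
have hr : has a (rev (x :: q)) by rewrite has_rev /= ax.
move Ew: (rev (x :: q)) hr => w hr; case: (split_find hr) Ew => y s t ay ns Ew.
have {Ew} E : x :: q = rcons (rev t) y ++ rev s.
  by rewrite -[LHS]revK Ew rev_cat rev_rcons -cat_rcons.
case: (rev t) E => [|z m] /= [_ qE].
  by exists l, x, [::], (rev s); rewrite cat_rcons /= qE has_rev; split.
exists l, x, (rcons m y), (rev s); rewrite cat_rcons /= qE has_rev last_rcons.
by split.
Qed.

End Shape.

#[local] Arguments ladj : simpl never.

Ltac perm_count := apply/permP => ?; rewrite /= ?count_cat /= ?count_cat /=; clear; lia.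

(** * Growing a path or a tailed triangle by one vertex *)

Section Extend.
Variables (n : nat) (e : rel 'I_n).
Hypotheses (e_sym : symmetric e) (e_irr : irreflexive e).
Variable col : {set 'I_n} -> nat.
Hypothesis cc : coloring e col.
Implicit Types (I J K D : {set 'I_n}) (x y v q : 'I_n) (p l m r s t : seq 'I_n).
Local Notation conn := (conn e).
Local Notation ispath := (ispath e).
Local Notation ladj := (ladj e).

Lemma uniq_flatten_disjoint (ss : seq (seq 'I_n)) : uniq (flatten ss) ->
  pairwise (fun s t => ~~ has (mem s) t) ss.
Proof.
elim: ss => [|s ss IH] //=; rewrite cat_uniq => /and3P[_ d /IH ->]; rewrite andbT.
apply/allP => t ts; apply/hasPn => x xt; move/hasPn: d; apply.
by apply/flattenP; exists t.
Qed.

Lemma ladj1 s v : ladj s [:: v] = has (e v) s.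
Proof. by apply: eq_has => x; rewrite /= orbF e_sym. Qed.

Lemma conn_vset1 x : conn (vset [:: x]).
Proof. exact: (path_conn e_sym (ispath1 e_irr x)). Qed.

Lemma no_minor_uniq (ss : seq (seq 'I_n)) L : all (fun s => conn (vset s)) ss ->
  uniq (flatten ss) ->
  (forall i j, i < j -> j < size ss ->
     ladj (nth [::] ss i) (nth [::] ss j) = edges L i j) ->
  uncolorable (size ss) (edges L) -> False.
Proof. by move=> h1 /uniq_flatten_disjoint h2 h3 h4; apply: (no_minor e_sym cc h1 h2 h3 h4). Qed.

(* Merging the vertices between the first and the last neighbor of [v] on [p], as
   well as the two remaining ends of [p], yields a 4-cycle, a diamond or a claw in
   all other cases. *)
Lemma path_extend p v : ispath p -> v \notin p -> has (e v) p ->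
  exists l m, [/\ l ++ m = p \/ l ++ m = rev p, ~~ has (e v) l &
    (exists2 x, m = [:: x] & e v x) \/
    (exists x y, [/\ m = [:: x; y], e v x & e v y])].
Proof.
move=> pp vp hp; have [l [x [m [r [pE nl nr vx vy]]]]] := split_has hp.
have M2 : m = [::] \/ exists y, m = [:: y].
  case: (lastP m) pE vy => [|mid y] pE vy; first by left.
  right; rewrite last_rcons in vy; case: (eqVneq mid [::]) => [->|mid0]; first by exists y.
  exfalso; rewrite -cats1 -cat1s in pE; have pm : ispath ([:: x] ++ mid ++ [:: y]).
    by apply: (@ispath_sub _ _ l _ r); rewrite -pE.
  have pmid : ispath mid by apply: ispath_sub pm.
  (* The cycle [x], [mid], [y], [v] is a 4-cycle, or a diamond if [v] also has a neighbor in [mid];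
     the last flag covers both. *)
  apply: (@no_minor_uniq [:: [:: x]; mid; [:: y]; [:: v]]
    [:: (0, 1, true); (1, 2, true); (2, 3, true); (0, 3, true); (1, 3, has (e v) mid)]).
  - by rewrite /= !conn_vset1 (path_conn e_sym pmid).
  - have vm : v \notin [:: x] ++ mid ++ [:: y].
      by apply: contra vp => h; rewrite pE mem_cat mem_cat h orbT.
    rewrite (@perm_uniq _ _ (v :: [:: x] ++ mid ++ [:: y])); last by perm_count.
    by rewrite cons_uniq vm; case: pm.
  - have a1 : ladj [:: x] mid by apply: (@ispath_adj _ _ [:: x]) => //;
      apply: (@ispath_sub _ _ [::] _ [:: y]).
    have a2 : ladj mid [:: y] by apply: ispath_adj => //;
      apply: (@ispath_sub _ _ [:: x] _ [::]); rewrite cats0.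
    have a3 := ispath_nadj pm mid0.
    move=> [|[|[|i]]] [|[|[|[|j]]]] //= _ _.
    + by rewrite (negbTE a3).
    + by rewrite ladj1 /= vx.
    + by rewrite ladj1 /edges /= ?orbF ?andbT.
    + by rewrite ladj1 /= vy.
  - by case: (has (e v) mid); vm_compute.
have pM : ispath (x :: m) by apply: (@ispath_sub _ _ l _ r); rewrite -pE.
have lr : l = [::] \/ r = [::].
  have [->|l0] := eqVneq l [::]; first by left.
  have [->|r0] := eqVneq r [::]; first by right.
  exfalso; rewrite pE in pp.
  have p1 : ispath (l ++ (x :: m)).
    by apply: (@ispath_sub _ _ [::] _ r); rewrite cat0s -catA.
  have p2 : ispath ((x :: m) ++ r).
    by apply: (@ispath_sub _ _ l _ [::]); rewrite cats0.
  have pl : ispath l by apply: (@ispath_sub _ _ [::] _ (x :: m)).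
  have pr : ispath r by apply: (@ispath_sub _ _ (x :: m) _ [::]); rewrite cats0.
  (* A claw with center [x :: m]: both ends of the path are nonempty and contain no neighbor of
     [v]. *)
  apply: (@no_minor_uniq [:: l; x :: m; r; [:: v]]
    [:: (0, 1, true); (1, 2, true); (1, 3, true)]).
  - by rewrite /= conn_vset1 !(path_conn e_sym).
  - rewrite (@perm_uniq _ _ (v :: p)); last by rewrite pE; perm_count.
    by rewrite cons_uniq vp pE; case: pp.
  - have a1 : ladj l (x :: m) by apply: ispath_adj p1 _ _.
    have a2 : ladj (x :: m) r by apply: ispath_adj p2 _ _.
    have a3 : ~~ ladj l r by apply: ispath_nadj pp _.
    move=> [|[|[|i]]] [|[|[|[|j]]]] //= _ _.
    + by rewrite (negbTE a3).
    + by rewrite ladj1 (negbTE nl).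
    + by rewrite ladj1 /= vx.
    + by rewrite ladj1 (negbTE nr).
  - by vm_compute.
have tailP s : s = [:: x] \/ (exists y, s = [:: x; y] /\ e v y) \/
    (exists y, s = [:: y; x] /\ e v y) ->
    (exists2 x, s = [:: x] & e v x) \/ (exists x y, [/\ s = [:: x; y], e v x & e v y]).
  case=> [->|[[y [-> ey]]|[y [-> ey]]]]; first by left; exists x.
    by right; exists x, y.
  by right; exists y, x.
case: lr => E.
  exists (rev r), (rev (x :: m)); split; first by right; rewrite -rev_cat pE E.
    by rewrite has_rev.
  apply: tailP; case: M2 vy => [->|[y ->]] vy; first by left.
  by right; right; exists y.
exists l, (x :: m); split=> //; first by left; rewrite pE E cats0.
apply: tailP; case: M2 vy => [->|[y ->]] vy; first by left.
by right; left; exists y.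
Qed.

(** The triangle [q], [x0], [x1] with tail [t] at [x1], seen as an induced path plus one vertex
    joined exactly to its first two vertices. *)
Definition tailed_triangle q x0 x1 t :=
  [/\ ispath [:: x0, x1 & t], q \notin [:: x0, x1 & t], e q x0, e q x1 & ~~ has (e q) t].

Definition admissible D := (exists p, [/\ ispath p, p != [::] & D = vset p]) \/
  (exists q x0 x1 t, tailed_triangle q x0 x1 t /\ D = vset [:: q, x0, x1 & t]).

Lemma ispath2 x y : x != y -> e x y -> ispath [:: x; y].
Proof.
move=> ne exy; apply: (@ispath_rcons _ _ e_sym e_irr [::] x y) => //.
  exact: ispath1.
by rewrite inE eq_sym.
Qed.

Lemma ispath3 x y z : uniq [:: x; y; z] -> e x y -> e y z -> ~~ e z x ->
  ispath [:: x; y; z].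
Proof.
rewrite /= !inE negb_or andbT => /andP[/andP[xy xz] yz] exy eyz nzx.
apply: (@ispath_rcons _ _ e_sym e_irr [:: x] y z) => //.
- exact: ispath2.
- by rewrite !inE negb_or [z == x]eq_sym [z == y]eq_sym xz.
- by rewrite /= orbF.
Qed.

Lemma admissible_extend_path p v : ispath p -> v \notin p -> has (e v) p ->
  admissible (v |: vset p).
Proof.
move=> pp vp hp; have [l [m [plm nl h]]] := path_extend pp vp hp.
have pm : l ++ m =i p by case: plm => -> // x; rewrite mem_rev.
have pl : ispath (l ++ m) by case: plm => -> //; apply: ispath_rev.
have vlm : v \notin l ++ m by rewrite pm.
case: h => [[x mE vx]|[x [y [mE vx vy]]]]; rewrite {}mE in pl vlm pm.
  left; exists (rcons (l ++ [:: x]) v); split.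
  - by rewrite cats1 in pl vlm *; apply: ispath_rcons => //; rewrite e_sym.
  - by rewrite -size_eq0 size_rcons.
  - by apply/setP => z; rewrite !inE mem_rcons inE pm.
(* The two neighbors end the path, so [v] becomes the apex over the first two vertices of the
   reversed path. *)
right; exists v, y, x, (rev l); split.
  have E : [:: y, x & rev l] = rev (l ++ [:: x; y]) by rewrite rev_cat.
  split=> //; last by rewrite has_rev.
    by rewrite E; apply: ispath_rev.
  by rewrite E mem_rev.
apply/setP => z; rewrite !inE -pm mem_cat mem_rev !inE.
by case: (z == v); case: (z == x); case: (z == y); rewrite ?orbT ?orbF.
Qed.

(** Two neighbors in the triangle would give a diamond, three a K4. *)
Lemma triangle_two v q x0 x1 : uniq [:: q; x0; x1; v] ->
  e q x0 -> e q x1 -> e x0 x1 ->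
  (e v q + e v x0 + e v x1 <= 1)%N.
Proof.
move=> u e1 e2 e3; rewrite leqNgt; apply/negP => two.
apply: (@no_minor_uniq [:: [:: q]; [:: x0]; [:: x1]; [:: v]]
  [:: (0, 1, true); (0, 2, true); (1, 2, true); (0, 3, e v q); (1, 3, e v x0);
      (2, 3, e v x1)]).
- by rewrite /= !conn_vset1.
- by [].
- move=> [|[|[|i]]] [|[|[|[|j]]]] //= _ _; rewrite ladj1 /edges /= ?orbF ?andbT //.
  + by rewrite e_sym.
  + by rewrite e_sym.
  + by rewrite e_sym.
- by move: two; case: (e v q); case: (e v x0); case: (e v x1) => // _; vm_compute.
Qed.

(** Merging the tail into one vertex leaves a five-vertex graph. The search rules out every nonempty
    set of neighbors of [v] in the triangle, whether or not [v] is also adjacent to the tail. *)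
Lemma tailed_triangle_nbr v q x0 x1 t : tailed_triangle q x0 x1 t -> t != [::] ->
  v \notin [:: q, x0, x1 & t] -> [|| e v q, e v x0 | e v x1] = false.
Proof.
case=> pp qp e1 e2 nq t0 vn; apply/negP => one.
have pt : ispath t by apply: (@ispath_sub _ _ [:: x0; x1] _ [::]); rewrite cats0.
have p1t : ladj [:: x1] t.
  apply: (@ispath_adj _ _ [:: x1] t) => //.
  by apply: (@ispath_sub _ _ [:: x0] _ [::]); rewrite cats0.
have p0t : ~~ ladj [:: x0] t by apply: (@ispath_nadj _ _ [:: x0] [:: x1] t).
have e01 : e x0 x1 by apply: (@ispath_edge _ _ [::] x0 x1 t).
apply: (@no_minor_uniq [:: [:: q]; [:: x0]; [:: x1]; t; [:: v]]
  [:: (0, 1, true); (0, 2, true); (1, 2, true); (2, 3, true);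
      (0, 4, e v q); (1, 4, e v x0); (2, 4, e v x1); (3, 4, has (e v) t)]).
- by rewrite /= !conn_vset1 (path_conn e_sym pt).
- rewrite (@perm_uniq _ _ (v :: q :: [:: x0, x1 & t])); last by perm_count.
  by rewrite cons_uniq vn cons_uniq qp; case: pp.
- move=> [|[|[|[|i]]]] [|[|[|[|[|j]]]]] //= _ _.
  + by rewrite ladj1 /= e_sym e1.
  + by rewrite ladj1 /= e_sym e2.
  + by rewrite /ladj /= orbF (negbTE nq).
  + by rewrite ladj1 /edges /= ?orbF ?andbT.
  + by rewrite ladj1 /= e_sym e01.
  + by rewrite (negbTE p0t).
  + by rewrite ladj1 /edges /= ?orbF ?andbT.
  + by rewrite ladj1 /edges /= ?orbF ?andbT.
  + by rewrite ladj1 /edges /= ?orbF ?andbT.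
- by move: one; case: (e v q); case: (e v x0); case: (e v x1); case: (has (e v) t) => // _;
    vm_compute.
Qed.

(** Contracting the stretch from [x1] to [x] makes it the common vertex of two triangles, completed
    by [q], [x0] and by [v], [y]. *)
Lemma no_butterfly v q x0 x1 l x y : tailed_triangle q x0 x1 (l ++ [:: x; y]) ->
  v \notin [:: q, x0, x1 & l ++ [:: x; y]] -> ~~ e v q -> ~~ e v x0 ->
  e v x -> e v y -> False.
Proof.
move=> [pp qp e1 e2 nq] vn nvq nvp0 vx vy.
have pp' : ispath ([:: x0] ++ (x1 :: l ++ [:: x]) ++ [:: y]) by rewrite /= -catA.
have pm : ispath (x1 :: l ++ [:: x]) by apply: ispath_sub pp'.
have a1 : ladj [:: x0] (x1 :: l ++ [:: x]).
  by apply: (@ispath_adj _ _ [:: x0]) => //; apply: (@ispath_sub _ _ [::] _ [:: y]).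
have a2 : ladj (x1 :: l ++ [:: x]) [:: y].
  by apply: ispath_adj => //; apply: (@ispath_sub _ _ [:: x0] _ [::]); rewrite cats0.
have a3 := ispath_nadj pp' isT.
move: nq; rewrite has_cat /= !negb_or andbT => /and3P[nl nx ny].
apply: (@no_minor_uniq [:: [:: q]; [:: x0]; x1 :: l ++ [:: x]; [:: y]; [:: v]]
  [:: (0, 1, true); (0, 2, true); (1, 2, true); (2, 3, true); (2, 4, true); (3, 4, true)]).
- by rewrite /= !conn_vset1 (path_conn e_sym pm).
- rewrite (@perm_uniq _ _ (v :: q :: [:: x0, x1 & l ++ [:: x; y]])); last by perm_count.
  by rewrite cons_uniq vn cons_uniq qp; case: pp.
- move=> [|[|[|[|i]]]] [|[|[|[|[|j]]]]] //= _ _.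
  + by rewrite ladj1 /= e_sym e1.
  + by rewrite /ladj /= e2.
  + by rewrite ladj1 /= orbF e_sym (negbTE ny).
  + by rewrite ladj1 /= (negbTE nvq).
  + by rewrite (negbTE a3).
  + by rewrite ladj1 /= (negbTE nvp0).
  + by rewrite ladj1 /= has_cat /= vx !orbT.
  + by rewrite ladj1 /= vy.
- by vm_compute.
Qed.

Lemma admissible_extend_triangle v q x0 x1 t : tailed_triangle q x0 x1 t ->
  v \notin [:: q, x0, x1 & t] -> has (e v) [:: q, x0, x1 & t] ->
  admissible (v |: vset [:: q, x0, x1 & t]).
Proof.
move=> tt vn hv; case: (tt) => pp qp e1 e2 nq.
have e01 : e x0 x1 by apply: (@ispath_edge _ _ [::] x0 x1 t).
have [t0|t0] := eqVneq t [::].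
  move: vn hv pp qp; rewrite {}t0 => {tt nq t} vn hv pp qp.
  have u : uniq [:: q; x0; x1; v].
    rewrite (@perm_uniq _ _ (v :: q :: [:: x0; x1])); last by perm_count.
    by rewrite cons_uniq vn cons_uniq qp; case: pp.
  have two := triangle_two u e1 e2 e01.
  have nn x y : x != y -> y != x by rewrite eq_sym.
  have ss x y : e x y -> e y x by rewrite e_sym.
  move: (u); rewrite /= !inE !negb_or !andbT => /and3P[/and3P[d1 d2 d3] /andP[d4 d5] d6].
  (* The new vertex has exactly one neighbor in the bare triangle, which is relabeled so that this
     neighbor carries the tail. *)
  right; case: (boolP (e v q)) (two) (hv) => vq.
    case: (boolP (e v x0)) => //= vp0; case: (boolP (e v x1)) => //= vp1 _ _.
    exists x0, x1, q, [:: v]; split; last first.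
      by apply/setP => z; rewrite !inE; case: (z == v); case: (z == q); case: (z == x0);
        case: (z == x1).
    split; rewrite /= ?orbF //.
    - apply: ispath3 => //; try exact: ss.
      by rewrite /= !inE !negb_or !andbT (nn _ _ d2) d6 d3.
    - by rewrite !inE !negb_or d4 (nn _ _ d1) d5.
    - by rewrite e_sym.
    - by rewrite e_sym.
  case: (boolP (e v x0)) => vp0.
    case: (boolP (e v x1)) => //= vp1 _ _.
    exists q, x1, x0, [:: v]; split; last first.
      by apply/setP => z; rewrite !inE; case: (z == v); case: (z == q); case: (z == x0);
        case: (z == x1).
    split; rewrite /= ?orbF //.
    - apply: ispath3 => //; try exact: ss.
      by rewrite /= !inE !negb_or !andbT (nn _ _ d4) d6 d5.
    - by rewrite !inE !negb_or d2 d1 d3.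
    - by rewrite e_sym.
  case: (boolP (e v x1)) => //= vp1; last by rewrite (negbTE vq) (negbTE vp0) (negbTE vp1).
  move=> _ _; exists q, x0, x1, [:: v]; split; last first.
    by apply/setP => z; rewrite !inE; case: (z == v); case: (z == q); case: (z == x0);
      case: (z == x1).
  split; rewrite /= ?orbF //.
  - apply: ispath3 => //; try exact: ss.
    by rewrite /= !inE !negb_or !andbT d4 d5 d6.
  - by rewrite !inE !negb_or d1 d2 d3.
  - by rewrite e_sym.
have := tailed_triangle_nbr tt t0 vn => /negbT; rewrite !negb_or => /and3P[nvq nvp0 nvp1].
have vp : v \notin [:: x0, x1 & t] by move: vn; rewrite inE negb_or => /andP[].
have hp : has (e v) [:: x0, x1 & t] by move: hv; rewrite /= (negbTE nvq).
have [l [m [plm nl h]]] := path_extend pp vp hp.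
(* On the reversed path the neighbors of [v] would include [x0], already excluded; only the free end
   of the tail remains. *)
case: plm => E; last first.
  exfalso; case: h => [[x mE vx]|[x [y [mE vx vy]]]].
    have := congr1 rev E; rewrite revK mE rev_cat /= => -[xp _].
    by move: nvp0; rewrite -xp vx.
  have := congr1 rev E; rewrite revK mE rev_cat /= => -[yp _].
  by move: nvp0; rewrite -yp vy.
case: h => [[x mE vx]|[x [y [mE vx vy]]]]; rewrite {}mE in E.
  right; exists q, x0, x1, (rcons t v); split; last first.
    by apply/setP => z; rewrite !inE mem_rcons inE; case: (z == v); rewrite ?orbT.
  split=> //.
  - rewrite -!rcons_cons -E cats1 in pp vp *.
    by apply: ispath_rcons => //; rewrite e_sym.
  - rewrite -!rcons_cons mem_rcons inE negb_or qp andbT.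
    by move: vn; rewrite inE negb_or eq_sym => /andP[].
  - by rewrite has_rcons negb_or nq andbT e_sym.
(* Two neighbors at the end of the path: a short [l] makes [x0] or [x1] one of them, a longer one
   produces the butterfly. *)
exfalso; case: l E nl => [|a [|b l]] /= E nl.
- by case: E => xp _ _; move: nvp0; rewrite -xp vx.
- by case: E => _ xp _; move: nvp1; rewrite -xp vx.
case: E => ap bp tE; rewrite -tE in tt vn.
exact: (no_butterfly tt vn nvq nvp0 vx vy).
Qed.

Lemma admissible_extend D v : admissible D -> v \notin D -> (exists2 x, x \in D & e v x) ->
  admissible (v |: D).
Proof.
case=> [[p [pp _ ->]]|[q [x0 [x1 [t [tt ->]]]]]]; rewrite inE => vn [x]; rewrite inE => xp vx.
  by apply: admissible_extend_path => //; apply/hasP; exists x.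
by apply: admissible_extend_triangle => //; apply/hasP; exists x.
Qed.

(* A maximal admissible subset of [D] has no neighbor in [D], hence is [D]. *)
Lemma conn_admissible D : conn D -> admissible D.
Proof.
move=> cD; suff grow (m : nat) J : (#|D :\: J| <= m)%N -> J \subset D -> admissible J -> admissible D.
  have /set0Pn[x xD] := conn_neq0 cD.
  apply: (grow _ [set x] (leqnn _)); first by rewrite sub1set.
  left; exists [:: x]; split=> //; first exact: ispath1.
  by apply/setP => z; rewrite !inE.
elim: m J => [|m IH] J le JD gJ.
  suff -> : D = J by [].
  apply/eqP; rewrite eqEsubset JD andbT -setD_eq0 -cards_eq0.
  by rewrite -leqn0.
have J0 : J != set0.
  case: gJ => [[[|x p] [_ // _ ->]]|[q [x0 [x1 [t [_ ->]]]]]]; apply/set0Pn.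
    by exists x; rewrite inE mem_head.
  by exists q; rewrite inE mem_head.
have [E|DJ] := eqVneq (D :\: J) set0.
  by apply: (IH J) => //; rewrite E cards0.
have /adjP[x [v [xJ]]] := conn_cut e_sym cD JD J0 DJ; rewrite inE => /andP[vJ vD] exv.
apply: (IH (v |: J)).
- rewrite -ltnS; apply: leq_trans le; apply: proper_card; apply/properP; split.
    by apply/subsetP => z; rewrite !inE negb_or => /andP[/andP[_ ->] ->].
  by exists v; rewrite !inE ?vJ ?vD // eqxx.
- by rewrite subUset sub1set vD.
- by apply: admissible_extend => //; exists x; rewrite // e_sym.
Qed.

End Extend.

(** * Connected subgraph arrangements of paths and tailed triangles *)

Section Assemble.
Local Open Scope ring_scope.
Variables (n : nat) (e : rel 'I_n).
Hypotheses (e_sym : symmetric e) (e_irr : irreflexive e).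
Local Notation V := 'rV[rat]_n.
Local Notation sp := {vspace V}.
Local Notation conn := (conn e).
Local Notation adj := (adj e).
Implicit Types (C D I J M : {set 'I_n}) (x v q u : 'I_n) (s : seq 'I_n).

Definition forms_in C := [seq cvec M | M <- enum {set 'I_n} & conn M && (M \subset C)].
(** The arrangement of the subgraph on [C], kept in the full space: the unit vectors outside [C] lie
    in its center and serve in the product and modular steps. *)
Definition AGin C := arr (fullv : sp) (forms_in C).

Lemma forms_inP C f : reflect (exists I, [/\ conn I, I \subset C & f = cvec I])
  (f \in forms_in C).
Proof.
apply: (iffP mapP) => [[I]|[I [cI IC ->]]].
  by rewrite mem_filter => /andP[/andP[cI IC] _] ->; exists I.
by exists I; rewrite // mem_filter cI IC mem_enum.
Qed.

Lemma AGinP C H : reflect (exists I, [/\ conn I, I \subset C & H = hyp fullv (cvec I)])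
  (H \in AGin C).
Proof.
apply: (iffP (arrP _ _ _)) => [[f /forms_inP[I [cI IC ->]] ->]|[I [cI IC ->]]].
  by exists I.
by exists (cvec I) => //; apply/forms_inP; exists I.
Qed.

Lemma AGin_setT : AGin setT = AG e.
Proof.
apply/fsetP => H; apply/AGinP/AGP => [[I [cI _ ->]]|[I cI ->]].
  by exists I; rewrite // /hyp capfv.
by exists I; rewrite subsetT /hyp capfv.
Qed.

Lemma AGin0 : AGin set0 = fset0.
Proof.
apply/fsetP => H; rewrite in_fset0; apply/negP => /AGinP[I [cI]].
by rewrite subset0 (negbTE (conn_neq0 cI)).
Qed.

Lemma hyp_delta I x : (delta_mx 0 x \in hyp fullv (cvec I)) = (x \notin I).
Proof. by rewrite mem_hyp memvf ev_cvec_delta; case: (x \in I). Qed.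

Definition coordspan D : sp := <<[seq (delta_mx 0%R i : V) | i <- enum D]>>%VS.

Lemma coordspan_le D I : [disjoint D & I] -> (coordspan D <= hyp fullv (cvec I))%VS.
Proof.
move=> d; apply/span_subvP => _ /mapP[i iD ->]; rewrite mem_enum in iD.
by rewrite hyp_delta (disjointFr d).
Qed.

Lemma coordspan_compl D : (coordspan (~: D) + coordspan D)%VS = fullv.
Proof.
apply/eqP; rewrite eqEsubv subvf /=; apply/subvP => w _.
rewrite [w]row_sum_delta; apply: memv_suml => i _; apply: rpredZ.
have [iD|iD] := boolP (i \in D).
  by apply: (subvP (addvSr _ _)); apply: memv_span; apply: map_f; rewrite mem_enum.
apply: (subvP (addvSl _ _)); apply: memv_span; apply: map_f.
by rewrite mem_enum in_setC.
Qed.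

(** [D] is a connected subset of [C] through [v] of maximal size. No edge joins it to the rest of
    [C], so a connected set inside [C] lies in [D] or misses it. *)
Lemma AGin_component C v : v \in C -> exists D,
  [/\ conn D, v \in D, D \subset C & AGin C = (AGin D `|` AGin (C :\: D))%fset].
Proof.
move=> vC; pose P D := conn D && (D \subset C) && (v \in D).
have P0 : P [set v] by rewrite /P conn1 // sub1set vC inE eqxx.
case: (arg_maxnP (fun D => #|D|) P0) => D /andP[/andP[cD DC] vD] maxD.
exists D; split=> //.
have nadj : ~~ adj D (C :\: D).
  apply/negP => /adjP[x [y [xD]]]; rewrite inE => /andP[yD yC] exy.
  have : P (D :|: [set y]).
    rewrite /P subUset DC sub1set yC inE vD !andbT; apply: connU => //.
      exact: conn1.
    by apply/adjP; exists x, y; rewrite inE eqxx.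
  by move=> /maxD; rewrite setUC cardsU1 yD; lia.
apply/fsetP => H; rewrite in_fsetU; apply/AGinP/orP => [[I [cI IC ->]]|].
  have [ID|ID] := boolP (I \subset D); first by left; apply/AGinP; exists I.
  right; apply/AGinP; exists I; split=> //; rewrite subsetD IC /=.
  apply: contraR nadj; rewrite -setI_eq0 => ID0.
  have /adjP[x [y [xI yI exy]]] : adj (I :&: D) (I :\: (I :&: D)).
    apply: (conn_cut e_sym cI) => //; first exact: subsetIl.
    by rewrite setDIr setDv set0U setD_eq0.
  move: xI yI; rewrite !inE => /andP[_ xD] /andP[ny yI].
  apply/adjP; exists x, y; rewrite inE (subsetP IC) // andbT; split=> //.
  by apply: contra ny => ->; rewrite yI.
case=> /AGinP[I [cI IC ->]]; exists I; split=> //.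
  exact: subset_trans IC DC.
exact: subset_trans IC (subsetDl _ _).
Qed.

Lemma IF_components C :
  (forall D, conn D -> exists P, IFpair fullv (AGin D) P) ->
  exists P, IFpair fullv (AGin C) P.
Proof.
move=> IFD; move: {2}#|C| (leqnn #|C|) => m; elim: m C => [|m IH] C.
  rewrite leqn0 cards_eq0 => /eqP ->; rewrite AGin0; exists [::]; exact: IF_empty.
have [->|/set0Pn[v vC]] := eqVneq C set0.
  by move=> _; rewrite AGin0; exists [::]; exact: IF_empty.
move=> leC; have [D [cD vD DC ->]] := AGin_component vC.
have [P1 IF1] := IFD D cD.
have [|P2 IF2] := IH (C :\: D).
  rewrite -ltnS; apply: leq_trans leC; apply: proper_card; apply/properP.
  by split; [exact: subsetDl | exists v; rewrite // inE vD].
(* Forms supported in [D] vanish on the unit vectors outside [D], and the others on those in [D];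
   the two coordinate subspaces span everything. *)
exists (P1 ++ P2); apply: (IF_product IF1 (coordspan_compl D) _ _ IF2).
  move=> H /AGinP[I [_ ID ->]]; apply: coordspan_le.
  by rewrite disjoint_sym disjoints_subset setCK.
move=> H /AGinP[I [_ ID ->]]; apply: coordspan_le.
by rewrite disjoint_sym; apply: disjointWl ID _; rewrite disjoint_sym -setI_eq0 setDE
  setIC -setIA [~: D :&: D]setIC setICr setI0.
Qed.

(** A leaf can be removed without disconnecting. A cut of the rest extends to a cut of [I] by
    placing [v] on the side of [u], and then no crossing edge uses [v]. *)
Lemma conn_pendant D v u I : v \notin D -> {in D, forall x, e v x -> x = u} ->
  conn I -> I \subset v |: D -> v \in I ->
  I = [set v] \/ exists J, [/\ conn J, J \subset D, u \in J & I = v |: J].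
Proof.
move=> vD nb cI ID vI; have [Iv|Iv] := eqVneq (I :\ v) set0.
  left; apply/eqP; rewrite eqEsubset sub1set vI andbT; apply/subsetP => x xI.
  by rewrite inE; apply: contraT => nx; have := in_set0 x; rewrite -Iv !inE nx xI.
right; exists (I :\ v); rewrite setD1K //.
have ID' x : x \in I -> x != v -> x \in D.
  by move=> xI nx; have := subsetP ID x xI; rewrite !inE (negbTE nx).
have uI : u \in I :\ v.
  have /adjP[x [y []]] : adj [set v] (I :\: [set v]).
    by apply: (conn_cut e_sym cI); rewrite ?sub1set //; apply/set0Pn; exists v; rewrite inE.
  rewrite !inE => /eqP -> /andP[ny yI] evy.
  have yD := ID' y yI ny; rewrite -(nb y yD evy) ny yI //.
split=> //; last by apply/subsetP => x; rewrite !inE => /andP[nx xI]; apply: ID'.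
apply/(connP e_sym); split=> // J JI J0 nJ.
have JI' : J \subset I by apply: subset_trans JI (subsetDl _ _).
have vJ : v \notin J by apply/negP => /(subsetP JI); rewrite !inE eqxx.
have [uJ|uJ] := boolP (u \in J).
  have /adjP[x [y [xJ yJ exy]]] : adj (v |: J) (I :\: (v |: J)).
    apply: (conn_cut e_sym cI).
    - by rewrite subUset sub1set vI.
    - by apply/set0Pn; exists v; rewrite !inE eqxx.
    - apply: contra nJ => /eqP E; rewrite eqEsubset JI /=.
      apply/subsetP => x; rewrite !inE => /andP[nx xI].
      by apply: contraT => xJ; have := in_set0 x; rewrite -E !inE negb_or nx xI xJ.
  move: xJ yJ; rewrite !inE negb_or => /orP[/eqP xv|xJ] /andP[/andP[nyv yJ] yI].
    by move: exy yJ; rewrite xv => /(nb y (ID' y yI nyv)) ->; rewrite uJ.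
  by apply/adjP; exists x, y; rewrite !inE yJ nyv yI.
have /adjP[x [y [xJ]]] : adj J (I :\: J).
  apply: (conn_cut e_sym cI) => //; apply/set0Pn; exists u.
  by move: uI; rewrite !inE uJ => /andP[_ ->].
rewrite inE => /andP[yJ yI] exy; apply/adjP; exists x, y; rewrite !inE yJ yI andbT.
split=> //; apply: contraNneq uJ => yv.
have xI := subsetP JI x xJ; move: xI; rewrite !inE => /andP[nx xI].
by rewrite -(nb x (ID' x xI nx)) // e_sym -yv.
Qed.

Lemma conn_add D v u J : v \notin D -> u \in D -> e v u -> conn J -> J \subset D ->
  u \in J -> conn (v |: J).
Proof.
move=> vD uD evu cJ JD uJ; apply: connU => //; first exact: conn1.
by apply/adjP; exists v, u; rewrite inE eqxx.
Qed.

Lemma path_head v s : ispath e (v :: s) -> v \notin s /\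
  {in s, forall x, e v x -> x = head v s}.
Proof.
case=> /= /andP[vs us] h; split=> // x xs; rewrite h ?inE ?eqxx ?xs ?orbT //=.
rewrite ?eqxx; case: (eqVneq v x) => [E|_]; first by move: vs; rewrite E xs.
rewrite !orbF eqSS; case: s xs {vs us h} => //= y s _.
by case: (eqVneq y x).
Qed.

Lemma path_head_vset v s : ispath e (v :: s) -> v \notin vset s /\
  {in vset s, forall x, e v x -> x = head v s}.
Proof. by case/path_head=> vs nb; split=> [|x]; rewrite inE //; apply: nb. Qed.

Lemma vset_cons v s : vset (v :: s) = v |: vset s.
Proof. by apply/setP => x; rewrite !inE. Qed.

Lemma AGin_add v C : AGin (v |: C) =
  (arr fullv [seq cvec M | M <- enum {set 'I_n} & [&& conn M, M \subset v |: C & v \in M]]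
   `|` AGin C)%fset.
Proof.
apply/fsetP => H; rewrite in_fsetU; apply/AGinP/orP => [[I [cI IC ->]]|].
  have [vI|vI] := boolP (v \in I).
    left; apply: mem_arr; apply: map_f; rewrite mem_filter cI IC vI mem_enum //.
  right; apply/AGinP; exists I; split=> //; apply/subsetP => x xI.
  by have := subsetP IC x xI; rewrite !inE => /orP[/eqP xv|//]; rewrite -xv xI in vI.
case=> [/arrP[_ /mapP[M + ->] ->]|].
  by rewrite mem_filter => /andP[/and3P[cM MC _] _]; exists M.
by case/AGinP=> I [cI IC ->]; exists I; split=> //; apply: subset_trans IC (subsetUr _ _).
Qed.

Lemma cvec_inj : injective (@cvec n).
Proof. by move=> I J E; apply: HI_inj; rewrite !HI_kerf E. Qed.

(** Connected sets through the end [v] are the initial segments of the path, and two of them differ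
    by a segment avoiding [v], up to sign. The recursion strips [v] from both until one is a single
    vertex. *)
Lemma path_diff v s I J : ispath e (v :: s) -> conn I -> conn J ->
  I \subset vset (v :: s) -> J \subset vset (v :: s) -> v \in I -> v \in J -> I != J ->
  exists M, [/\ conn M, M \subset vset s &
    cvec I - cvec J = cvec M \/ cvec I - cvec J = - cvec M].
Proof.
elim: s v I J => [|u s IH] v I J pp cI cJ Is Js vI vJ nIJ.
all: have [vD nb'] := path_head_vset pp; rewrite vset_cons in Is Js.
  have sub0 J' x : x \in J' -> J' \subset vset [::] -> False.
    by move=> xJ /subsetP/(_ x xJ); rewrite inE.
  case/eqP: nIJ; case: (conn_pendant vD nb' cI Is vI) => [->|[I' [_ h xI _]]];
    last by case: (sub0 _ _ xI h).
  by case: (conn_pendant vD nb' cJ Js vJ) => [->|[J' [_ h xJ _]]];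
    last by case: (sub0 _ _ xJ h).
have pu : ispath e (u :: s) by apply: (@ispath_sub _ _ [:: v] _ [::]); rewrite cats0.
have cvecv M : M \subset vset (u :: s) -> cvec (v |: M) = cvec [set v] + cvec M.
  move=> MS; apply: cvecU; rewrite disjoints_subset sub1set inE.
  by apply: contra vD; apply: (subsetP MS).
case: (conn_pendant vD nb' cI Is vI) => [IE|[I' [cI' I's uI IE]]];
  case: (conn_pendant vD nb' cJ Js vJ) => [JE|[J' [cJ' J's uJ JE]]].
- by case/eqP: nIJ; rewrite IE JE.
- exists J'; split=> //; right; rewrite IE JE cvecv // opprD addrA subrr.
  exact: sub0r.
- exists I'; split=> //; left; rewrite IE JE cvecv // addrC addrA [- _ + _]addrC subrr.
  exact: add0r.
- have [] := IH u I' J' pu cI' cJ' I's J's uI uJ.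
    by apply: contra nIJ => /eqP E; rewrite IE JE E.
  move=> M [cM MS D]; exists M; split=> //.
    by apply: subset_trans MS _; apply/subsetP => x; rewrite !inE orbC => ->.
  by move: D; rewrite IE JE !cvecv // opprD addrACA subrr add0r.
Qed.

Lemma AGin_center v C : v \notin C -> {in AGin C, forall H : sp, (delta_mx 0 v : V) \in H}.
Proof.
move=> vC H /AGinP[I [_ IC ->]]; rewrite hyp_delta.
by apply: contra vC; apply: (subsetP IC).
Qed.

(** Each new end vertex is a modular step: its unit vector lies in the center of the arrangement of
    the rest, and [path_diff] supplies the differences. *)
Lemma IF_path s : ispath e s -> exists P, IFpair fullv (AGin (vset s)) P.
Proof.
elim: s => [|v s IH] pp.
  rewrite (_ : vset [::] = set0) ?AGin0; first by exists [::]; exact: IF_empty.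
  by apply/setP => x; rewrite !inE.
have ps : ispath e s by apply: (@ispath_sub _ _ [:: v] _ [::]); rewrite cats0.
have [P IF] := IH ps; have [vn _] := path_head pp.
rewrite vset_cons AGin_add; set fs := [seq _ | _ <- _ & _].
have fsP f : f \in fs -> exists I, [/\ conn I, I \subset vset (v :: s), v \in I & f = cvec I].
  case/mapP => I; rewrite mem_filter => /andP[/and3P[cI Is vI] _] ->.
  by exists I; rewrite vset_cons.
exists ([::] ++ nseq (fs != [::]) (arr fullv fs) ++ P).
apply: (@IF_modular n fullv _ [::] P (delta_mx 0 v)) => //.
- exact: memvf.
- by apply: AGin_center; rewrite inE.
- by move=> f /fsP[I [_ _ vI ->]]; rewrite ev_cvec_delta vI.
- by rewrite map_inj_uniq; [apply: filter_uniq; apply: enum_uniq | apply: cvec_inj].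
- move=> f g /fsP[I [cI Is vI ->]] /fsP[J [cJ Js vJ ->]] ne.
  have nIJ : I != J by apply: contraNneq ne => ->.
  have [M [cM MS [->|->]]] := path_diff pp cI cJ Is Js vI vJ nIJ.
    by apply/AGinP; exists M.
  by rewrite hyp_opp; apply/AGinP; exists M.
Qed.

End Assemble.

(** * Linear forms of a tailed triangle *)

Section Triangle.
Local Open Scope ring_scope.
Variables (n : nat) (e : rel 'I_n).
Hypotheses (e_sym : symmetric e) (e_irr : irreflexive e).
Variables q x0 x1 : 'I_n.
Local Notation V := 'rV[rat]_n.
Local Notation sp := {vspace V}.
Local Notation conn := (conn e).
Local Notation adj := (adj e).
Local Notation coord x := (cvec [set x]).
Implicit Types (C D I J M : {set 'I_n}) (x v u z : 'I_n) (s : seq 'I_n).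

(* In these coordinates the hyperplanes of the tailed triangle are those of [Gam]. *)
Definition ta : 'cV[rat]_n := 2^-1 *: (coord q + coord x0).
Definition tb : 'cV[rat]_n := 2^-1 *: (coord q - coord x0).
(** Half of [q] and of [x0] plus the tail from [x1] to [v]. Subtracting or adding [ta] removes or
    completes both halves, [tb] moves them to [x0] or to [q], and the difference with an earlier
    [ctop] is an end segment of the tail: these are the sums over the connected sets through [v]. *)
Fixpoint ctop s : 'cV[rat]_n := if s is v :: s' then ctop s' + coord v else ta.
Fixpoint tcs s : seq 'cV[rat]_n := if s is v :: s' then ctop s :: tcs s' else [::].
Local Notation ends := (ends ta tb).
Local Notation Gam := (Gam ta tb).

Lemma taDtb : ta + tb = coord q.
Proof. by apply/colP => i; rewrite !mxE; field. Qed.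
Lemma taBtb : ta - tb = coord x0.
Proof. by apply/colP => i; rewrite !mxE; field. Qed.
Lemma taDta : ta + ta = coord q + coord x0.
Proof. by apply/colP => i; rewrite !mxE; field. Qed.

Lemma ev_coord x v : ev (coord x) (delta_mx 0 v : V) = (v == x)%:R.
Proof. by rewrite ev_cvec_delta inE. Qed.

Lemma ev_ctop v s : v \notin [:: q, x0 & s] -> ev (ctop s) (delta_mx 0 v : V) = 0.
Proof.
elim: s => [|u s IH] /=; rewrite !inE !negb_or.
  by case/andP=> vq v0; rewrite evZl evDl !ev_coord (negbTE vq) (negbTE v0) addr0 mulr0.
case/and4P=> vq v0 vu vs; rewrite evDl ev_coord (negbTE vu) addr0.
by apply: IH; rewrite !inE !negb_or vq v0.
Qed.

Lemma ev_tcs v s : v \notin [:: q, x0 & s] ->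
  {in [:: ta, tb & tcs s], forall f, ev f (delta_mx 0 v : V) = 0}.
Proof.
move=> vs f; rewrite !inE => /or3P[/eqP->|/eqP->|].
- move: vs; rewrite !inE !negb_or => /and3P[vq v0 _].
  by rewrite evZl evDl !ev_coord (negbTE vq) (negbTE v0) addr0 mulr0.
- move: vs; rewrite !inE !negb_or => /and3P[vq v0 _].
  by rewrite evZl evBl !ev_coord (negbTE vq) (negbTE v0) subr0 mulr0.
elim: s vs => [|u s IH] //= vs; rewrite inE => /orP[/eqP->|].
  exact: (@ev_ctop v (u :: s)).
by apply: IH; move: vs; rewrite !inE !negb_or => /and4P[-> -> _ ->].
Qed.

Lemma dual_tcs s : uniq [:: q, x0 & s] ->
  dual fullv [:: ta, tb & tcs s] /\ uniq [:: ta, tb & tcs s].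
Proof.
elim: s => [|v s IH] us.
  have nq : q != x0 by move: us; rewrite /= inE andbT.
  have nx : x0 != q by rewrite eq_sym.
  have aq : ev ta (delta_mx 0 q : V) = 2^-1.
    by rewrite evZl evDl !ev_coord eqxx (negbTE nq) addr0 mulr1.
  have a0 : ev ta (delta_mx 0 x0 : V) = 2^-1.
    by rewrite evZl evDl !ev_coord eqxx (negbTE nx) add0r mulr1.
  have bq : ev tb (delta_mx 0 q : V) = 2^-1.
    by rewrite evZl evBl !ev_coord eqxx (negbTE nq) subr0 mulr1.
  have b0 : ev tb (delta_mx 0 x0 : V) = - 2^-1.
    by rewrite evZl evBl !ev_coord eqxx (negbTE nx) sub0r mulrN1.
  have nab : ta != tb.
    by apply/eqP => E; move: b0; rewrite -E a0 => /eqP; vm_compute.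
  split; last by rewrite /= inE nab.
  move=> f; rewrite !inE => /orP[/eqP->|/eqP->].
    exists (delta_mx 0 q + delta_mx 0 x0); first exact: memvf.
    move=> g; rewrite !inE => /orP[/eqP->|/eqP->]; rewrite evDr ?aq ?a0 ?bq ?b0.
      by rewrite eqxx; apply/eqP; vm_compute.
    by rewrite eq_sym (negbTE nab) subrr.
  exists (delta_mx 0 q - delta_mx 0 x0); first exact: memvf.
  move=> g; rewrite !inE => /orP[/eqP->|/eqP->]; rewrite evBr ?aq ?a0 ?bq ?b0.
    by rewrite (negbTE nab) subrr.
  by rewrite eqxx; apply/eqP; vm_compute.
have [vs us'] : v \notin [:: q, x0 & s] /\ uniq [:: q, x0 & s].
  move: us; rewrite /= !inE !negb_or => /and3P[/and3P[h1 h2 h3] /andP[h4 h5] /andP[h6 ->]].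
  by rewrite [v == q]eq_sym [v == x0]eq_sym h1 h2 h3 h4 h5 h6.
have [d u] := IH us'.
have cv : ev (ctop (v :: s)) (delta_mx 0 v : V) = 1.
  by rewrite /= evDl ev_ctop // ev_coord eqxx add0r.
have cn : ctop (v :: s) \notin [:: ta, tb & tcs s].
  by apply/negP => /(ev_tcs vs); rewrite cv => /eqP; rewrite oner_eq0.
split.
  have := dual_cons d (memvf _) (ev_tcs vs) cv; apply: dual_sub => f.
  by rewrite /= !inE => /or4P[]->; rewrite ?orbT.
move: cn u; rewrite /= !inE !negb_or => /and3P[h1 h2 h3] /andP[/andP[h4 h5] /andP[h6 h7]].
by rewrite [ta == ctop s + _]eq_sym [tb == ctop s + _]eq_sym h1 h2 h3 h4 h5 h6.
Qed.

Hypotheses (e_q0 : e q x0) (e_q1 : e q x1) (e_01 : e x0 x1).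

(* [s] lists the tail of the triangle [q], [x0], [x1] from its free end to [x1]. *)
Definition tail s := [/\ ispath e (s ++ [:: x0]), q \notin s ++ [:: x0],
  {in s, forall z, e q z = (z == x1)} & s != [::] -> last x0 s = x1].

Lemma tail_behead v s : tail (v :: s) -> tail s.
Proof.
case=> pp qn nq lt; split.
- by apply: (@ispath_sub _ _ [:: v] _ [::]); rewrite cats0.
- by move: qn; rewrite inE negb_or => /andP[].
- by move=> z zs; apply: nq; rewrite inE zs orbT.
- by case: s lt {pp qn nq} => //= u s; apply.
Qed.

Lemma tail_uniq s : tail s -> uniq [:: q, x0 & s].
Proof.
case=> -[u _] qn _ _; rewrite (@perm_uniq _ _ (q :: s ++ [:: x0])).
  by rewrite cons_uniq qn.
by rewrite perm_cons perm_sym perm_catC.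
Qed.

(** At [v = x1] the four choices of [q] and [x0] give the four forms. Beyond it [v] is a leaf at
    [u]: the set of [v] alone gives [g = ctop (u :: s)], the others extend the sets through [u],
    shifting both sides by the coordinate of [v]. The entry [- tb] stands apart because its form
    [b + c] belongs to the block [sums]. *)
Lemma tail_end s v (f : 'cV[rat]_n) : tail (v :: s) ->
  (f \in [seq cvec M | M <- enum {set 'I_n} &
     [&& conn M, M \subset v |: vset [:: q, x0 & s] & v \in M]]) =
  (f \in [seq ctop (v :: s) - g | g <- - tb :: ends (tcs s)]).
Proof.
elim: s v f => [|u s IH] v f tt; have uu := tail_uniq tt.
  have vE : v = x1 by case: tt => _ _ _; apply.
  subst v.
  have [/andP[q0 q1] x01] : (q != x0) && (q != x1) /\ x0 != x1.
    by move: uu; rewrite /= !inE !negb_or andbT => /andP.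
  have d1 : [disjoint [set q] & [set x1]] by rewrite disjoints1 inE.
  have d2 : [disjoint [set x0] & [set x1]] by rewrite disjoints1 inE.
  have d4 : [disjoint [set q] & [set x0]] by rewrite disjoints1 inE.
  have d3 : [disjoint [set q] :|: [set x0] & [set x1]].
    by rewrite disjoints_subset subUset -!disjoints_subset d1.
  have E1 : ta + coord x1 - ta = coord x1 by rewrite addrC addKr.
  have E2 : ta + coord x1 - - ta = cvec ([set q] :|: [set x0] :|: [set x1]).
    by rewrite !cvecU // opprK addrAC taDta.
  have E3 : ta + coord x1 - tb = cvec ([set x0] :|: [set x1]).
    by rewrite cvecU // addrAC taBtb.
  have E4 : ta + coord x1 - - tb = cvec ([set q] :|: [set x1]).
    by rewrite cvecU // opprK addrAC taDtb.
  have c1 := conn1 e_sym.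
  have c2 x y : e x y -> conn ([set x] :|: [set y]).
    move=> exy; apply: connU => //; apply/adjP; exists x, y; by rewrite !inE.
  have c3 : conn ([set q] :|: [set x0] :|: [set x1]).
    apply: connU => //; first exact: c2.
    by apply/adjP; exists q, x1; rewrite !inE eqxx.
  (* Such a set is determined by whether it contains [q] and [x0]; all four are connected in a
     triangle. *)
  have ME M : M \subset x1 |: vset [:: q; x0] -> x1 \in M ->
      M = (if q \in M then if x0 \in M then [set q] :|: [set x0] else [set q]
           else if x0 \in M then [set x0] else set0) :|: [set x1].
    move=> /subsetP MS x1M; apply/setP => z.
    have := MS z; rewrite !inE => {}MS.
    have [->|zx1] := eqVneq z x1; first by rewrite x1M orbT.
    have [->|zq] := eqVneq z q.
      by case: (q \in M); case: (x0 \in M); rewrite !inE ?eqxx // ?(negbTE q0).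
    have [->|z0] := eqVneq z x0.
      by case: (boolP (q \in M)) => _; case: (boolP (x0 \in M)) => _;
        rewrite !inE ?eqxx ?orbT // eq_sym (negbTE q0).
    move: MS; rewrite (negbTE zx1) (negbTE zq) (negbTE z0) /= => MS.
    have -> : z \in M = false by apply/negP => /MS.
    by case: (q \in M); case: (x0 \in M); rewrite !inE ?(negbTE zq) ?(negbTE z0).
  rewrite /= !inE E1 E2 E3 E4; apply/idP/idP => [/mapP[M]|].
    rewrite mem_filter => /andP[/and3P[cM MS x1M] _] ->; rewrite (ME M MS x1M).
    by case: (q \in M); case: (x0 \in M); rewrite ?set0U eqxx ?orbT.
  move=> h; apply/mapP; case/or4P: h => /eqP->.
  - exists ([set q] :|: [set x1]); rewrite ?E4 // mem_filter mem_enum c2 //= andbT.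
    rewrite !inE eqxx orbT andbT; apply/subsetP => z; rewrite !inE.
    by case/orP=> ->; rewrite ?orbT.
  - exists [set x1]; rewrite ?E1 // mem_filter mem_enum c1 //= andbT.
    by rewrite !inE eqxx andbT; apply/subsetP => z; rewrite !inE => ->.
  - exists ([set q] :|: [set x0] :|: [set x1]); rewrite ?E2 // mem_filter mem_enum c3 //= andbT.
    rewrite !inE eqxx orbT andbT; apply/subsetP => z; rewrite !inE.
    by case/orP=> [/orP[]|] ->; rewrite ?orbT.
  - exists ([set x0] :|: [set x1]); rewrite ?E3 // mem_filter mem_enum c2 //= andbT.
    rewrite !inE eqxx orbT andbT; apply/subsetP => z; rewrite !inE.
    by case/orP=> ->; rewrite ?orbT.
have tu := tail_behead tt.
case: (tt) => pp qn nq lt; have [vn nb] := path_head pp.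
have vD : v \notin vset [:: q, x0, u & s].
  move: uu; rewrite /= !inE !negb_or.
  case/and3P=> /and4P[_ h1 _ _] /and3P[h2 _ _] /andP[/andP[h3 h4] _].
  by rewrite [v == q]eq_sym [v == x0]eq_sym h1 h2 h3 h4.
have uD : u \in vset [:: q, x0, u & s] by rewrite !inE eqxx !orbT.
have evu : e v u by apply: (@ispath_edge _ _ [::] v u (s ++ [:: x0])).
have nbD : {in vset [:: q, x0, u & s], forall x, e v x -> x = u}.
  move=> x; rewrite !inE => xD evx.
  have [xq|xq] := eqVneq x q.
    (* Within the tail [q] is adjacent only to [x1], which is the last entry of [u :: s] and hence
       different from [v]. *)
    move: evx; rewrite xq e_sym nq ?mem_head // => /eqP vx1; exfalso.
    move: vD; rewrite vx1 !inE !negb_or => /and4P[_ _ h1 h2].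
    have := mem_last u s; move: (lt isT) => /= ->.
    by rewrite inE (negbTE h1) (negbTE h2).
  apply: nb => //; rewrite /= !inE mem_cat !inE.
  by move: xD; rewrite (negbTE xq) /= => /or3P[]->; rewrite ?orbT.
have DE : vset [:: q, x0, u & s] = u |: vset [:: q, x0 & s].
  by apply/setP => z; rewrite !inE; case: (z == u); rewrite ?orbT.
have cvecv M : M \subset vset [:: q, x0, u & s] -> cvec (v |: M) = coord v + cvec M.
  move=> MS; apply: cvecU; rewrite disjoints1.
  by apply: contra vD; apply: (subsetP MS).
apply/idP/idP => [/mapP[M]|/mapP[g]].
  rewrite mem_filter => /andP[/and3P[cM MS vM] _] ->.
  apply/mapP; case: (conn_pendant e_sym vD nbD cM MS vM) => [->|[J [cJ JS uJ ->]]].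
    exists (ctop (u :: s)); first by rewrite !inE eqxx !orbT.
    by rewrite /= addrC addKr.
  have : cvec J \in [seq cvec M | M <- enum {set 'I_n} &
     [&& conn M, M \subset u |: vset [:: q, x0 & s] & u \in M]].
    by apply: map_f; rewrite mem_filter mem_enum cJ -DE JS uJ.
  rewrite (IH u _ tu) => /mapP[g gi E]; exists g.
    by move: gi; rewrite !inE => /orP[->//|->]; rewrite !orbT.
  by rewrite cvecv // E [LHS]addrCA addrA.
rewrite inE => gi ->; apply/mapP; have {gi} [->|gi] : g = ctop (u :: s) \/ g \in - tb :: ends (tcs s).
  by case/orP: gi => [/eqP->|]; [right; exact: mem_head |];
    rewrite /= inE => /orP[/eqP->|gi]; [left | right; rewrite inE gi orbT].
- exists [set v]; last by rewrite /= addrC addKr.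
  by rewrite mem_filter mem_enum conn1 //= sub1set !inE eqxx.
have : ctop (u :: s) - g \in [seq ctop (u :: s) - g | g <- - tb :: ends (tcs s)].
  exact: (map_f (fun g => ctop (u :: s) - g)).
rewrite -(IH u _ tu) => /mapP[J]; rewrite mem_filter -DE => /andP[/and3P[cJ JS uJ] _] E.
exists (v |: J).
  rewrite mem_filter mem_enum (conn_add e_sym vD uD evu cJ JS uJ) setUS //=.
  by rewrite !inE eqxx.
by rewrite cvecv // -E [RHS]addrCA addrA.
Qed.

(** [a + b], [a - b] and [2 a] are the coordinates of [q], of [x0] and their sum, which settles the
    single edge. Each tail vertex then contributes the sets through it, translated by [tail_end]. *)
Lemma AGin_triangle s : tail s ->
  AGin e (vset [:: q, x0 & s]) = arr fullv (flatten (Gam false (tcs s))).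
Proof.
elim: s => [|v s IH] tt.
  have q0 : q != x0 by have := tail_uniq tt; rewrite /= inE andbT.
  have d4 : [disjoint [set q] & [set x0]] by rewrite disjoints1 inE.
  have c1 := conn1 e_sym.
  have c2 : conn ([set q] :|: [set x0]).
    by apply: connU => //; apply/adjP; exists q, x0; rewrite !inE.
  have hD : hyp fullv (tb + ta) = hyp fullv (coord q) by rewrite addrC taDtb.
  have hB : hyp fullv (tb - ta) = hyp fullv (coord x0).
    by rewrite -opprB hyp_opp taBtb.
  have hA : hyp fullv ta = hyp fullv (cvec ([set q] :|: [set x0])).
    by rewrite hyp_scale // cvecU.
  apply/fsetP => H; apply/AGinP/arrP => [[I [cI IS ->]]|[f]].
    have ME : I = (if q \in I then [set q] else set0) :|:
                  (if x0 \in I then [set x0] else set0).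
      apply/setP => z; have := subsetP IS z; rewrite !inE.
      have [->|zq] := eqVneq z q.
        by case: (q \in I); case: (x0 \in I); rewrite !inE ?eqxx ?(negbTE q0).
      have [->|z0] := eqVneq z x0.
        by case: (q \in I); case: (x0 \in I); rewrite !inE ?eqxx ?orbT // eq_sym (negbTE q0).
      move=> h; have -> : z \in I = false by apply/negP => /h.
      by case: (q \in I); case: (x0 \in I); rewrite !inE ?(negbTE zq) ?(negbTE z0).
    have I0 := conn_neq0 cI; move: I0; rewrite ME.
    case: (q \in I); case: (x0 \in I); rewrite ?setU0 ?set0U ?eqxx // => _.
    - by exists ta; [rewrite Gam_cat mem_cat !inE eqxx ?orbT | rewrite hA].
    - by exists (tb + ta); [rewrite Gam_cat mem_cat !inE eqxx ?orbT | rewrite hD].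
    - by exists (tb - ta); [rewrite Gam_cat mem_cat !inE eqxx ?orbT | rewrite hB].
  rewrite Gam_cat mem_cat /= !inE => /orP[/orP[]|] /eqP-> ->.
  - by exists [set q]; split; rewrite ?hD // sub1set !inE eqxx.
  - by exists [set x0]; split; rewrite ?hB // sub1set !inE eqxx orbT.
  - exists ([set q] :|: [set x0]); split; rewrite ?hA //.
    by rewrite subUset !sub1set !inE !eqxx orbT.
have -> : vset [:: q, x0, v & s] = v |: vset [:: q, x0 & s].
  by apply/setP => z; rewrite !inE; case: (z == v); rewrite ?orbT.
rewrite AGin_add IH; last exact: tail_behead tt.
rewrite [tcs (v :: s)]/= Gam_cons -/(ctop (v :: s)).
have -> : arr fullv [seq cvec M | M <- enum {set 'I_n} &
     [&& conn M, M \subset v |: vset [:: q, x0 & s] & v \in M]] =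
   arr fullv ((tb + ctop (v :: s)) :: upper ta tb (ctop (v :: s)) (tcs s)).
  apply/fsetP => H; apply/arrP/arrP => -[f fi ->]; exists f => //.
    move: fi; rewrite (tail_end _ tt) /= !inE opprK addrC.
    done.
  by rewrite (tail_end _ tt) /= inE opprK addrC.
by rewrite Gam_cat !arr_cons !arr_cat -!fsetUA; congr (_ `|` _)%fset; apply: fsetUCA.
Qed.

Lemma IF_tail s : tail s -> exists P, IFpair fullv (AGin e (vset [:: q, x0 & s])) P.
Proof.
move=> tt; have [d u] := dual_tcs (tail_uniq tt).
rewrite AGin_triangle //; exists [seq arr fullv B | B <- Gam false (tcs s)].
exact: IFpair_Gam.
Qed.

End Triangle.

(** * The equivalence *)

Lemma admissible_ind_factored (n : nat) (e : rel 'I_n) (D : {set 'I_n}) :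
  symmetric e -> irreflexive e -> admissible e D ->
  exists P, IFpair (fullv : {vspace 'rV[rat]_n}) (AGin e D) P.
Proof.
move=> e_sym e_irr [[p [pp _ ->]]|[q [x0 [x1 [t [[pp qn e0 e1 nt] ->]]]]]].
  exact: IF_path.
have e01 : e x0 x1 by apply: (@ispath_edge _ _ [::] x0 x1 t).
(* [tailed_triangle] lists the tail outward from the triangle, while [tail] starts at the free end,
   the vertex added last; hence the reversal. *)
have rE : rev (x1 :: t) ++ [:: x0] = rev [:: x0, x1 & t].
  by rewrite [in RHS]rev_cons cats1.
have [|P IFP] := @IF_tail n e e_sym q x0 x1 e0 e1 e01 (rev (x1 :: t)).
  split; rewrite ?rE ?mem_rev //.
  - exact: ispath_rev.
  - move=> z; rewrite mem_rev inE => /orP[/eqP->|zt]; first by rewrite e1 eqxx.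
    rewrite (negbTE (hasPn nt z zt)); apply/esym/negbTE.
    apply: contraTneq zt => ->; case: pp => /=.
    by case/and3P.
  - by rewrite rev_cons last_rcons.
exists P; rewrite (_ : vset _ = vset [:: q, x0 & rev (x1 :: t)]) //.
by apply/setP => z; rewrite !inE mem_rev inE.
Qed.

Theorem mainTheorem6 (n : nat) (e : rel 'I_n) :
  symmetric e -> irreflexive e ->
  factored (fullv : {vspace 'rV[rat]_n}) (AG e) <->
  ind_factored (fullv : {vspace 'rV[rat]_n}) (AG e).
Proof.
move=> e_sym e_irr; split; last exact: ind_factored_factored.
case=> P /nice_coloring[col cc]; rewrite /ind_factored -AGin_setT.
apply: (IF_components e_sym) => D cD.
by apply: admissible_ind_factored => //; apply: (conn_admissible e_sym e_irr cc).
Qed.
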